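(* Let $n\ge 1$. There is a bijection between the following sets: (1) the set of all triangulations (generalized dissections) $\Gamma$ of $S(A_n)$ which contain $c_{P(1)}$ and have at least one complete triangle; (2) the set of all (isomorphism classes of basic) non-hereditary tilted algebras of type $A_n$.
   Context: $\Bbbk$ is an algebraically closed field, $A_n=\Bbbk\mathcal{Q}$ is the path algebra of the quiver $\mathcal{Q}:1\to2\to\cdots\to n$; modules are finitely generated right modules. An algebra is tilted of type $A_n$ if it is isomorphic to $\operatorname{End}_{A_n}(T)$ for a tilting $A_n$-module $T$; here $T$ is taken basic and algebras are considered up to isomorphism. The surface $S(A_n)$. It is a closed disk with $n+3$ points on its boundary, in counterclockwise order $p,x_0,x_1,\dots,x_n,x_{n+1}$. The points $p,x_1,\dots,x_n$ are the marked points and $x_0,x_{n+1}$ are the two extra marked points. The disk carries the $n$ arcs $\Delta=\{px_1,\dots,px_n\}$, the arc $px_i$ corresponding to the vertex $i$ of $\mathcal{Q}$. Permissible curves in $S(A_n)$ (up to equivalence) are the curves joining two of these $n+3$ points, taken up to isotopy fixing endpoints and with minimal intersection; there is one for each pair of distinct points. A boundary segment is a segment of the boundary circle between two consecutive points among the $n+3$ points. A partial generalized dissection is a set of permissible curves, none homotopic to a boundary segment, any two of which do not meet in the interior of the disk; a generalized dissection is a maximal partial generalized dissection. Generalized dissections of $S(A_n)$ are exactly its triangulations. The curve $c_{P(1)}$, corresponding to the indecomposable projective module $P(1)$, is the curve joining $x_0$ and $x_{n+1}$. A triangle of $\Gamma$ is one of the triangles into which $\Gamma$ divides the disk (sides are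 curves of $\Gamma$ or boundary segments); it is complete if all its three sides belong to $\Gamma$. *)

(* Defs.v *)
From HB Require Import structures.
From mathcomp Require Import all_boot all_order all_algebra.

Set Implicit Arguments.
Unset Strict Implicit.
Unset Printing Implicit Defensive.

Import GRing.Theory.
Local Open Scope ring_scope.

Record quiver := Quiver {
  vertex : finType;
  arrow : finType;
  src : arrow -> vertex;
  tgt : arrow -> vertex }.

Section Paths.
Variable Q : quiver.

Fixpoint is_chain (v : vertex Q) (s : seq (arrow Q)) : bool :=
  if s is a :: s' then (src a == v) && is_chain (tgt a) s' else true.

(* A path is its starting vertex together with its sequence of arrows; the
   empty sequences give the stationary paths. The length is bounded by the
   number of vertices so as to obtain a finite type: when Q has no oriented
   cycle, every path has fewer arrows than there are vertices, so that nothing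
   is lost (see linear_chain_size for the quivers used here). *)
Definition qpath : predArgType :=
  {u : vertex Q * #|vertex Q|.-bseq (arrow Q) | is_chain u.1 u.2}.
HB.instance Definition _ := Finite.on qpath.

Definition psrc (p : qpath) : vertex Q := (val p).1.
Definition parrows (p : qpath) : seq (arrow Q) := (val p).2.
Definition ptgt (p : qpath) : vertex Q :=
  last (psrc p) (map (@tgt Q) (parrows p)).

(* r is the concatenation "first p, then q" *)
Definition is_concat (p q r : qpath) : bool :=
  [&& ptgt p == psrc q, psrc r == psrc p & parrows r == parrows p ++ parrows q].

End Paths.

(* The vector space with basis the paths of Q; f p is the coefficient of f at
   the path p. *)
Definition path_algebra (k : fieldType) (Q : quiver) : Type :=
  {ffun qpath Q -> k}.

Section PathAlgebra.
Variables (k : fieldType) (Q : quiver).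
Local Notation A := (path_algebra k Q).
Implicit Types (f g h : A) (p q r s u : qpath Q).

HB.instance Definition _ := GRing.Lmodule.copy A {ffun qpath Q -> k^o}.

Definition pa_one : A := [ffun p => (parrows p == [::])%:R].
Definition pa_mul f g : A :=
  [ffun r => \sum_p \sum_(q | is_concat p q r) f p * g q].

Lemma is_chain_cat (v : vertex Q) (s1 s2 : seq (arrow Q)) :
  is_chain v (s1 ++ s2) =
  is_chain v s1 && is_chain (last v (map (@tgt Q) s1)) s2.
Proof. by elim: s1 v => //= a s1 IH v; rewrite IH andbA. Qed.

Lemma qpath_eq p q : psrc p = psrc q -> parrows p = parrows q -> p = q.
Proof.
case: p q => [[v s] vs] [[w t] wt]; rewrite /psrc /parrows /= => e1 e2.
by apply/val_inj; rewrite /= e1; congr pair; apply: val_inj.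
Qed.

Lemma exists_qpath (v : vertex Q) (s : seq (arrow Q)) :
  is_chain v s -> (size s <= #|vertex Q|)%N ->
  exists p, psrc p = v /\ parrows p = s.
Proof.
move=> vs ss; pose b := Bseq ss.
have vb : is_chain (v, b).1 (v, b).2 by [].
by exists (exist _ (v, b) vb).
Qed.

Lemma chainP p : is_chain (psrc p) (parrows p).
Proof. exact: (valP p). Qed.

Lemma size_parrows p : (size (parrows p) <= #|vertex Q|)%N.
Proof. exact: size_bseq. Qed.

Definition is_concat3 p q u r : bool :=
  [&& ptgt p == psrc q, ptgt q == psrc u, psrc r == psrc p
    & parrows r == parrows p ++ parrows q ++ parrows u].

Lemma concat3_right p q u r (x : k) :
  \sum_(s | is_concat p s r && is_concat q u s) x =
  if is_concat3 p q u r then x else 0.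
Proof.
case: ifP => [/and4P[/eqP e1 /eqP e2 /eqP e3 /eqP e4]|no].
  have := chainP r; rewrite e3 e4 is_chain_cat => /andP[_].
  rewrite -/(ptgt p) e1 => ch.
  have sz : (size (parrows q ++ parrows u) <= #|vertex Q|)%N.
    apply: leq_trans (size_parrows r).
    by rewrite e4 [in leqRHS]size_cat leq_addl.
  have [s [s1 s2]] := exists_qpath ch sz.
  rewrite (big_pred1 s) // => t /=.
  apply/idP/eqP => [/andP[/and3P[/eqP a1 _ _] /and3P[_ /eqP a2 /eqP a3]]|->].
    by apply: qpath_eq; [rewrite s1 a2|rewrite s2 a3].
  by rewrite /is_concat s1 s2 e1 e2 e3 e4 !eqxx.
rewrite big_pred0 // => s; apply: contraFF no.
move=> /andP[/and3P[/eqP a1 /eqP a2 /eqP a3] /and3P[/eqP b1 /eqP b2 /eqP b3]].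
by rewrite /is_concat3 a1 b2 b1 a2 a3 b3 !eqxx.
Qed.

Lemma concat3_left p q u r (x : k) :
  \sum_(s | is_concat s u r && is_concat p q s) x =
  if is_concat3 p q u r then x else 0.
Proof.
case: ifP => [/and4P[/eqP e1 /eqP e2 /eqP e3 /eqP e4]|no].
  have := chainP r; rewrite e3 e4 catA is_chain_cat => /andP[ch _].
  have sz : (size (parrows p ++ parrows q) <= #|vertex Q|)%N.
    apply: leq_trans (size_parrows r).
    by rewrite e4 catA [in leqRHS]size_cat leq_addr.
  have [s [s1 s2]] := exists_qpath ch sz.
  have st : ptgt s = ptgt q.
    by rewrite /ptgt s1 s2 map_cat last_cat -/(ptgt p) e1.
  rewrite (big_pred1 s) // => t /=.
  apply/idP/eqP => [/andP[_ /and3P[_ /eqP a2 /eqP a3]]|->].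
    by apply: qpath_eq; [rewrite s1 a2|rewrite s2 a3].
  by rewrite /is_concat st s1 s2 e1 e2 e3 e4 catA !eqxx.
rewrite big_pred0 // => s; apply: contraFF no.
move=> /andP[/and3P[/eqP a1 /eqP a2 /eqP a3] /and3P[/eqP b1 /eqP b2 /eqP b3]].
have st : ptgt s = ptgt q.
  by rewrite /ptgt b2 b3 map_cat last_cat -/(ptgt p) b1.
by rewrite /is_concat3 -st a1 b1 a2 b2 a3 b3 catA !eqxx.
Qed.

Lemma pa_mulA : associative pa_mul.
Proof.
move=> f g h; apply/ffunP => r; rewrite !ffunE.
transitivity (\sum_p \sum_q \sum_u
    (if is_concat3 p q u r then f p * g q * h u else 0)).
  apply: eq_bigr => p _; rewrite big_mkcond /=.
  transitivity (\sum_s \sum_q \sum_u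
      (if is_concat p s r && is_concat q u s then f p * g q * h u else 0)).
    apply: eq_bigr => s _; case: (is_concat p s r) => /=; last first.
      by rewrite big1 // => q _; rewrite big1.
    rewrite ffunE big_distrr; apply: eq_bigr => q _.
    rewrite big_distrr /= big_mkcond; apply: eq_bigr => u _.
    by rewrite mulrA.
  rewrite exchange_big; apply: eq_bigr => q _.
  rewrite exchange_big; apply: eq_bigr => u _.
  by rewrite -big_mkcond concat3_right.
symmetry; transitivity (\sum_s \sum_u \sum_p \sum_q
      (if is_concat s u r && is_concat p q s then f p * g q * h u else 0)).
  apply: eq_bigr => s _; rewrite big_mkcond; apply: eq_bigr => u _ /=.
  case: (is_concat s u r) => /=; last first.
    by rewrite big1 // => p _; rewrite big1.
  rewrite ffunE big_distrl; apply: eq_bigr => p _.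
  by rewrite big_distrl /= big_mkcond.
rewrite exchange_big.
transitivity (\sum_u \sum_p \sum_q
    (if is_concat3 p q u r then f p * g q * h u else 0)).
  apply: eq_bigr => u _; rewrite exchange_big; apply: eq_bigr => p _.
  rewrite exchange_big; apply: eq_bigr => q _.
  by rewrite -big_mkcond concat3_left.
by rewrite exchange_big; apply: eq_bigr => p _; rewrite exchange_big.
Qed.

Lemma pa_mul1l : left_id pa_one pa_mul.
Proof.
move=> f; apply/ffunP => r; rewrite ffunE.
have [e [e1 e2]] := @exists_qpath (psrc r) [::] isT isT.
have te : ptgt e = psrc r by rewrite /ptgt e1 e2.
rewrite (bigD1 e) //= [X in _ + X]big1 ?addr0 => [|p pe].
  rewrite (big_pred1 r) => [|q /=]; first by rewrite ffunE e2 mul1r.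
  rewrite /is_concat te e1 e2 eqxx /=.
  apply/idP/eqP => [/andP[/eqP a /eqP b]|->]; last by rewrite !eqxx.
  by apply: qpath_eq.
apply: big1 => q /and3P[/eqP a1 /eqP a2 /eqP a3]; rewrite ffunE.
case: eqP => [p0|_]; last by rewrite mul0r.
by case/eqP: pe; apply: qpath_eq; rewrite ?e1 ?e2.
Qed.

Lemma pa_mul1r : right_id pa_one pa_mul.
Proof.
move=> f; apply/ffunP => r; rewrite ffunE.
have [e [e1 e2]] := @exists_qpath (ptgt r) [::] isT isT.
rewrite (bigD1 r) //= [X in _ + X]big1 ?addr0 => [|p pr].
  rewrite (big_pred1 e) => [|q /=]; first by rewrite ffunE e2 mulr1.
  rewrite /is_concat eqxx -{1}[parrows r]cats0 eqseq_cat // eqxx /=.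
  apply/idP/eqP => [/andP[/eqP a /eqP b]|->]; last by rewrite e1 e2 !eqxx.
  by apply: qpath_eq; rewrite ?e1 ?e2.
apply: big1 => q /and3P[/eqP a1 /eqP a2 /eqP a3]; rewrite ffunE.
case: eqP => [q0|_]; last by rewrite mulr0.
by case/eqP: pr; apply: qpath_eq; rewrite ?a2 // a3 q0 cats0.
Qed.

Lemma pa_mulDl : left_distributive pa_mul +%R.
Proof.
move=> f g h; apply/ffunP => r; rewrite !ffunE -big_split /=.
apply: eq_bigr => p _; rewrite -big_split /=; apply: eq_bigr => q _.
by rewrite ffunE mulrDl.
Qed.

Lemma pa_mulDr : right_distributive pa_mul +%R.
Proof.
move=> f g h; apply/ffunP => r; rewrite !ffunE -big_split /=.
apply: eq_bigr => p _; rewrite -big_split /=; apply: eq_bigr => q _.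
by rewrite ffunE mulrDr.
Qed.

HB.instance Definition _ := GRing.Zmodule_isPzRing.Build A
  pa_mulA pa_mul1l pa_mul1r pa_mulDl pa_mulDr.

Lemma path_algebra_scaleAl (c : k) f g : c *: (f * g) = (c *: f) * g.
Proof.
apply/ffunP => r; rewrite !ffunE [LHS]big_distrr /=; apply: eq_bigr => p _.
by rewrite big_distrr /=; apply: eq_bigr => q _; rewrite ffunE [LHS]mulrA.
Qed.

Lemma path_algebra_scaleAr (c : k) f g : c *: (f * g) = f * (c *: g).
Proof.
apply/ffunP => r; rewrite !ffunE [LHS]big_distrr /=; apply: eq_bigr => p _.
by rewrite big_distrr /=; apply: eq_bigr => q _; rewrite ffunE [LHS]mulrCA.
Qed.

End PathAlgebra.

(* The quiver 1 -> 2 -> ... -> n, the vertex i being numbered i - 1 in 'I_n.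
   There is one arrow for each pair of vertices (i, i + 1). *)
Definition linear_arrow (n : nat) : predArgType :=
  {a : 'I_n * 'I_n | a.2 == a.1.+1 :> nat}.
HB.instance Definition _ n := Finite.on (linear_arrow n).

Definition linear_quiver (n : nat) : quiver :=
  @Quiver 'I_n (linear_arrow n) (fun a => (val a).1) (fun a => (val a).2).

Lemma linear_chain_size n (v : vertex (linear_quiver n))
    (s : seq (arrow (linear_quiver n))) :
  is_chain v s -> (size s < #|vertex (linear_quiver n)|)%N.
Proof.
have -> : #|vertex (linear_quiver n)| = n by rewrite card_ord.
move=> vs; suff : (v + size s < n)%N by apply: leq_ltn_trans; rewrite leq_addl.
elim: s v vs => [|a s IH] v /=; first by rewrite addn0 ltn_ord.
case/andP=> /eqP <- /IH; rewrite /src /tgt /= (eqP (valP a)).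
by rewrite addSnnS.
Qed.

Notation linear_path_algebra k n := (path_algebra k (linear_quiver n)).

(* A right module over R is a left module over the converse ring R^c. *)
Notation rmodType R := (lmodType R^c).

Section RightModules.
Variable R : pzRingType.
Implicit Types M N X Y Z T : rmodType R.

Definition rmod_iso M N : Prop := exists f : {linear M -> N}, bijective f.

Definition finitely_generated M : Prop :=
  exists (m : nat) (g : 'I_m -> M),
    forall x : M, exists c : 'I_m -> R^c, x = \sum_i c i *: g i.

Definition projective P : Prop :=
  forall M N (g : {linear M -> N}) (f : {linear P -> N}),
    (forall y, exists x, g x = y) ->
    exists h : {linear P -> M}, forall x, g (h x) = f x.

Definition indecomposable M : Prop :=
  (exists x : M, x <> 0) /\
  forall X Y : rmodType R, rmod_iso M (X * Y)%type ->
    (forall x : X, x = 0) \/ (forall y : Y, y = 0).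

Definition short_exact X Y Z (f : {linear X -> Y}) (g : {linear Y -> Z}) :=
  [/\ injective f,
      forall y, g y = 0 <-> exists x, f x = y
    & forall z, exists y, g y = z].

Definition pd_le1 M : Prop :=
  exists (P1 P0 : rmodType R) (f : {linear P1 -> P0}) (g : {linear P0 -> M}),
    [/\ projective P1, projective P0 & short_exact f g].

(* Vanishing of the Yoneda group Ext^1(M, N) *)
Definition Ext1_zero M N : Prop :=
  forall (E : rmodType R) (f : {linear N -> E}) (g : {linear E -> M}),
    short_exact f g -> exists s : {linear M -> E}, forall x, g (s x) = x.

(* X is (isomorphic to) a direct summand of a finite power of T *)
Definition in_add T X : Prop :=
  exists (m : nat) (i : {linear X -> {ffun 'I_m -> T}})
         (p : {linear {ffun 'I_m -> T} -> X}), forall x, p (i x) = x.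

Definition tilting T : Prop :=
  [/\ finitely_generated T, pd_le1 T, Ext1_zero T T
    & exists (T' T'' : rmodType R)
             (f : {linear (R^c)^o -> T'}) (g : {linear T' -> T''}),
        [/\ in_add T T', in_add T T'' & short_exact f g]].

Definition is_direct_sum (m : nat) (X : 'I_m -> rmodType R) M : Prop :=
  exists (i : forall j, {linear X j -> M}) (p : forall j, {linear M -> X j}),
    [/\ forall j x, p j (i j x) = x,
        forall j l x, j != l -> p l (i j x) = 0
      & forall x, x = \sum_j i j (p j x)].

Definition basic_module M : Prop :=
  exists (m : nat) (X : 'I_m -> rmodType R),
    [/\ is_direct_sum X M, forall j, indecomposable (X j)
      & forall j l, rmod_iso (X j) (X l) -> j = l].

(* Every right ideal of R is a projective module; a right ideal is presented
   by an injective morphism into the regular right module. *)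
Definition hereditary : Prop :=
  forall (I : rmodType R) (i : {linear I -> (R^c)^o}),
    injective i -> projective I.

End RightModules.

Section Tilted.
Variable k : fieldType.

Definition alg_iso (B C : algType k) : Prop :=
  exists f : {lrmorphism B -> C}, bijective f.

Definition iso_class (B : algType k) : algType k -> Prop := alg_iso B.

Definition pa_scalar (Q : quiver) (c : k) : path_algebra k Q :=
  c *: (1 : path_algebra k Q).

(* B is isomorphic, as a k-algebra, to the algebra of endomorphisms of the
   right module T, multiplied by composition; a scalar c acts on T as the
   element c *: 1 of the path algebra. *)
Definition is_End_algebra (Q : quiver) (T : rmodType (path_algebra k Q))
    (B : algType k) : Prop :=
  exists rho : B -> {linear T -> T},
    [/\ forall b c x, rho (b + c) x = rho b x + rho c x,
        forall b c x, rho (b * c) x = rho b (rho c x),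
        forall x, rho 1 x = x
      & forall (a : k) b x,
          rho (a *: b) x = (pa_scalar Q a : (path_algebra k Q)^c) *: rho b x] /\
    (forall b c, rho b =1 rho c -> b = c) /\
    (forall f : {linear T -> T}, exists b, rho b =1 f).

Definition tilted_algebra (n : nat) (B : algType k) : Prop :=
  exists T : rmodType (linear_path_algebra k n),
    [/\ tilting T, basic_module T & is_End_algebra T B].

End Tilted.

(* The n + 3 points p, x_0, ..., x_(n+1) on the boundary circle, numbered in
   their cyclic order: p is 0 and x_i is i + 1. *)
Definition point (n : nat) : predArgType := 'I_n.+3.
HB.instance Definition _ n := Finite.on (point n).

Definition pt_x (n i : nat) : point n := inord i.+1.

Section Surface.
Variable n : nat.
Implicit Types (c d t : {set point n}) (G : {set {set point n}}).

(* A permissible curve is determined up to isotopy by its two end points. *)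
Definition is_curve c : bool := #|c| == 2.

Definition is_boundary_segment c : bool :=
  [exists a : 'I_n.+3, c == [set a; ordS a]].

(* For curves c and d: the end points of c and d alternate on the circle, i.e.
   c and d, in minimal position, meet in the interior of the disk. *)
Definition interleave c d : bool :=
  [exists a : 'I_n.+3, exists b : 'I_n.+3,
   exists u : 'I_n.+3, exists v : 'I_n.+3,
    [&& c == [set a; b], d == [set u; v] & (a < u < b)%N && (b < v)%N]].
Definition cross c d : bool := interleave c d || interleave d c.

Definition partial_dissection G : bool :=
  [forall c in G, is_curve c && ~~ is_boundary_segment c] &&
  [forall c in G, forall d in G, ~~ cross c d].

Definition generalized_dissection G : bool := maxset partial_dissection G.

(* A triangle of G is given by its three vertices. All the points are on the
   boundary of the disk, so the curvilinear triangle bounded by three such sides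
   contains no point in its interior and is not divided further by G. *)
Definition is_triangle G t : bool :=
  (#|t| == 3) &&
  [forall a in t, forall b in t, (a != b) ==>
     (([set a; b] \in G) || is_boundary_segment [set a; b])].

Definition is_complete_triangle G t : bool :=
  is_triangle G t &&
  [forall a in t, forall b in t, (a != b) ==> ([set a; b] \in G)].

Definition curve_P1 : {set point n} := [set pt_x n 0; pt_x n n.+1].

End Surface.

(* Main.v *)
Require Import Defs.
From HB Require Import structures.
From mathcomp Require Import all_boot all_order all_algebra.
From mathcomp Require Import boolp.
From mathcomp Require Import zify.

Set Implicit Arguments.
Unset Strict Implicit.
Unset Printing Implicit Defensive.

Import GRing.Theory.
Local Open Scope ring_scope.

(* Cutting off the triangle p x_0 x_(n+1), a triangulation containing c_P(1) is a
   triangulation of the polygon x_0 ... x_(n+1), and the curve x_l x_(b+1) corresponds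
   to the interval module M[l, b[ supported on the vertices l <= j < b. Two curves
   cross exactly when Ext^1 between the modules does not vanish one way or the other.
   Since every indecomposable module is an interval module, this matches
   triangulations with basic tilting modules T.

   The algebra End(T) has at most one-dimensional spaces e_x End(T) e_y, so it is
   determined by the relation "Hom(x, y) <> 0" on the curves, and conversely its
   characters recover this relation. It is hereditary iff the relation is transitive,
   and transitivity fails exactly at complete triangles.

   Seen from the side x_0 x_(n+1), the triangulation is a binary search tree. The
   arrows of End(T) are the edges of the tree, and a zero relation at a node tells
   its two children from its parent. One such node suffices to orient the whole
   tree, so that End(T) determines the triangulation. *)

(** * Linear maps and submodules *)

(** Vertices are numbered from 0 and paths act on the right, so [M[l, b[] is generated at l, its
    submodules are the final segments, and it is projective exactly when b = n; in particular [[0,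
    n[] is P(1). The endpoint x_(b+1) instead of x_b makes adjacent intervals [[l, b[] and [[b, d[]
    cross, as they must, since [[l, d[] is a non-split extension of the first by the second. The
    definition of a tilting module asks for a coresolution of the regular module in add T, and
    summands are never counted. From a tree, this coresolution has to be built, by moving each
    vertex down from the root to the triangle whose apex it labels; from a tilting module, the
    coresolution is what produces the summands required by maximality. At a node, the right child is
    a submodule of the parent and the left child is a quotient of it; their supports are disjoint,
    whence the zero relation. A tree without a branching node is a chain, which yields the same
    algebra when read from its other end: already for n = 2 the two triangulations give isomorphic
    algebras. This is why injectivity needs a complete triangle. *)

Section Generic.
Variable R : pzRingType.
Implicit Types M N U V W : lmodType R.

Lemma linear_intro U V (f : U -> V) :
  (forall u v, f (u + v) = f u + f v) -> (forall a u, f (a *: u) = a *: f u) ->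
  exists F : {linear U -> V}, F =1 f.
Proof.
move=> fD fZ.
have fL : linear f by move=> a u v; rewrite fD fZ.
pose m := GRing.isLinear.Build R U V *:%R f fL.
pose F : {linear U -> V} := HB.pack f m.
by exists F.
Qed.

Lemma factor_through U V W (j : {linear U -> V}) (f : {linear W -> V}) :
  injective j -> (forall w, exists u, j u = f w) ->
  exists F : {linear W -> U}, forall w, j (F w) = f w.
Proof.
move=> jI fj; pose g w := projT1 (cid (fj w)).
have gE w : j (g w) = f w by rewrite /g; case: cid.
have [||F FE] := @linear_intro _ _ g.
- by move=> u v; apply: jI; rewrite linearD !gE linearD.
- by move=> a u; apply: jI; rewrite linearZ !gE linearZ.
by exists F => w; rewrite FE.
Qed.

Lemma inverse_linear U V (f : {linear U -> V}) : bijective f ->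
  exists g : {linear V -> U}, cancel f g /\ cancel g f.
Proof.
move=> [h fh hf].
have [||g gE] := @linear_intro _ _ h.
- by move=> u v; apply: (can_inj fh); rewrite linearD !hf.
- by move=> a u; apply: (can_inj fh); rewrite linearZ !hf.
by exists g; split=> x; rewrite gE.
Qed.

End Generic.

Section SubModule.
Variables (R : pzRingType) (M : lmodType R) (P : M -> Prop).
Hypotheses (P0 : P 0) (PD : forall x y, P x -> P y -> P (x + y))
  (PZ : forall a x, P x -> P (a *: x)).

Definition submod_pred : {pred M} := fun x => `[< P x >].

Lemma submod_pred_closed : submod_closed submod_pred.
Proof.
split; first exact/asboolP.
by move=> a x y /asboolP Px /asboolP Py; apply/asboolP; apply: PD => //; apply: PZ.
Qed.

HB.instance Definition _ := GRing.isSubmodClosed.Build R M submod_pred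
  submod_pred_closed.

Definition submod_type : Type := {x : M | x \in submod_pred}.
HB.instance Definition _ := [isSub of submod_type for sval].
HB.instance Definition _ := [Choice of submod_type by <:].
HB.instance Definition _ := [SubChoice_isSubLmodule of submod_type by <:].

Lemma submodule_exists :
  exists (K : lmodType R) (j : {linear K -> M}),
    injective j /\ forall x, P x <-> exists u, j u = x.
Proof.
exists submod_type, (val : {linear submod_type -> M}); split; first exact: val_inj.
move=> x; split=> [Px|[u <-]]; last by have /asboolP := valP u.
have Px' : x \in submod_pred by apply/asboolP.
by exists (exist _ x Px').
Qed.

End SubModule.

Lemma eq_pair (A B : Type) (x y : A * B) : x.1 = y.1 -> x.2 = y.2 -> x = y.
Proof. by case: x y => [a b] [c d] /= -> ->. Qed.

Section RightModuleFacts.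
Variable R : pzRingType.
Implicit Types T X Y Z E : rmodType R.

(* Pull the extension E of Y by Z back along T -> Y, then add the complement of
   Z in T: this is an extension of T by T. *)
Lemma Ext1_zero_retract T Y Z (iY : {linear Y -> T}) (pY : {linear T -> Y})
    (iZ : {linear Z -> T}) (pZ : {linear T -> Z}) :
  cancel iY pY -> cancel iZ pZ -> Ext1_zero T T -> Ext1_zero Y Z.
Proof.
move=> iYK iZK extT E f g [fI gf gS].
pose P (u : (E * T * T)%type) := g u.1.1 = pY u.1.2 /\ pZ u.2 = 0.
have [||| E' [j [jI jP]]] := @submodule_exists R^c (E * T * T)%type P.
- by split; rewrite !linear0.
- by move=> x y [a b] [c d]; split; rewrite /= !linearD ?a ?c //= b d addr0.
- by move=> a x [c d]; split; rewrite /= !linearZ ?c //= d scaler0.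
have [||F0 F0E] := @linear_intro _ T (E * T * T)%type
    (fun t => (f (pZ t), 0, t - iZ (pZ t))).
- by move=> u v; rewrite !linearD /=; congr (_, _, _); rewrite ?addr0 //= addrACA.
- by move=> a u; rewrite !linearZ /=; congr (_, _, _); rewrite ?scaler0 //= -scalerDr.
have gf0 z : g (f z) = 0 by apply/gf; exists z.
have [|F FE] := @factor_through _ _ _ _ j F0 jI.
  move=> t; apply/jP; split; rewrite F0E /=; first by rewrite gf0 linear0.
  by rewrite linearB iZK subrr.
have [||G GE] := @linear_intro _ E' T (fun e => (j e).1.2).
- by move=> u v; rewrite linearD.
- by move=> a u; rewrite linearZ.
have ex : short_exact F G.
  split.
  - move=> x y /(congr1 j); rewrite !FE !F0E => -[/fI e1 e2].
    by move: e2; rewrite e1 => /addIr.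
  - move=> e; split=> [|[t <-]]; last by rewrite GE FE F0E.
    have [ge pe] : P (j e) by apply/jP; exists e.
    rewrite GE => e0; move: ge; rewrite e0 linear0 => /gf[z fz].
    exists (iZ z + (j e).2); apply: jI; rewrite FE F0E linearD iZK pe addr0 fz.
    rewrite addrC addKr -e0.
    by case: (j e) => [[]].
  - move=> t; have [e ge] := gS (pY t).
    have [u ju] : exists u, j u = (e, t, 0).
      by apply/jP; split; rewrite ?linear0.
    by exists u; rewrite GE ju.
have [s sE] := extT _ _ _ ex.
(* A section over [iY y] has its T-component equal to [iY y]; membership in the pullback then says
   that g sends its E-component to [pY (iY y) = y]. *)
have [||s0 s0E] := @linear_intro _ Y E (fun y => (j (s (iY y))).1.1).
- by move=> u v; rewrite !linearD.
- by move=> a u; rewrite !linearZ.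
exists s0 => y; rewrite s0E.
have [-> _] : P (j (s (iY y))) by apply/jP; exists (s (iY y)).
by rewrite -GE sE iYK.
Qed.

Lemma linear_ffunZ T X m (i : {linear X -> {ffun 'I_m -> T}}) (a : R^c) x l :
  i (a *: x) l = a *: i x l.
Proof. by rewrite linearZ ffunE. Qed.

Lemma in_add_prod T X Y : in_add T X -> in_add T Y -> in_add T (X * Y)%type.
Proof.
move=> [m1 [i1 [p1 ip1]]] [m2 [i2 [p2 ip2]]].
have [||i iE] := @linear_intro _ (X * Y)%type {ffun 'I_(m1 + m2) -> T}
  (fun x => [ffun j => match split j with inl j => i1 x.1 j | inr j => i2 x.2 j end]).
- by move=> u v; apply/ffunP => j; rewrite !ffunE !linearD; case: split => l; rewrite ffunE.
- by move=> a u; apply/ffunP => j; rewrite !ffunE !linearZ; case: split => l; rewrite ffunE.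
have [||p pE] := @linear_intro _ {ffun 'I_(m1 + m2) -> T} (X * Y)%type
  (fun t => (p1 [ffun j => t (lshift m2 j)], p2 [ffun j => t (rshift m1 j)])).
- move=> u v; apply: eq_pair => /=; rewrite -linearD; congr (_ _);
    by apply/ffunP => j; rewrite !ffunE.
- move=> a u; apply: eq_pair => /=; rewrite -linearZ; congr (_ _);
    by apply/ffunP => j; rewrite !ffunE.
exists (m1 + m2)%N, i, p => -[x y]; rewrite pE iE /=.
congr (_, _); [rewrite -[RHS]ip1|rewrite -[RHS]ip2]; congr (_ _); apply/ffunP => j; rewrite !ffunE.
  by rewrite -[lshift _ _]/(unsplit (inl j)) unsplitK.
by rewrite -[rshift _ _]/(unsplit (inr j)) unsplitK.
Qed.

End RightModuleFacts.

(** * The path algebra as an algebra of triangular matrices *)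

Section LinearPaths.
Variable n : nat.
Local Notation Q := (linear_quiver n).
Implicit Types p q r : qpath Q.

Lemma linear_chain_last (v : vertex Q) (s : seq (arrow Q)) : is_chain v s ->
  (last v (map (@tgt Q) s) : 'I_n) = ((v : 'I_n) + size s)%N :> nat.
Proof.
elim: s v => [|a s IH] v /=; first by rewrite addn0.
by case/andP=> /eqP <- /IH ->; rewrite /src /tgt /= (eqP (valP a)) addSnnS.
Qed.

Lemma linear_chain_inj (v : vertex Q) (s s' : seq (arrow Q)) :
  is_chain v s -> is_chain v s' -> size s = size s' -> s = s'.
Proof.
elim: s v s' => [|a s IH] v [|a' s'] //= /andP[/eqP va cs] /andP[/eqP va' cs'] [ss].
have aa : a = a'.
  move: va va' {cs cs' IH}; rewrite /src /=; case: a a' => [[i j] e1] [[i' j'] e2] /= e3 e4.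
  apply: val_inj; apply: eq_pair => /=; first by rewrite e3 e4.
  by apply: val_inj; rewrite /= (eqP e1) (eqP e2) /= e3 e4.
by subst a'; rewrite (IH _ _ cs cs').
Qed.

Lemma linear_chain_exists (i j : 'I_n) : (i <= j)%N ->
  exists s : seq (arrow Q), is_chain (i : vertex Q) s /\ size s = (j - i)%N.
Proof.
move: {2}(j - i)%N (erefl (j - i)%N) => d; elim: d i => [|d IH] i e ij.
  by exists [::]; rewrite e.
have i1 : (i.+1 < n)%N by have := ltn_ord j; lia.
have [||s [cs ss]] := IH (Ordinal i1); [by rewrite /=; lia|by rewrite /=; lia|].
have ax : (i, Ordinal i1).2 == (i, Ordinal i1).1.+1 :> nat by [].
exists ((exist _ (i, Ordinal i1) ax : linear_arrow n) :: s); split=> /=.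
  by rewrite eqxx.
by rewrite ss /=; lia.
Qed.

Lemma linear_path_tgt p : (ptgt p : 'I_n) = ((psrc p : 'I_n) + size (parrows p))%N :> nat.
Proof. exact/linear_chain_last/chainP. Qed.

Lemma linear_path_le p : ((psrc p : 'I_n) <= (ptgt p : 'I_n))%N.
Proof. by rewrite linear_path_tgt leq_addr. Qed.

Lemma linear_path_inj p q : psrc p = psrc q -> ptgt p = ptgt q -> p = q.
Proof.
move=> e1 e2; apply: qpath_eq => //.
apply: (@linear_chain_inj (psrc p)); rewrite ?chainP ?e1 ?chainP //.
by have := linear_path_tgt p; have := linear_path_tgt q; rewrite e1 e2; lia.
Qed.

Lemma linear_path_exists (i j : 'I_n) : (i <= j)%N ->
  exists p, psrc p = i /\ ptgt p = j.
Proof.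
move=> ij; have [s [cs ss]] := linear_chain_exists ij.
have [p [e1 e2]] := exists_qpath cs (ltnW (linear_chain_size cs)).
exists p; split=> //; apply: val_inj; rewrite /= linear_path_tgt e1 e2 ss.
exact: subnKC.
Qed.

Lemma linear_path_concat p q : ptgt p = psrc q ->
  exists r, is_concat p q r /\ ptgt r = ptgt q.
Proof.
move=> pq.
have [|r [e1 e2]] := @linear_path_exists (psrc p) (ptgt q).
  by apply: leq_trans (linear_path_le p) _; rewrite pq linear_path_le.
exists r; split=> //; rewrite /is_concat pq e1 !eqxx /=; apply/eqP.
have c : is_chain (psrc p) (parrows p ++ parrows q).
  by rewrite is_chain_cat chainP /= -/(ptgt p) pq chainP.
apply: linear_chain_inj c _; first by rewrite -e1 chainP.
have := linear_path_tgt p; have := linear_path_tgt q; have := linear_path_tgt r.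
by rewrite size_cat e1 e2 pq; lia.
Qed.

Lemma is_concat_ptgt p q r : is_concat p q r -> ptgt r = ptgt q.
Proof.
case/and3P=> /eqP e1 /eqP e2 /eqP e3.
by rewrite /ptgt e2 e3 map_cat last_cat -/(ptgt p) e1.
Qed.

End LinearPaths.

Section Coefficients.
Variables (k : fieldType) (n : nat).
Local Notation Q := (linear_quiver n).
Local Notation A := (linear_path_algebra k n).
Implicit Types f g : A.

(* There is at most one path from i to j, so the sum has at most one term. *)
Definition pcoef f (i j : 'I_n) : k :=
  \sum_(p : qpath Q | (psrc p == i) && (ptgt p == j)) (f p : k).

Definition of_pcoef (F : 'I_n -> 'I_n -> k) : A :=
  [ffun p : qpath Q => F (psrc p) (ptgt p)].

(** A matrix unit with indices in [nat], so that [hi s], which may equal n, can be an index: the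
    value is 0 as soon as b < a or b is not a vertex. *)
Definition punit (a b : nat) : A :=
  of_pcoef (fun i j => ((i == a :> nat) && (j == b :> nat))%:R).

Lemma pcoef_at f (p : qpath Q) : pcoef f (psrc p) (ptgt p) = f p.
Proof.
rewrite /pcoef (big_pred1 p) // => q /=; apply/andP/eqP => [[/eqP e1 /eqP e2]|->] //.
exact: linear_path_inj.
Qed.

Lemma pcoef_lt f (i j : 'I_n) : (j < i)%N -> pcoef f i j = 0.
Proof.
move=> ji; rewrite /pcoef big_pred0 // => p; apply/negP => /andP[/eqP e1 /eqP e2].
by have := linear_path_le p; rewrite e1 e2; lia.
Qed.

Lemma pcoef_inj f g : (forall i j, pcoef f i j = pcoef g i j) -> f = g.
Proof. by move=> e; apply/ffunP => p; rewrite -!pcoef_at e. Qed.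

Lemma of_pcoefK F (i j : 'I_n) : pcoef (of_pcoef F) i j = if (i <= j)%N then F i j else 0.
Proof.
case: leqP => ij; last by rewrite pcoef_lt.
have [p [<- <-]] := linear_path_exists ij.
by rewrite pcoef_at ffunE.
Qed.

Lemma pcoefD f g i j : pcoef (f + g) i j = pcoef f i j + pcoef g i j.
Proof. by rewrite /pcoef -big_split; apply: eq_bigr => p _; rewrite ffunE. Qed.

Lemma pcoefZ (c : k) f i j : pcoef (c *: f) i j = c * pcoef f i j.
Proof. by rewrite /pcoef big_distrr; apply: eq_bigr => p _; rewrite ffunE. Qed.

Lemma pcoef0 i j : pcoef 0 i j = 0.
Proof. by rewrite /pcoef big1 // => p _; rewrite ffunE. Qed.

Lemma pcoef_sum I (r : seq I) (P : pred I) (F : I -> A) i j :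
  pcoef (\sum_(x <- r | P x) F x) i j = \sum_(x <- r | P x) pcoef (F x) i j.
Proof. by apply: (big_morph (fun f => pcoef f i j)) => [f g|]; rewrite (pcoefD, pcoef0). Qed.

Lemma pcoef1 i j : pcoef 1 i j = (i == j)%:R.
Proof.
case: (ltngtP i j) => ij.
- have [p [<- e]] := linear_path_exists (ltnW ij); rewrite -{1}e pcoef_at ffunE.
  have := linear_path_tgt p; case: (parrows p) => [|a s] /=.
    by rewrite e addn0; move: ij => /[swap] => eij; move=> _; case: eqP => // ne; case: ne; apply: val_inj.
  by rewrite e; case: eqP => // ->; lia.
- by rewrite pcoef_lt //; case: eqP ij => // ->; rewrite ltnn.
- have {ij} -> : i = j by apply: val_inj.
  have [p [e1 e2]] := linear_path_exists (leqnn j); rewrite -{1}e1 -{1}e2 pcoef_at ffunE eqxx.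
  by have := linear_path_tgt p; rewrite e1 e2; case: (parrows p) => //= a s; lia.
Qed.

(** Both sides add up f p * g q over the pairs of consecutive paths p from i and q to j: such a pair
    has exactly one concatenation, and the pairs are grouped on the right by the vertex where p
    ends. *)
Lemma pcoefM f g i j : pcoef (f * g) i j = \sum_l pcoef f i l * pcoef g l j.
Proof.
transitivity (\sum_(r : qpath Q | (psrc r == i) && (ptgt r == j))
  \sum_p \sum_(q | is_concat p q r) (f p : k) * g q).
  by rewrite /pcoef; apply: eq_bigr => r _; rewrite ffunE.
transitivity (\sum_(p : qpath Q | psrc p == i) \sum_(q : qpath Q | (ptgt q == j) && (ptgt p == psrc q)) (f p : k) * g q).
  rewrite exchange_big [RHS]big_mkcond; apply: eq_bigr => p _ /=.
  rewrite (exchange_big_dep predT) //=.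
  transitivity (\sum_(q : qpath Q) if [&& psrc p == i, ptgt q == j & ptgt p == psrc q] then (f p : k) * g q else 0); last first.
    by case: ifP => pi; rewrite /= -?big_mkcond //= big1.
  apply: eq_bigr => q _; case: ifP => [/and3P[/eqP e1 /eqP e2 /eqP e3]|no].
    have [r [cr rt]] := linear_path_concat e3.
    rewrite (big_pred1 r) // => r' /=.
    apply/idP/eqP => [/andP[/andP[/eqP a1 /eqP a2] _]|->].
      apply: linear_path_inj; last by rewrite a2 rt e2.
      by rewrite a1; case/and3P: cr => _ /eqP ->.
    by rewrite cr rt e2 !eqxx; case/and3P: cr => _ /eqP ->; rewrite e1 eqxx.
  rewrite big_pred0 // => r; apply: contraFF no => /andP[/andP[/eqP <- /eqP <-] c].
  by rewrite -(is_concat_ptgt c) eqxx; case/and3P: c => -> /eqP ->; rewrite eqxx.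
rewrite /pcoef; under [RHS]eq_bigr do rewrite big_distrlr /=.
rewrite [RHS](exchange_big_dep (fun p : qpath Q => psrc p == i)) /=; last by move=> l p _ /andP[].
apply: eq_bigr => p /eqP pi.
rewrite [RHS](big_pred1 (ptgt p)) => [|l]; last by rewrite /= pi eqxx eq_sym.
by apply: eq_bigl => q; rewrite andbC eq_sym.
Qed.

Lemma pcoef_punit (a b : nat) (i j : 'I_n) :
  pcoef (punit a b) i j = ((a <= b)%N && (i == a :> nat) && (j == b :> nat))%:R.
Proof.
rewrite of_pcoefK; case: eqP => [->|_]; case: eqP => [->|_]; case: leqP => //=; rewrite ?andbF //.
Qed.

End Coefficients.

(** * Sums of interval modules *)

Section RightAction.
Variables (k : fieldType) (n : nat).
Local Notation A := (linear_path_algebra k n).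

Definition ract (M : rmodType A) (m : M) (f : A) : M := (f : A^c) *: m.

Variables M N : rmodType A.
Implicit Types (m : M) (f g : A).

Lemma ractM m f g : ract m (f * g) = ract (ract m f) g.
Proof. by rewrite /ract scalerA. Qed.
Lemma ract1 m : ract m 1 = m. Proof. by rewrite /ract scale1r. Qed.
Lemma ractDl m m' f : ract (m + m') f = ract m f + ract m' f.
Proof. by rewrite /ract scalerDr. Qed.
Lemma ractDr m f g : ract m (f + g) = ract m f + ract m g.
Proof. by rewrite /ract scalerDl. Qed.
Lemma ractBl m m' f : ract (m - m') f = ract m f - ract m' f.
Proof. by rewrite /ract scalerBr. Qed.
Lemma ract0l f : ract (0 : M) f = 0. Proof. by rewrite /ract scaler0. Qed.
Lemma ract0r m : ract m 0 = 0. Proof. by rewrite /ract scale0r. Qed.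
Lemma ract_suml I (r : seq I) (P : pred I) (F : I -> M) f :
  ract (\sum_(i <- r | P i) F i) f = \sum_(i <- r | P i) ract (F i) f.
Proof. by rewrite /ract scaler_sumr. Qed.
Lemma ract_sumr I (r : seq I) (P : pred I) (F : I -> A) m :
  ract m (\sum_(i <- r | P i) F i) = \sum_(i <- r | P i) ract m (F i).
Proof. by rewrite /ract scaler_suml. Qed.
Lemma ract_linear (h : {linear M -> N}) m f : h (ract m f) = ract (h m) f.
Proof. by rewrite /ract linearZ. Qed.

Lemma ract_scale (c : k) m f : ract m (c *: f) = ract (ract m (pa_scalar _ c)) f.
Proof. by rewrite -ractM /pa_scalar -path_algebra_scaleAl mul1r. Qed.

Lemma ract_scalar_comm (c : k) m f :
  ract (ract m (pa_scalar _ c)) f = ract (ract m f) (pa_scalar _ c).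
Proof.
rewrite -!ractM /pa_scalar -path_algebra_scaleAl mul1r.
by rewrite -path_algebra_scaleAr mulr1.
Qed.

End RightAction.

Section MatrixUnits.
Variables (k : fieldType) (n : nat).
Local Notation A := (linear_path_algebra k n).
Local Notation E := (@punit k n).

Lemma punitM a b c d : (b < n)%N -> (a <= b)%N -> (c <= d)%N ->
  E a b * E c d = if b == c then E a d else 0.
Proof.
move=> bn ab cd; apply: pcoef_inj => i j; rewrite pcoefM.
rewrite (bigD1 (Ordinal bn)) //= [X in _ + X]big1 ?addr0; last first.
  move=> l lb; rewrite pcoef_punit; case: (l =P b :> nat) => [e|]; last by rewrite andbF mul0r.
  by case/eqP: lb; apply: val_inj.
rewrite !pcoef_punit ab cd eqxx andbT /= -natrM mulnb.
case: (b =P c) => [e|_]; last by rewrite /= ?andbF ?pcoef0.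
by rewrite pcoef_punit (leq_trans ab) ?e.
Qed.

Lemma punit_gt a b : (b < a)%N -> E a b = 0.
Proof.
by move=> ba; apply: pcoef_inj => i j; rewrite pcoef_punit leqNgt ba pcoef0.
Qed.

Lemma punit_ge a b : (n <= b)%N -> E a b = 0.
Proof.
move=> nb; apply: pcoef_inj => i j; rewrite pcoef_punit pcoef0.
by rewrite [(j == b :> nat)]ltn_eqF ?andbF //; apply: leq_trans (ltn_ord j) nb.
Qed.

Lemma punit_mull a (i : 'I_n) (f : A) : (a <= i)%N ->
  E a i * f = \sum_(j < n) pcoef f i j *: E a j.
Proof.
move=> ai; apply: pcoef_inj => u v; rewrite pcoefM pcoef_sum.
rewrite (bigD1 i) //= [X in _ + X]big1 ?addr0; last first.
  move=> l li; rewrite pcoef_punit; case: (l =P i :> nat) => [e|]; last by rewrite andbF mul0r.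
  by case/eqP: li; apply: val_inj.
rewrite (bigD1 v) //= [X in _ + X]big1 ?addr0; last first.
  move=> l lv; rewrite pcoefZ pcoef_punit; case: (v =P l :> nat) => [e|]; last by rewrite andbF mulr0.
  by case/eqP: lv; apply: val_inj.
rewrite pcoefZ !pcoef_punit !eqxx ai /= !andbT mulrC.
case: (leqP a v) => //= va; rewrite pcoef_lt ?mul0r //; exact: leq_trans va ai.
Qed.

Lemma punit_mulr b (j : 'I_n) (f : A) : (j <= b < n)%N ->
  f * E j b = \sum_(i < n) pcoef f i j *: E i b.
Proof.
case/andP=> jb bn; apply: pcoef_inj => u v; rewrite pcoefM pcoef_sum.
rewrite (bigD1 j) //= [X in _ + X]big1 ?addr0; last first.
  move=> l lj; rewrite pcoef_punit; case: (l =P j :> nat) => [e|]; last by rewrite andbF mulr0.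
  by case/eqP: lj; apply: val_inj.
rewrite (bigD1 u) //= [X in _ + X]big1 ?addr0; last first.
  move=> l lu; rewrite pcoefZ pcoef_punit; case: (u =P l :> nat) => [e|]; last by rewrite andbF mulr0.
  by case/eqP: lu; apply: val_inj.
rewrite pcoefZ !pcoef_punit !eqxx jb /= !andbT.
case: (leqP u b) => //= ub; rewrite pcoef_lt ?mul0r //; exact: leq_ltn_trans jb ub.
Qed.

Lemma punit1 : 1 = \sum_(i < n) E i i :> A.
Proof.
apply: pcoef_inj => u v; rewrite pcoef_sum pcoef1 (bigD1 u) //= [X in _ + X]big1 ?addr0.
  by rewrite pcoef_punit leqnn eqxx /= eq_sym.
move=> l lu; rewrite pcoef_punit; case: (u =P l :> nat) => [e|]; last by rewrite andbF.
by case/eqP: lu; apply: val_inj.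
Qed.

Lemma punit_expand (f : A) : f = \sum_(i < n) \sum_(j < n) pcoef f i j *: E i j.
Proof.
rewrite -[LHS]mul1r punit1 big_distrl; apply: eq_bigr => i _ /=.
exact: punit_mull.
Qed.

End MatrixUnits.

Definition thin_index (n : nat) (S : finType) (lo hi : S -> nat) : predArgType :=
  {p : S * 'I_n | (lo p.1 <= p.2 < hi p.1)%N}.
HB.instance Definition _ n S lo hi := Finite.on (@thin_index n S lo hi).

(* The direct sum over s of the interval modules [lo s, hi s[: a basis vector for
   each vertex j of the interval, and the path from i to j sends the i-th basis
   vector to the j-th one. *)
Definition thin_mod (k : fieldType) (n : nat) (S : finType) (lo hi : S -> nat) : Type :=
  {ffun thin_index n lo hi -> k}.

Section ThinModule.
Variables (k : fieldType) (n : nat) (S : finType) (lo hi : S -> nat).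
Local Notation A := (linear_path_algebra k n).
Local Notation TM := (thin_mod k n lo hi).
Local Notation E := (@punit k n).
HB.instance Definition _ := GRing.Zmodule.copy TM {ffun thin_index n lo hi -> k}.
Implicit Types (v w : TM) (f g : A) (s : S) (i j l : 'I_n).

(** Extension by zero outside the interval lets all sums range over every vertex, without membership
    proofs in the index. *)
Definition tcoef v s j : k := if insub (s, j) is Some p then v p else 0.
Definition of_tcoef (F : S -> 'I_n -> k) : TM := [ffun p => F (val p).1 (val p).2].

Lemma of_tcoefK F s j : tcoef (of_tcoef F) s j = if (lo s <= j < hi s)%N then F s j else 0.
Proof.
rewrite /tcoef; case: insubP => [p /= -> e|/negbTE /= -> //].
by rewrite ffunE /= e.
Qed.

Lemma tcoef_out v s j : ~~ (lo s <= j < hi s)%N -> tcoef v s j = 0.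
Proof. by move=> /negbTE sj; rewrite /tcoef insubF. Qed.

Lemma tcoef_in v s j : tcoef v s j <> 0 -> (lo s <= j < hi s)%N.
Proof. by move=> h; apply/negP => /negP /(tcoef_out v). Qed.

Lemma tcoef_inj v w : (forall s j, tcoef v s j = tcoef w s j) -> v = w.
Proof.
move=> e; apply/ffunP => p; have := e (val p).1 (val p).2.
by rewrite /tcoef -surjective_pairing valK.
Qed.

Lemma tcoefD v w s j : tcoef (v + w) s j = tcoef v s j + tcoef w s j.
Proof. by rewrite /tcoef; case: insub => [p|]; rewrite ?ffunE ?addr0. Qed.

Lemma tcoef0 s j : tcoef 0 s j = 0.
Proof. by rewrite /tcoef; case: insub => [p|]; rewrite ?ffunE. Qed.

Lemma tcoef_sum I (r : seq I) (P : pred I) (F : I -> TM) s j :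
  tcoef (\sum_(x <- r | P x) F x) s j = \sum_(x <- r | P x) tcoef (F x) s j.
Proof. by elim/big_rec2: _ => [|x y z _ <-]; rewrite ?tcoef0 ?tcoefD. Qed.

Definition tact (f : A^c) v : TM :=
  of_tcoef (fun s j => \sum_i tcoef v s i * pcoef (f : A) i j).

Lemma tact_coef f v s j : tcoef (tact f v) s j =
  if (lo s <= j < hi s)%N then \sum_i tcoef v s i * pcoef f i j else 0.
Proof. by rewrite of_tcoefK. Qed.

(** Intervals are convex: a path with both ends in the interval only visits vertices of the
    interval, so truncating at the intermediate vertex loses nothing. *)
Lemma tact_A (f g : A^c) v : tact f (tact g v) = tact (f * g) v.
Proof.
apply: tcoef_inj => s l; rewrite !tact_coef; case: ifP => // sl.
transitivity (\sum_i \sum_j tcoef v s i * (pcoef (g : A) i j * pcoef (f : A) j l)); last first.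
  by apply: eq_bigr => i _; rewrite -big_distrr /= -pcoefM.
rewrite exchange_big; apply: eq_bigr => j _ /=; rewrite tact_coef.
case: ifP => [_|sj].
  by rewrite big_distrl; apply: eq_bigr => i _ /=; rewrite mulrA.
rewrite mul0r big1 // => i _.
have [->|/tcoef_in si] := pselect (tcoef v s i = 0); first by rewrite mul0r.
case: (ltnP j i) => ij; first by rewrite pcoef_lt // mul0r mulr0.
by case: (ltnP l j) => jl; [rewrite [pcoef _ j l]pcoef_lt // !mulr0|lia].
Qed.

Lemma tact_1 : left_id 1 tact.
Proof.
move=> v; apply: tcoef_inj => s j; rewrite tact_coef; case: ifP => [_|/negbT/tcoef_out -> //].
rewrite (bigD1 j) //= big1 ?addr0 => [|i /negbTE ij]; rewrite pcoef1 ?eqxx ?mulr1 //.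
by rewrite ij mulr0.
Qed.

Lemma tact_Dr : right_distributive tact +%R.
Proof.
move=> f v w; apply: tcoef_inj => s j; rewrite tcoefD !tact_coef; case: ifP; rewrite ?addr0 // => _.
by rewrite -big_split; apply: eq_bigr => i _; rewrite tcoefD mulrDl.
Qed.

Lemma tact_Dl v : {morph tact^~ v : f g / f + g}.
Proof.
move=> f g; apply: tcoef_inj => s j; rewrite tcoefD !tact_coef; case: ifP; rewrite ?addr0 // => _.
by rewrite -big_split; apply: eq_bigr => i _; rewrite pcoefD mulrDr.
Qed.

HB.instance Definition _ := GRing.Zmodule_isLmodule.Build A^c TM tact_A tact_1 tact_Dr tact_Dl.

Lemma tcoef_ract v f s j : tcoef (ract (v : TM) f) s j =
  if (lo s <= j < hi s)%N then \sum_i tcoef v s i * pcoef f i j else 0.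
Proof. exact: tact_coef. Qed.

End ThinModule.

Lemma sum_ord_nat (V : nmodType) n (a : 'I_n) (F : 'I_n -> V) :
  \sum_(j < n | j == a :> nat) F j = F a.
Proof. by rewrite (big_pred1 a) // => j; rewrite /= -val_eqE. Qed.

Section Generators.
Variables (k : fieldType) (n : nat) (S : finType) (lo hi : S -> nat).
Local Notation A := (linear_path_algebra k n).
Local Notation TM := (thin_mod k n lo hi).
Local Notation E := (@punit k n).
Implicit Types (v w : TM) (f g : A) (s : S) (i j l : 'I_n).

(** The basis vector at the left end of the s-th interval, from which paths reach the rest of it; it
    is 0 for an empty interval, a case that kernels and cokernels do produce. *)
Definition tgen s : TM := of_tcoef lo hi (fun s' j => ((s' == s) && (j == lo s :> nat))%:R).

Lemma tcoef_tgen s s' j :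
  tcoef (tgen s) s' j = [&& s' == s, j == lo s :> nat & lo s < hi s]%N%:R.
Proof.
rewrite of_tcoefK; case: (s' =P s) => [->|_]; last by case: ifP.
case: (j =P lo s :> nat) => [->|_]; last by case: ifP.
by rewrite leqnn /=; case: ifP.
Qed.

(** The combination of paths starting at [lo s] that carries the generator [tgen s] to the s-th
    component of v. *)
Definition tvec v s : A := \sum_(j < n) tcoef v s j *: E (lo s) j.

Lemma pcoef_tvec v s i j : pcoef (tvec v s) i j = if i == lo s :> nat then tcoef v s j else 0.
Proof.
rewrite pcoef_sum (bigD1 j) //= big1 ?addr0 => [|l lj].
  rewrite pcoefZ pcoef_punit eqxx andbT; case: eqP => _; last by rewrite andbF mulr0.
  rewrite andbT; case: leqP => lj; rewrite ?mulr1 // tcoef_out ?mul0r //; lia.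
rewrite pcoefZ pcoef_punit; case: (j =P l :> nat) => [e|]; last by rewrite andbF mulr0.
by case/eqP: lj; apply: val_inj.
Qed.

Lemma tvecD v w s : tvec (v + w) s = tvec v s + tvec w s.
Proof.
by rewrite -big_split; apply: eq_bigr => j _; rewrite tcoefD /= scalerDl.
Qed.

Lemma tvec_tgen s s' : tvec (tgen s) s' = if (s' == s) && (lo s < hi s)%N then E (lo s) (lo s) else 0.
Proof.
apply: pcoef_inj => i j; rewrite pcoef_tvec tcoef_tgen.
case: (s' =P s) => [->|_] /=; last by rewrite pcoef0; case: ifP.
case: ltnP => /= _; rewrite ?andbF ?pcoef0 ?andbT; last by case: ifP.
by rewrite pcoef_punit leqnn; case: ifP.
Qed.

Lemma tgen_ract s (a : A) t j : tcoef (ract (tgen s) a) t j =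
  if (t == s) && (lo t <= j < hi t)%N then \sum_(i < n | i == lo s :> nat) pcoef a i j else 0.
Proof.
rewrite tcoef_ract; case: ifP => tj; last by rewrite andbF.
rewrite andbT; case: eqP => [ts|/eqP/negbTE ts]; last first.
  by rewrite big1 // => i _; rewrite tcoef_tgen ts mul0r.
rewrite [RHS]big_mkcond; apply: eq_bigr => i _; rewrite tcoef_tgen ts eqxx /=.
have -> : (lo s < hi s)%N by rewrite -ts; lia.
by rewrite andbT; case: eqP; rewrite ?mul1r ?mul0r.
Qed.

Lemma thin_expand v : v = \sum_s ract (tgen s) (tvec v s).
Proof.
apply: tcoef_inj => s j; rewrite tcoef_sum (bigD1 s) //= big1 ?addr0 => [|t ts].
  rewrite tgen_ract eqxx; case: ifP => [/= sj|/negbT]; last by move=> ?; rewrite tcoef_out.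
  have sn : (lo s < n)%N by apply: leq_ltn_trans (ltn_ord j); case/andP: sj.
  by rewrite (sum_ord_nat (Ordinal sn)) pcoef_tvec eqxx.
by rewrite tgen_ract eq_sym (negbTE ts).
Qed.

Lemma tgen_id s : ract (tgen s) (E (lo s) (lo s)) = tgen s.
Proof.
rewrite [RHS]thin_expand (bigD1 s) //= big1 ?addr0 => [|t /negbTE ts]; last first.
  by rewrite tvec_tgen ts ract0r.
rewrite tvec_tgen eqxx /=; case: ltnP => // sh; rewrite ract0r.
by apply: tcoef_inj => t j; rewrite tgen_ract tcoef0; case: ifP => // /andP[/eqP-> h]; lia.
Qed.

Lemma tgen_kill s (j : nat) : (hi s <= j)%N -> ract (tgen s) (E (lo s) j) = 0.
Proof.
move=> h; apply: tcoef_inj => t l; rewrite tgen_ract tcoef0; case: ifP => // /andP[/eqP -> tl].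
rewrite big1 // => i _; rewrite pcoef_punit.
have /negbTE -> : (l != j :> nat) by lia.
by rewrite andbF.
Qed.

Lemma thin_hom_ext (M : rmodType A) (F G : {linear TM -> M}) :
  (forall s, F (tgen s) = G (tgen s)) -> F =1 G.
Proof.
move=> FG v; rewrite (thin_expand v) !linear_sum; apply: eq_bigr => s _.
by rewrite !ract_linear FG.
Qed.

(** The s-th summand is the projective right ideal of the paths from [lo s], modulo those ending at
    [hi s] or later. Multiplying x s by the idempotent at [lo s] spares the caller from choosing it
    at that vertex. *)
Lemma thin_hom (M : rmodType A) (x : S -> M) :
  (forall s (j : nat), (hi s <= j)%N -> ract (x s) (E (lo s) j) = 0) ->
  exists F : {linear TM -> M}, forall s, F (tgen s) = ract (x s) (E (lo s) (lo s)).
Proof.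
move=> kill.
have [||F FE] := @linear_intro _ TM M (fun v => \sum_s ract (x s) (tvec v s)).
- by move=> u v; rewrite -big_split; apply: eq_bigr => s _; rewrite tvecD ractDr.
- move=> a v; rewrite -[a *: \sum_s _]/(ract (\sum_s _) a) -[a *: v]/(ract v a) ract_suml.
  apply: eq_bigr => s _; rewrite -ractM.
  have -> : tvec v s * a = \sum_(j < n) (\sum_i tcoef v s i * pcoef a i j) *: E (lo s) j.
    rewrite big_distrl /=.
    transitivity (\sum_i \sum_j (tcoef v s i * pcoef a i j) *: E (lo s) j).
      apply: eq_bigr => i _; rewrite -path_algebra_scaleAl.
      have [->|/tcoef_in si] := pselect (tcoef v s i = 0).
        by rewrite scale0r big1 // => j _; rewrite mul0r scale0r.
      rewrite punit_mull; last by case/andP: si.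
      by rewrite scaler_sumr; apply: eq_bigr => j _; rewrite scalerA.
    by rewrite exchange_big; apply: eq_bigr => j _; rewrite scaler_suml.
  rewrite !ract_sumr; apply: eq_bigr => j _; rewrite tcoef_ract.
  case: ifP => // /negbT; rewrite negb_and -!ltnNge => /orP[js|js].
    by rewrite punit_gt // !scaler0.
  have k0 c : ract (x s) (c *: E (lo s) j) = 0 by rewrite ract_scale ract_scalar_comm kill // ract0l.
  by rewrite !k0.
exists F => s; rewrite FE (bigD1 s) //= big1 ?addr0 => [|t /negbTE ts]; last first.
  by rewrite tvec_tgen ts ract0r.
rewrite tvec_tgen eqxx /=; case: ltnP => // sh; by rewrite ract0r kill.
Qed.

End Generators.

Section ThinMaps.
Variables (k : fieldType) (n : nat).
Variables (S S' : finType) (lo hi : S -> nat) (lo' hi' : S' -> nat).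
Local Notation A := (linear_path_algebra k n).
Local Notation TM := (thin_mod k n lo hi).
Local Notation TM' := (thin_mod k n lo' hi').
Local Notation E := (@punit k n).

(** The interval of s maps onto its initial segment up to [hi' t], which is a submodule of the
    interval of t. When the two intervals do not meet, the entry m s t has no effect. *)
Lemma thin_map (m : S -> S' -> k) :
  (forall s t, m s t <> 0 -> (lo' t <= lo s /\ hi' t <= hi s)%N) ->
  exists F : {linear TM -> TM'}, forall v t j,
    tcoef (F v) t j = if (lo' t <= j < hi' t)%N then \sum_s m s t * tcoef v s j else 0.
Proof.
move=> mP.
have [||F FE] := @linear_intro _ TM TM' (fun v => of_tcoef lo' hi' (fun t j => \sum_s m s t * tcoef v s j)).
- move=> u v; apply: tcoef_inj => t j; rewrite tcoefD !of_tcoefK; case: ifP; rewrite ?addr0 // => _.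
  by rewrite -big_split; apply: eq_bigr => s _; rewrite tcoefD mulrDr.
- move=> a v; rewrite -[a *: v]/(ract v a) -[a *: of_tcoef _ _ _]/(ract (of_tcoef _ _ _ : TM') a).
  apply: tcoef_inj => t j; rewrite tcoef_ract of_tcoefK; case: ifP => // tj.
  transitivity (\sum_s \sum_i m s t * (tcoef v s i * pcoef a i j)); last first.
    rewrite exchange_big; apply: eq_bigr => i _; rewrite of_tcoefK.
    case: ifP => [_|ti]; first by rewrite big_distrl; apply: eq_bigr => s _; rewrite /= mulrA.
    rewrite mul0r big1 // => s _.
    have [->|/mP [h1 h2]] := pselect (m s t = 0); first by rewrite mul0r.
    have [->|/tcoef_in si] := pselect (tcoef v s i = 0); first by rewrite mul0r mulr0.
    by rewrite pcoef_lt ?mulr0 //; lia.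
  apply: eq_bigr => s _; rewrite tcoef_ract; case: ifP => sj; first by rewrite big_distrr.
  rewrite mulr0 big1 // => i _.
  have [->|/mP [h1 h2]] := pselect (m s t = 0); first by rewrite mul0r.
  have [->|/tcoef_in si] := pselect (tcoef v s i = 0); first by rewrite mul0r mulr0.
  by rewrite pcoef_lt ?mulr0 //; lia.
by exists F => v t j; rewrite FE of_tcoefK.
Qed.

(** The image of a generator is fixed by the idempotent at [lo s], hence in each summand it is a
    multiple of the basis vector at [lo s]; these multiples form the matrix. *)
Lemma thin_hom_matrix (F : {linear TM -> TM'}) : (forall t, hi' t <= n)%N ->
  exists m : S -> S' -> k,
    (forall s t, m s t <> 0 -> [/\ lo' t <= lo s, lo s < hi' t & hi' t <= hi s]%N) /\
    forall v t j,
      tcoef (F v) t j = if (lo' t <= j < hi' t)%N then \sum_s m s t * tcoef v s j else 0.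
Proof.
move=> hn; pose w s := F (tgen k n lo hi s).
(* At most one term: the coefficient at [lo s], or 0 if [lo s] is not a vertex. *)
pose m s t := \sum_(j < n | j == lo s :> nat) tcoef (w s) t j.
have wE s t j : tcoef (w s) t j = if j == lo s :> nat then m s t else 0.
  have -> : w s = ract (w s) (E (lo s) (lo s)) by rewrite -ract_linear tgen_id.
  case: eqP => [js|js].
    rewrite /m (eq_bigl (fun l : 'I_n => l == j :> nat)) => [|l]; last by rewrite js.
    by rewrite sum_ord_nat -ract_linear tgen_id.
  rewrite tcoef_ract; case: ifP => // _; rewrite big1 // => i _.
  by rewrite pcoef_punit (introF eqP js) andbF mulr0.
have mE s t : m s t <> 0 -> exists2 j : 'I_n, j = lo s :> nat & tcoef (w s) t j = m s t.
  case: (ltnP (lo s) n) => sn h.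
    by exists (Ordinal sn); rewrite ?wE /= ?eqxx.
  case: h; rewrite /m big_pred0 // => j; have := ltn_ord j; lia.
have FE v t j : tcoef (F v) t j = if (lo' t <= j < hi' t)%N then \sum_s m s t * tcoef v s j else 0.
  case: ifP => [tj|/negbT/tcoef_out -> //].
  rewrite {1}(thin_expand v) linear_sum tcoef_sum; apply: eq_bigr => s _.
  rewrite ract_linear tcoef_ract tj.
  case: (ltnP (lo s) n) => sn.
    rewrite (bigD1 (Ordinal sn)) //= big1 ?addr0 => [|i /negbTE il].
      by rewrite -/(w s) wE eqxx pcoef_tvec eqxx.
    by rewrite -/(w s) wE -[X in i == X :> nat]/(val (Ordinal sn)) val_eqE il mul0r.
  rewrite tcoef_out ?mulr0 ?big1 // => [i _|]; last by have := ltn_ord j; lia.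
  by rewrite -/(w s) wE; case: eqP => [?|]; rewrite ?mul0r //; have := ltn_ord i; lia.
exists m; split=> // s t mst; have [j js wj] := mE _ _ mst.
have tj : (lo' t <= j < hi' t)%N by apply: (@tcoef_in _ _ _ _ _ (w s)); rewrite wj.
rewrite -js; split; [by case/andP: tj|by case/andP: tj|].
(* If [hi s < hi' t], the path from [lo s] to [hi s] kills the generator but not its image. *)
rewrite leqNgt; apply/negP => ht.
have hn' : (hi s < n)%N by exact: leq_trans ht (hn t).
case: (ltnP (lo s) (hi s)) => sh.
  have := FE (ract (tgen k n lo hi s) (E (lo s) (hi s))) t (Ordinal hn').
  rewrite tgen_kill // linear0 tcoef0 /= ht -ltnS ltnS.
  have := congr1 (fun u => tcoef u t (Ordinal hn')) (ract_linear F (tgen k n lo hi s) (E (lo s) (hi s))).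
  rewrite tgen_kill // linear0 tcoef0 tcoef_ract /= ht.
  have -> : (lo' t <= hi s)%N by lia.
  rewrite (bigD1 j) //= big1 ?addr0 => [|i ij].
    by rewrite -/(w s) wj pcoef_punit js eqxx /= eqxx (ltnW sh) mulr1 => /esym.
  by rewrite -/(w s) wE -js val_eqE (negbTE ij) mul0r.
apply: mst; rewrite -wj /w; have -> : tgen k n lo hi s = 0.
  by apply: tcoef_inj => u l; rewrite tcoef_tgen tcoef0 ltnNge sh !andbF.
by rewrite linear0 tcoef0.
Qed.

End ThinMaps.

Lemma sum_unit (V : nmodType) (F : unit -> V) : \sum_u F u = F tt.
Proof. by rewrite (big_pred1 tt) // => -[]. Qed.

Lemma sum_delta (R : pzRingType) (S : finType) (G : S -> R) t :
  \sum_s (s == t)%:R * G s = G t.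
Proof.
rewrite (bigD1 t) //= eqxx mul1r big1 ?addr0 // => s /negbTE ->.
by rewrite mul0r.
Qed.

(** * Projectivity and extensions of interval modules *)

Section ThinHomological.
Variables (k : fieldType) (n : nat) (S : finType) (lo hi : S -> nat).
Local Notation A := (linear_path_algebra k n).
Local Notation TM := (thin_mod k n lo hi).
Local Notation E := (@punit k n).
Local Notation tgen := (tgen k n lo hi).

Lemma thin_lift (M N : rmodType A) (g : {linear M -> N}) (f : {linear TM -> N}) (x : S -> M) :
  (forall s, g (x s) = f (tgen s)) ->
  (forall s (j : nat), (hi s <= j)%N -> ract (x s) (E (lo s) j) = 0) ->
  exists h : {linear TM -> M}, forall v, g (h v) = f v.
Proof.
move=> gx /thin_hom[h hE]; exists h.
apply: (@thin_hom_ext _ _ _ _ _ _ (g \o h) f) => s /=.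
by rewrite hE ract_linear gx -ract_linear tgen_id.
Qed.

(** With upper end n no path relation has to be respected, so any preimages of the generators define
    a lift. *)
Lemma thin_projective : (forall s, hi s = n) -> projective TM.
Proof.
move=> hn M N g f gS; pose x s := projT1 (cid (gS (f (tgen s)))).
apply: (@thin_lift _ _ g f x) => [s|s j]; first by rewrite /x; case: cid.
by rewrite hn => nj; rewrite punit_ge // ract0r.
Qed.

(** By the resolution of [[lo, hi[] by [[hi, n[] and [[lo, n[], Ext^1 is the cokernel of the action
    of the path from lo to hi on N; the second hypothesis is the surjectivity of that action. *)
Lemma thin_Ext1_zero (N : rmodType A) : (forall s, lo s <= hi s)%N ->
  (forall s, (hi s < n)%N -> forall y : N,
    exists z, ract y (E (hi s) (hi s)) = ract z (E (lo s) (hi s))) ->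
  Ext1_zero TM N.
Proof.
move=> lohi ext X f g [fI gf gS].
suff /choice[x xP] : forall s, exists x, g x = tgen s /\
    forall j : nat, (hi s <= j)%N -> ract x (E (lo s) j) = 0.
  have [||h hE] := @thin_lift _ _ g idfun x; first by move=> s; have [] := xP s.
    by move=> s; have [] := xP s.
  by exists h.
move=> s; have [e ge] := gS (tgen s).
case: (ltnP (hi s) n) => hn; last first.
  exists e; split=> // j hj; rewrite punit_ge ?ract0r //; exact: leq_trans hn hj.
have [y fy] : exists y, f y = ract e (E (lo s) (hi s)).
  by apply/gf; rewrite ract_linear ge tgen_kill.
have [z yz] := ext s hn y.
(* The preimage e is corrected by an element of N so that the path to [hi s] kills it; the paths to
   later vertices factor through that one. *)
exists (e - f z); split.
  by rewrite linearB ge (_ : g (f z) = 0) ?subr0 //; apply/gf; exists z.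
have kill : ract (e - f z) (E (lo s) (hi s)) = 0.
  rewrite ractBl -fy -ract_linear -yz ract_linear fy -ractM punitM //= eqxx.
  by rewrite subrr.
move=> j hj; have -> : E (lo s) j = E (lo s) (hi s) * E (hi s) j by rewrite punitM // eqxx.
by rewrite ractM kill ract0l.
Qed.

Lemma thin_finitely_generated : finitely_generated TM.
Proof.
exists #|S|, (fun j => tgen (enum_val j)) => v; exists (fun j => tvec v (enum_val j)).
rewrite {1}(thin_expand v).
exact: (reindex _ (onW_bij _ (@enum_val_bij S))).
Qed.

End ThinHomological.

Section ThinExact.
Variables (k : fieldType) (n : nat) (S : finType) (lo hi : S -> nat).
Local Notation A := (linear_path_algebra k n).
Local Notation TM := (thin_mod k n lo hi).

(** Paths only move to the right, so cutting at mid leaves the right part as a submodule and the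
    left part as a quotient. Either part may be empty. *)
Lemma thin_short_exact (mid : S -> nat) : (forall s, lo s <= mid s <= hi s)%N ->
  exists (f : {linear thin_mod k n mid hi -> TM}) (g : {linear TM -> thin_mod k n lo mid}),
    [/\ short_exact f g, forall v s j, tcoef (f v) s j = tcoef v s j
      & forall v s j, tcoef (g v) s j = if (lo s <= j < mid s)%N then tcoef v s j else 0].
Proof.
move=> H.
have [|f fE] := @thin_map k n S S mid hi lo hi (fun s t => (s == t)%:R).
  by move=> s t; case: eqP => // -> _; have := H t; lia.
have [|g gE] := @thin_map k n S S lo hi lo mid (fun s t => (s == t)%:R).
  by move=> s t; case: eqP => // -> _; have := H t; lia.
have gC v t j : tcoef (g v) t j = if (lo t <= j < mid t)%N then tcoef v t j else 0.
  by rewrite gE sum_delta.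
have fC v t j : tcoef (f v) t j = tcoef v t j.
  rewrite fE sum_delta; case: ifP => // /negbT h; rewrite tcoef_out //.
  by apply: contra h => h; have := H t; lia.
exists f, g; split=> //; split.
- by move=> u v fuv; apply: tcoef_inj => s j; rewrite -!fC fuv.
- move=> y; split=> [gy|[x <-]]; last first.
    apply: tcoef_inj => s j; rewrite gC fC tcoef0; case: ifP => // h; rewrite tcoef_out //; lia.
  exists (of_tcoef mid hi (fun s j => tcoef y s j)); apply: tcoef_inj => s j.
  rewrite fC of_tcoefK; case: ifP => // h.
  have := gC y s j; rewrite gy tcoef0; case: ifP => // h' _; rewrite tcoef_out //; lia.
- move=> z; exists (of_tcoef lo hi (fun s j => tcoef z s j)).
  apply: tcoef_inj => s j; rewrite gC of_tcoefK; case: ifP => [h|/negbT/tcoef_out-> //].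
  by have -> : (lo s <= j < hi s)%N by have := H s; lia.
Qed.

End ThinExact.

Section ThinSummands.
Variables (k : fieldType) (n : nat) (S : finType) (lo hi : S -> nat).
Local Notation A := (linear_path_algebra k n).
Local Notation TM := (thin_mod k n lo hi).

Lemma thin_pd_le1 : (forall s, lo s <= hi s <= n)%N -> pd_le1 TM.
Proof.
move=> H; have [f [g [fg _ _]]] := @thin_short_exact k n S lo (fun=> n) hi H.
exists (thin_mod k n hi (fun=> n)), (thin_mod k n lo (fun=> n)), f, g.
by split=> //; exact: thin_projective.
Qed.

(** Each t receives its own copy of the big module, in which it occupies one summand; repetitions
    among the intervals of S' are therefore harmless. *)
Lemma thin_in_add (S' : finType) (lo' hi' : S' -> nat) :
  (forall t, (hi' t <= lo' t)%N \/ exists s, lo s = lo' t /\ hi s = hi' t) ->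
  in_add TM (thin_mod k n lo' hi').
Proof.
move=> H.
(* The value [None] stands for the empty intervals, which contribute nothing. *)
have /choice[sg sgP] : forall t, exists o : option S,
    if o is Some s then lo s = lo' t /\ hi s = hi' t else (hi' t <= lo' t)%N.
  by move=> t; case: (H t) => [h|[s h]]; [exists None|exists (Some s)].
have /choice[F FE] : forall j : 'I_#|S'|, exists F : {linear thin_mod k n lo' hi' -> TM},
    forall v s i, tcoef (F v) s i = if (lo s <= i < hi s)%N then
      \sum_t ((t == enum_val j) && (sg t == Some s))%:R * tcoef v t i else 0.
  move=> j; apply: thin_map => t s; case: eqP => //= _; case: eqP => //= e _.
  by have := sgP t; rewrite e => -[-> ->].
have /choice[G GE] : forall j : 'I_#|S'|, exists G : {linear TM -> thin_mod k n lo' hi'},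
    forall v t i, tcoef (G v) t i = if (lo' t <= i < hi' t)%N then
      \sum_s ((t == enum_val j) && (sg t == Some s))%:R * tcoef v s i else 0.
  move=> j; apply: thin_map => s t; case: eqP => //= _; case: eqP => //= e _.
  by have := sgP t; rewrite e => -[-> ->].
have [||i iE] := @linear_intro _ (thin_mod k n lo' hi') {ffun 'I_#|S'| -> TM}
  (fun v => [ffun j => F j v]).
- by move=> u v; apply/ffunP => j; rewrite !ffunE linearD.
- by move=> a u; apply/ffunP => j; rewrite !ffunE linearZ.
have [||p pE] := @linear_intro _ {ffun 'I_#|S'| -> TM} (thin_mod k n lo' hi')
  (fun w => \sum_j G j (w j)).
- by move=> u v; rewrite -big_split; apply: eq_bigr => j _; rewrite ffunE linearD.
- by move=> a u; rewrite scaler_sumr; apply: eq_bigr => j _; rewrite ffunE linearZ.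
exists #|S'|, i, p => v; rewrite pE iE; apply: tcoef_inj => t l.
rewrite tcoef_sum (bigD1 (enum_rank t)) //= [X in _ + X]big1 ?addr0; last first.
  move=> j jt; rewrite GE; case: ifP => // _; rewrite big1 // => s _.
  case: eqP => [e|]; last by rewrite mul0r.
  by case/eqP: jt; rewrite e enum_valK.
rewrite GE enum_rankK eqxx /=; case: ifP => [tl|/negbT/tcoef_out -> //].
have := sgP t; case e : (sg t) => [s|]; last by lia.
case=> e1 e2; rewrite (bigD1 s) //= big1 ?addr0 => [|s' ss']; last first.
  by rewrite (_ : Some s == Some s' = false) ?mul0r //; apply: contraNF ss' => /eqP[->].
rewrite eqxx mul1r ffunE FE e1 e2 tl (bigD1 t) //= big1 ?addr0 => [|t' tt'].
  by rewrite enum_rankK eqxx e eqxx mul1r.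
by rewrite enum_rankK (negbTE tt') mul0r.
Qed.

Lemma thin_inclusion (s0 : S) :
  exists f : {linear thin_mod k n (fun _ : unit => lo s0) (fun=> hi s0) -> TM},
    forall v s j, tcoef (f v) s j = if s == s0 then tcoef v tt j else 0.
Proof.
have [|f fE] := @thin_map k n unit S (fun=> lo s0) (fun=> hi s0) lo hi (fun _ s => (s == s0)%:R).
  by move=> _ s; case: eqP => // ->.
exists f => v s j; rewrite fE sum_unit; case: eqP => [->|_]; last by rewrite mul0r; case: ifP.
by rewrite mul1r; case: ifP => // /negbT h; rewrite tcoef_out.
Qed.

Lemma thin_projection (s0 : S) :
  exists f : {linear TM -> thin_mod k n (fun _ : unit => lo s0) (fun=> hi s0)},
    forall v j, tcoef (f v) tt j = tcoef v s0 j.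
Proof.
have [|f fE] := @thin_map k n S unit lo hi (fun=> lo s0) (fun=> hi s0) (fun s _ => (s == s0)%:R).
  by move=> s _; case: eqP => // ->.
exists f => v j; rewrite fE sum_delta.
by case: ifP => // /negbT h; rewrite tcoef_out.
Qed.

Lemma thin_direct_sum :
  is_direct_sum (fun j : 'I_#|S| =>
    thin_mod k n (fun _ : unit => lo (enum_val j)) (fun=> hi (enum_val j)) : rmodType A) TM.
Proof.
pose i (j : 'I_#|S|) := projT1 (cid (thin_inclusion (enum_val j))).
have iE j := projT2 (cid (thin_inclusion (enum_val j))).
pose p (j : 'I_#|S|) := projT1 (cid (thin_projection (enum_val j))).
have pE j := projT2 (cid (thin_projection (enum_val j))).
exists i, p; split.
- by move=> j x; apply: tcoef_inj => -[] l; rewrite pE iE eqxx.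
- move=> j l x jl; apply: tcoef_inj => -[] u; rewrite pE iE tcoef0.
  by rewrite (inj_eq enum_val_inj) eq_sym (negbTE jl).
- move=> x; apply: tcoef_inj => s l; rewrite tcoef_sum (bigD1 (enum_rank s)) //= big1 ?addr0.
    by rewrite iE pE enum_rankK eqxx.
  move=> j js; rewrite iE; case: eqP => // e; case/eqP: js; by rewrite e enum_valK.
Qed.

End ThinSummands.

Section Interval.
Variables (k : fieldType) (n : nat).
Local Notation A := (linear_path_algebra k n).
Local Notation E := (@punit k n).
Local Notation I a b := (thin_mod k n (fun _ : unit => a) (fun _ : unit => b)).

(** An injective morphism between nonempty intervals is nonzero and so imposes the inequalities of
    [thin_hom_matrix]; the isomorphism and its inverse impose them both ways. *)
Lemma interval_iso a b c d : (a < b <= n)%N -> (c < d <= n)%N ->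
  rmod_iso (I a b : rmodType A) (I c d) -> a = c /\ b = d.
Proof.
have aux a' b' c' d' (f : {linear I a' b' -> I c' d'}) : injective f -> (a' < b' <= n)%N -> (d' <= n)%N ->
    (c' <= a' /\ d' <= b')%N.
  move=> fI ab dn; have [|m [mP fE]] := thin_hom_matrix f; first by [].
  have an : (a' < n)%N by lia.
  have : f (tgen k n (fun=> a') (fun=> b') tt) != 0.
    apply/eqP => f0; have : tgen k n (fun=> a') (fun _ : unit => b') tt = 0.
      by apply: fI; rewrite f0 linear0.
    move/(congr1 (fun v => tcoef v tt (Ordinal an))); rewrite tcoef_tgen tcoef0 !eqxx /=.
    by case/andP: ab => -> _ /eqP; rewrite oner_eq0.
  have [m0 /eqP[]|/mP[? ? ?] _] := pselect (m tt tt = 0); last by [].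
  by apply: tcoef_inj => -[] j; rewrite fE sum_unit m0 mul0r tcoef0; case: ifP.
move=> ab cd [f fb]; have [g [fg gf]] := inverse_linear fb.
have [] := aux _ _ _ _ _ (can_inj fg) ab; first by lia.
have [] := aux _ _ _ _ _ (can_inj gf) cd; first by lia.
lia.
Qed.

(* Every nonzero submodule contains the last basis vector, so two nonzero ones
   cannot be independent. *)
Lemma interval_indecomposable a b : (a < b <= n)%N -> indecomposable (I a b : rmodType A).
Proof.
move=> ab; have bn : (b.-1 < n)%N by lia.
pose z : I a b := of_tcoef _ _ (fun _ j => (j == b.-1 :> nat)%:R).
have zE j : tcoef z tt j = (j == b.-1 :> nat)%:R.
  by rewrite of_tcoefK; case: eqP => [->|]; case: ifP => //; lia.
have z0 : z <> 0.
  move/(congr1 (fun v => tcoef v tt (Ordinal bn))); rewrite zE tcoef0 eqxx.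
  by move/eqP; rewrite oner_eq0.
have soc (v : I a b) : v <> 0 -> exists f, ract v f = z.
  move=> v0; have [j vj] : exists j, tcoef v tt j <> 0.
    apply: contrapT => h; apply: v0; apply: tcoef_inj => -[] j; rewrite tcoef0.
    by apply: contrapT => h'; apply: h; exists j.
  have jab := tcoef_in vj.
  exists ((tcoef v tt j)^-1 *: E j b.-1); apply: tcoef_inj => -[] l; rewrite tcoef_ract zE.
  rewrite (bigD1 j) //= big1 ?addr0 => [|i ij]; last first.
    by rewrite pcoefZ pcoef_punit val_eqE (negbTE ij) andbF !mulr0.
  rewrite pcoefZ pcoef_punit eqxx.
  have -> : (j <= b.-1)%N by lia.
  by rewrite /= mulrA mulfV ?mul1r; [case: eqP => [->|]; case: ifP => //; lia|apply/eqP].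
split; first by exists z.
move=> X Y [f fb]; have [g [fg gf]] := inverse_linear fb.
apply: contrapT => /not_orP[/existsNP[x x0] /existsNP[y y0]].
have [r rE] : exists r, ract (g (x, 0)) r = z.
  by apply: soc => /(congr1 f); rewrite gf linear0 => -[].
have [s sE] : exists s, ract (g (0, y)) s = z.
  by apply: soc => /(congr1 f); rewrite gf linear0 => -[].
apply: z0; apply: (can_inj fg); rewrite linear0.
have := rE; rewrite -sE -!ract_linear => /(can_inj gf) [_].
rewrite scaler0 => e; rewrite gf.
by apply: eq_pair => /=; [exact: scaler0|rewrite -e].
Qed.

End Interval.

(** * Indecomposable modules are interval modules *)

Section Functional.
Variables (k : fieldType) (n : nat).
Local Notation A := (linear_path_algebra k n).
Local Notation E := (@punit k n).

(** M is a k-space only through [pa_scalar], so linear algebra is done on coordinates: among the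
    matrices whose rows lie in the kernel, one of maximal rank spans it. *)
Lemma kernel_row_space r (M : rmodType A) (Phi : 'rV[k]_r -> M) :
  {morph Phi : u v / u + v} ->
  (forall c u, Phi (c *: u) = ract (Phi u) (pa_scalar _ c)) ->
  exists W : 'M[k]_r, forall u, Phi u = 0 <-> (u <= W)%MS.
Proof.
move=> PhiD PhiZ.
have Phi0 : Phi 0 = 0 by have := PhiD 0 0; rewrite addr0 => /esym/eqP; rewrite -subr_eq0 addrK => /eqP.
have Phi_sum (I : finType) (F : I -> 'rV[k]_r) : Phi (\sum_i F i) = \sum_i Phi (F i).
  exact: (big_morph _ PhiD Phi0).
have vanish m (W : 'M[k]_(m, r)) u : (forall i, Phi (row i W) = 0) -> (u <= W)%MS -> Phi u = 0.
  move=> W0 /submxP[D ->]; rewrite mulmx_sum_row Phi_sum big1 // => i _.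
  by rewrite PhiZ W0 ract0l.
pose P d := `[< exists W : 'M[k]_r, \rank W = d /\ forall i, Phi (row i W) = 0 >].
have P0 : exists d, P d.
  by exists 0%N; apply/asboolP; exists 0; split=> [|i]; rewrite ?mxrank0 // row0.
have Pb d : P d -> (d <= r)%N by move=> /asboolP[W [<- _]]; exact: rank_leq_row.
case: (ex_maxnP P0 Pb) => d /asboolP[W [rW W0]] dmax.
exists W => u; split=> [u0|]; last exact: vanish.
apply: contraT => uW.
have : P (\rank (W + u)%MS).
  apply/asboolP; exists (W + u)%MS; split=> // i.
  apply: (@vanish _ (col_mx W u)); last first.
    by apply: submx_trans (row_sub i _) _; rewrite addsmxE.
  move=> j; rewrite -[j]splitK; case: (split j) => l /=.
    by rewrite rowKu W0.
  by rewrite rowKd row_id.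
move/dmax; rewrite -rW => le.
have /andP[_ h] : (W == W + u)%MS.
  by rewrite -(mxrank_leqif_eq (addsmxSl W u)) eqn_leq le mxrankS ?addsmxSl.
by case/negP: uW; apply: submx_trans h; exact: addsmxSr.
Qed.

(** M is identified with a space of row vectors modulo the row space of W. Multiplication by
    [cokermx W] gives well-defined coordinates on this quotient, and one that does not vanish at y
    is normalised. *)
Lemma functional_exists (M : rmodType A) (y : M) : finitely_generated M -> y <> 0 ->
  exists lam : M -> k, [/\ {morph lam : u v / u + v},
    forall c u, lam (ract u (pa_scalar _ c)) = c * lam u & lam y = 1].
Proof.
move=> [m [g gP]] y0.
(* The generators times the matrix units span M over k. *)
pose J : finType := ('I_m * 'I_n * 'I_n)%type.
pose h (x : J) := ract (g x.1.1) (E x.1.2 x.2).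
pose Phi (u : 'rV[k]_#|J|) := \sum_(x : J) ract (h x) (pa_scalar _ (u 0 (enum_rank x))).
have PhiD : {morph Phi : u v / u + v}.
  move=> u v; rewrite /Phi -big_split; apply: eq_bigr => x _.
  by rewrite mxE /pa_scalar scalerDl ractDr.
have PhiZ c u : Phi (c *: u) = ract (Phi u) (pa_scalar _ c).
  rewrite /Phi ract_suml; apply: eq_bigr => x _.
  by rewrite mxE ract_scalar_comm -ract_scale /pa_scalar scalerA.
have Phi_surj x : exists u, Phi u = x.
  have [c ->] := gP x.
  exists (\row_j pcoef (c (enum_val j).1.1 : A) (enum_val j).1.2 (enum_val j).2).
  rewrite /Phi.
  transitivity (\sum_i \sum_a \sum_b ract (h (i, a, b)) (pa_scalar _ (pcoef (c i : A) a b))).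
    rewrite !pair_big /=; apply: eq_bigr => -[[i a] b] _.
    by rewrite mxE enum_rankK.
  apply: eq_bigr => i _; rewrite -[RHS]/(ract (g i) (c i)) {2}(punit_expand (c i)) ract_sumr.
  apply: eq_bigr => a _; rewrite ract_sumr; apply: eq_bigr => b _.
  by rewrite ract_scale ract_scalar_comm.
have [W WP] := kernel_row_space PhiD PhiZ.
pose u x := projT1 (cid (Phi_surj x)).
have uE x : Phi (u x) = x by rewrite /u; case: cid.
have PhiB v w : Phi v = Phi w -> v *m cokermx W = w *m cokermx W.
  move=> e; apply/eqP; rewrite -subr_eq0 -mulmxBl -submxE; apply/WP.
  have -> : v - w = v + (-1) *: w by rewrite scaleN1r.
  by rewrite PhiD PhiZ e /pa_scalar scaleN1r /ract scaleNr scale1r subrr.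
have [j uj] : exists j, (u y *m cokermx W) 0 j <> 0.
  apply: contrapT => H; apply: y0; rewrite -(uE y); apply/WP; rewrite submxE.
  apply/eqP/rowP => j; rewrite [RHS]mxE; apply: contrapT => h'; by apply: H; exists j.
exists (fun x => (u x *m cokermx W) 0 j / (u y *m cokermx W) 0 j); split.
- move=> v w; rewrite -mulrDl; congr (_ / _).
  rewrite (PhiB (u (v + w)) (u v + u w)) ?PhiD ?uE //.
  by rewrite mulmxDl mxE.
- move=> c v; rewrite mulrA; congr (_ / _).
  by rewrite (PhiB _ (c *: u v)) ?PhiZ ?uE // -scalemxAl mxE.
- by rewrite divff //; apply/eqP.
Qed.

(* A generator of the submodule at the first vertex a in the support of M spans an
   interval module; a linear form that is nonzero at its other end b - 1 splits it
   off, because M vanishes before a. *)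
Lemma indecomposable_interval (M : rmodType A) : finitely_generated M -> indecomposable M ->
  exists a b, (a < b <= n)%N /\
    rmod_iso M (thin_mod k n (fun _ : unit => a) (fun=> b)).
Proof.
move=> fgM [[m0 m0P] indec].
pose P a := `[< exists m : M, ract m (E a a) <> 0 >].
have exP : exists a, P a.
  apply: contrapT => H; apply: m0P; rewrite -[m0]ract1 punit1 ract_sumr big1 // => i _.
  by apply: contrapT => h; apply: H; exists i; apply/asboolP; exists m0.
case: (ex_minnP exP) => a /asboolP[m mP] amin.
have Mlt (i : nat) (v : M) : (i < a)%N -> ract v (E i i) = 0.
  move=> ia; apply: contrapT => h; have : (a <= i)%N by apply: amin; apply/asboolP; exists v.
  lia.
have an : (a < n)%N by rewrite ltnNge; apply/negP => h; apply: mP; rewrite punit_ge // ract0r.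
pose x := ract m (E a a).
have xE j : (a <= j)%N -> ract x (E a a * E a j) = ract x (E a j).
  by move=> aj; rewrite punitM // eqxx.
have xa : ract x (E a a) = x by rewrite /x -ractM punitM // eqxx.
pose Q j := `[< ract x (E a j) <> 0 >].
have exQ : exists j, Q j by exists a; apply/asboolP; rewrite xa.
have Qn j : Q j -> (j <= n)%N.
  by move=> /asboolP h; rewrite leqNgt; apply/negP => nj; apply: h; rewrite punit_ge ?ract0r // ltnW.
case: (ex_maxnP exQ Qn) => c /asboolP xc cmax {exQ Qn}.
have ac : (a <= c)%N by rewrite leqNgt; apply/negP => h; apply: xc; rewrite punit_gt // ract0r.
have cn : (c < n)%N by rewrite ltnNge; apply/negP => h; apply: xc; rewrite punit_ge // ract0r.
have [lam [lamD lamZ lam1]] := functional_exists fgM xc.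
have lam0 : lam 0 = 0 by have := lamD 0 0; rewrite addr0 => /esym/eqP; rewrite -subr_eq0 addrK => /eqP.
have lam_sum (I : finType) (F : I -> M) : lam (\sum_i F i) = \sum_i lam (F i).
  exact: (big_morph _ lamD lam0).
pose I := thin_mod k n (fun _ : unit => a) (fun=> c.+1).
pose t := tgen k n (fun _ : unit => a) (fun=> c.+1) tt.
have [|phi phiE] := @thin_hom k n unit (fun=> a) (fun=> c.+1) M (fun=> x).
  move=> _ j cj; apply: contrapT => h.
  by have : (j <= c)%N by [apply: cmax; apply/asboolP]; lia.
(* The retraction reads v at vertex j by pushing it along the path to c and applying [lam]. It
   commutes with the action because M vanishes at the vertices before a. *)
have [||r rE] := @linear_intro _ M I (fun v => of_tcoef _ _ (fun _ j => lam (ract v (E j c)))).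
- by move=> u v; apply: tcoef_inj => -[] j; rewrite tcoefD !of_tcoefK; case: ifP;
    rewrite ?addr0 // ractDl lamD.
- move=> f v; apply: tcoef_inj => -[] j; rewrite -[f *: of_tcoef _ _ _]/(ract (_ : I) f).
  rewrite -[f *: v]/(ract v f) tcoef_ract of_tcoefK; case: ifP => // acj.
  rewrite -ractM punit_mulr; last by lia.
  rewrite ract_sumr lam_sum; apply: eq_bigr => i _.
  rewrite ract_scale ract_scalar_comm lamZ of_tcoefK mulrC; case: ifP => // /negbT aci.
  case: (ltnP i a) => ia; last by rewrite pcoef_lt ?mulr0 ?mul0r //; lia.
  have -> : E i c = E i i * E i c by rewrite punitM ?eqxx //; lia.
  by rewrite ractM Mlt // ract0l lam0 !mul0r.
have rphi : forall v, r (phi v) = v.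
  apply: (@thin_hom_ext _ _ _ _ _ _ (r \o phi) idfun) => -[] /=.
  rewrite phiE xa rE; apply: tcoef_inj => -[] j; rewrite of_tcoefK tcoef_tgen /=.
  case: ifP => [acj|]; last by case: (j =P a :> nat) => [->|]; rewrite ?andbF //; lia.
  rewrite -xa -ractM punitM //; last by lia.
  rewrite eq_sym; case: (j =P a :> nat) => [e|_]; last by rewrite ract0r lam0.
  by rewrite lam1 ltnS ac.
have [|u v|f v|K [j [jI jP]]] := @submodule_exists _ M (fun v => r v = 0).
- exact: linear0.
- by rewrite linearD => -> ->; rewrite addr0.
- by rewrite linearZ /= => ->; rewrite scaler0.
have [||q qE] := @linear_intro _ M M (fun v => v - phi (r v)).
- by move=> u v; rewrite !linearD /= addrACA.
- by move=> f v; rewrite !linearZ /= -scalerDr.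
have [|ka kaE] := @factor_through _ _ _ _ j q jI.
  by move=> v; apply/jP; rewrite qE linearB rphi subrr.
have [||F FE] := @linear_intro _ M (I * K)%type (fun v => (r v, ka v)).
- by move=> u v; rewrite !linearD.
- by move=> f v; rewrite !linearZ.
have Fb : bijective F.
  exists (fun z => phi z.1 + j z.2) => [v|[z w]]; rewrite FE.
    by rewrite /= kaE qE addrC subrK.
  have rw : r (j w) = 0 by apply/jP; exists w.
  apply: eq_pair => /=; first by rewrite linearD rphi rw addr0.
  by apply: jI; rewrite kaE qE linearD rphi rw addr0 addrC addKr.
exists a, c.+1; split; first by rewrite ltnS ac.
have [I0|K0] := indec _ _ (ex_intro _ F Fb).
  have := I0 t => /(congr1 (fun v => tcoef v tt (Ordinal an))).
  by rewrite tcoef_tgen tcoef0 !eqxx ltnS ac => /eqP; rewrite oner_eq0.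
exists r, phi => // v.
by have := kaE v; rewrite (K0 (ka v)) linear0 qE => /esym/eqP; rewrite subr_eq0 => /eqP.
Qed.

End Functional.

(** * Algebras with a triangular basis *)

Section ThinAlgebra.
Variable k : fieldType.

(* R has a basis e_xy, indexed by the pairs with h x y, such that e_xy e_yz is e_xz
   if h x z and 0 otherwise; c u x y is the coefficient of u at e_xy. *)
Record thin_alg (S : finType) (h : rel S) (R : algType k) (c : R -> S -> S -> k) : Prop :=
  ThinAlg {
    ta_out : forall u x y, ~~ h x y -> c u x y = 0;
    ta_add : forall u v x y, c (u + v) x y = c u x y + c v x y;
    ta_scale : forall a u x y, c (a *: u) x y = a * c u x y;
    ta_one : forall x y, c 1 x y = (x == y)%:R;
    ta_mul : forall u v x z, c (u * v) x z = if h x z then \sum_y c u x y * c v y z else 0;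
    ta_inj : forall u v, (forall x y, c u x y = c v x y) -> u = v;
    ta_surj : forall F, exists u, forall x y, c u x y = if h x y then F x y else 0 }.

Section Concrete.
Variables (S : finType) (h : rel S) (s0 : S).
Hypothesis hR : reflexive h.
Hypothesis hA : forall x y z w, h x y -> h y z -> h z w -> h x w -> h x z && h y w.

Let idx : finType := {p : S * S | h p.1 p.2}.
Let TA : Type := {ffun idx -> k}.
HB.instance Definition _ := GRing.Lmodule.copy TA {ffun idx -> k^o}.

Let cf (u : TA) x y : k := if insub (x, y) is Some p then u p else 0.
Let mk (F : S -> S -> k) : TA := [ffun p => F (val p).1 (val p).2].

Let mkK F x y : cf (mk F) x y = if h x y then F x y else 0.
Proof.
rewrite /cf; case: insubP => [p /= -> e|/negbTE /= -> //].
by rewrite ffunE /= e.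
Qed.

Let cf_out u x y : ~~ h x y -> cf u x y = 0.
Proof. by move=> /negbTE xy; rewrite /cf insubF. Qed.

Let cf_in u x y : cf u x y <> 0 -> h x y.
Proof. by move=> xy; apply/negP => /negP /(cf_out u). Qed.

Let cf_inj u v : (forall x y, cf u x y = cf v x y) -> u = v.
Proof.
move=> e; apply/ffunP => p; have := e (val p).1 (val p).2.
by rewrite /cf -surjective_pairing valK.
Qed.

Let cfD u v x y : cf (u + v) x y = cf u x y + cf v x y.
Proof. by rewrite /cf; case: insub => [p|]; rewrite ?ffunE ?addr0. Qed.

Let cfZ a u x y : cf (a *: u) x y = a * cf u x y.
Proof. by rewrite /cf; case: insub => [p|]; rewrite ?ffunE ?mulr0. Qed.

Let cf0 x y : cf 0 x y = 0.
Proof. by rewrite /cf; case: insub => [p|]; rewrite ?ffunE. Qed.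

Let one : TA := mk (fun x y => (x == y)%:R).
Let mul (u v : TA) : TA := mk (fun x z => \sum_y cf u x y * cf v y z).

Let mulE u v x z : cf (mul u v) x z = if h x z then \sum_y cf u x y * cf v y z else 0.
Proof. exact: mkK. Qed.

Let oneE x y : cf one x y = (x == y)%:R.
Proof. by rewrite mkK; case: eqP => [->|_]; rewrite ?hR //; case: ifP. Qed.

(** The hypothesis [hA] says that in a chain x, y, z, t with h x t both partial products are
    nonzero, so neither bracketing loses a term that the other keeps. *)
Let mulA : associative mul.
Proof.
move=> u v w; apply: cf_inj => x t; rewrite !mulE; case: ifP => // xt.
transitivity (\sum_y \sum_z cf u x y * (cf v y z * cf w z t)).
  apply: eq_bigr => y _; rewrite mulE -big_distrr /=.
  have [->|/cf_in xy] := pselect (cf u x y = 0); first by rewrite !mul0r.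
  congr (_ * _); case: ifP => // /negP yt; rewrite big1 // => z _.
  have [->|/cf_in yz] := pselect (cf v y z = 0); first by rewrite mul0r.
  have [->|/cf_in zt] := pselect (cf w z t = 0); first by rewrite mulr0.
  by case: yt; have /andP[] := hA xy yz zt xt.
rewrite exchange_big; apply: eq_bigr => z _ /=; rewrite mulE.
have [->|/cf_in zt] := pselect (cf w z t = 0).
  by rewrite mulr0 big1 // => y _; rewrite !mulr0.
case: ifP => [_|/negP xz]; first by rewrite big_distrl; apply: eq_bigr => y _; rewrite /= mulrA.
rewrite mul0r big1 // => y _.
have [->|/cf_in xy] := pselect (cf u x y = 0); first by rewrite mul0r.
have [->|/cf_in yz] := pselect (cf v y z = 0); first by rewrite mul0r mulr0.
by case: xz; have /andP[] := hA xy yz zt xt.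
Qed.

Let mul1u : left_id one mul.
Proof.
move=> u; apply: cf_inj => x z; rewrite mulE; case: ifP => [_|/negbT/cf_out -> //].
rewrite (bigD1 x) //= big1 ?addr0 ?oneE ?eqxx ?mul1r // => y /negbTE yx.
by rewrite oneE eq_sym yx mul0r.
Qed.

Let mulu1 : right_id one mul.
Proof.
move=> u; apply: cf_inj => x z; rewrite mulE; case: ifP => [_|/negbT/cf_out -> //].
rewrite (bigD1 z) //= big1 ?addr0 ?oneE ?eqxx ?mulr1 // => y /negbTE yx.
by rewrite oneE yx mulr0.
Qed.

Let mulDl : left_distributive mul +%R.
Proof.
move=> u v w; apply: cf_inj => x z; rewrite cfD !mulE; case: ifP; rewrite ?addr0 // => _.
by rewrite -big_split; apply: eq_bigr => y _; rewrite cfD mulrDl.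
Qed.

Let mulDr : right_distributive mul +%R.
Proof.
move=> u v w; apply: cf_inj => x z; rewrite cfD !mulE; case: ifP; rewrite ?addr0 // => _.
by rewrite -big_split; apply: eq_bigr => y _; rewrite cfD mulrDr.
Qed.

Let one_neq0 : one != 0.
Proof.
apply/eqP => /(congr1 (fun u => cf u s0 s0)); rewrite oneE cf0 eqxx => /eqP.
by rewrite oner_eq0.
Qed.

HB.instance Definition _ := GRing.Zmodule_isNzRing.Build TA mulA mul1u mulu1 mulDl mulDr one_neq0.

Let scaleAl a (u v : TA) : a *: (u * v) = (a *: u) * v.
Proof.
apply: cf_inj => x z; rewrite cfZ [LHS](congr1 _ (mulE _ _ _ _)) [RHS]mulE; case: ifP; rewrite ?mulr0 // => _.
by rewrite big_distrr; apply: eq_bigr => y _; rewrite cfZ /= mulrA.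
Qed.
HB.instance Definition _ := GRing.Lmodule_isLalgebra.Build k TA scaleAl.

Let scaleAr a (u v : TA) : a *: (u * v) = u * (a *: v).
Proof.
apply: cf_inj => x z; rewrite cfZ [LHS](congr1 _ (mulE _ _ _ _)) [RHS]mulE; case: ifP; rewrite ?mulr0 // => _.
by rewrite big_distrr; apply: eq_bigr => y _; rewrite cfZ /= mulrCA.
Qed.
HB.instance Definition _ := GRing.Lalgebra_isAlgebra.Build k TA scaleAr.

Lemma thin_alg_exists : exists (R : algType k) (c : R -> S -> S -> k), thin_alg h c.
Proof.
exists (TA : algType k), cf; split=> //.
by move=> F; exists (mk F) => x y; rewrite mkK.
Qed.

End Concrete.

Section Iso.
Variables (S S' : finType) (h : rel S) (h' : rel S') (R R' : algType k).
Variables (c : R -> S -> S -> k) (c' : R' -> S' -> S' -> k).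
Hypotheses (taR : thin_alg h c) (taR' : thin_alg h' c').

Lemma thin_alg_iso (sg : S -> S') : bijective sg ->
  (forall x y, h' (sg x) (sg y) = h x y) -> alg_iso R R'.
Proof.
move=> [tu st ts] hh.
have /choice[f fE] : forall u, exists u', forall x y, c' u' (sg x) (sg y) = c u x y.
  move=> u; have [u' uE] := ta_surj taR' (fun x y => c u (tu x) (tu y)).
  exists u' => x y; rewrite uE !st hh; case: ifP => // /negbT xy.
  by rewrite (ta_out taR).
have /choice[g gE] : forall u', exists u, forall x y, c u x y = c' u' (sg x) (sg y).
  move=> u; have [u' uE] := ta_surj taR (fun x y => c' u (sg x) (sg y)).
  exists u' => x y; rewrite uE; case: ifP => // /negbT xy.
  by rewrite (ta_out taR') // hh.
have inj' u v : (forall x y, c' u (sg x) (sg y) = c' v (sg x) (sg y)) -> u = v.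
  by move=> e; apply: (ta_inj taR') => x y; have := e (tu x) (tu y); rewrite !ts.
have fD u v : f (u + v) = f u + f v.
  by apply: inj' => x y; rewrite (ta_add taR') !fE (ta_add taR).
have fZ a u : f (a *: u) = a *: f u.
  by apply: inj' => x y; rewrite (ta_scale taR') !fE (ta_scale taR).
have f1 : f 1 = 1.
  apply: inj' => x y; rewrite fE (ta_one taR) (ta_one taR').
  by rewrite (inj_eq (can_inj st)).
have fM u v : f (u * v) = f u * f v.
  apply: inj' => x y; rewrite fE (ta_mul taR) (ta_mul taR') hh; case: ifP => // _.
  rewrite [RHS](reindex sg) /=; last by exists tu => z _; rewrite ?st ?ts.
  by apply: eq_bigr => z _; rewrite !fE.
have fB : zmod_morphism f.
  by move=> u v; rewrite -scaleN1r fD fZ scaleN1r.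
have mf : monoid_morphism f by split.
pose m1 := GRing.isZmodMorphism.Build R R' f fB.
pose m2 := GRing.isMonoidMorphism.Build R R' f mf.
pose m3 := GRing.isScalable.Build k R R' *:%R f fZ.
pose F : {lrmorphism R -> R'} := HB.pack f m1 m2 m3.
exists F; exists g => u.
  by apply: (ta_inj taR) => x y; rewrite gE fE.
by apply: inj' => x y; rewrite fE gE.
Qed.

End Iso.

Lemma lrmorphism_inverse (R R' : algType k) (f : {lrmorphism R -> R'}) : bijective f ->
  exists g : {lrmorphism R' -> R}, cancel f g /\ cancel g f.
Proof.
move=> [g fg gf]; have gI u v : f u = f v -> u = v := can_inj fg (x1 := u) (x2 := v).
have gf1 u : f (g u) = u := gf u.
have gB : zmod_morphism g.
  by move=> u v; apply: gI; rewrite raddfB /= !gf1.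
have gM : monoid_morphism g.
  by split=> [|u v]; apply: gI; rewrite ?rmorph1 ?rmorphM /= !gf1.
have gZ : scalable g by move=> a u; apply: gI; rewrite linearZ /= !gf1.
pose m1 := GRing.isZmodMorphism.Build R' R g gB.
pose m2 := GRing.isMonoidMorphism.Build R' R g gM.
pose m3 := GRing.isScalable.Build k R' R *:%R g gZ.
pose G : {lrmorphism R' -> R} := HB.pack g m1 m2 m3.
by exists G.
Qed.

Lemma alg_iso_sym (R R' : algType k) : alg_iso R R' -> alg_iso R' R.
Proof. by move=> [f /lrmorphism_inverse[g [fg gf]]]; exists g; exists f. Qed.

Lemma alg_iso_trans (R1 R2 R3 : algType k) : alg_iso R1 R2 -> alg_iso R2 R3 -> alg_iso R1 R3.
Proof.
move=> [f [f' ff' f'f]] [g [g' gg' g'g]].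
exists (g \o f); exists (f' \o g') => x /=; first by rewrite gg' ff'.
by rewrite f'f g'g.
Qed.

Lemma alg_iso_refl (R : algType k) : alg_iso R R.
Proof. by exists idfun; exists idfun. Qed.

End ThinAlgebra.

(** * Endomorphism algebras of sums of interval modules *)

Section EndAlgebra.
Variables (k : fieldType) (n : nat) (S : finType) (lo hi : S -> nat).
Hypothesis lohi : forall s, (lo s < hi s <= n)%N.
Local Notation A := (linear_path_algebra k n).
Local Notation TM := (thin_mod k n lo hi).
Local Notation tgen := (tgen k n lo hi).

Lemma lo_lt s : (lo s < n)%N.
Proof. by case/andP: (lohi s) => h1 h2; exact: leq_trans h1 h2. Qed.

(** There is a nonzero morphism from the summand y to the summand x. The target comes first, so that
    composition of endomorphisms becomes the matrix product. *)
Definition thin_rel : rel S := fun x y => [&& lo x <= lo y, lo y < hi x & hi x <= hi y]%N.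

Definition end_coef (F : {linear TM -> TM}) x y : k := tcoef (F (tgen y)) x (Ordinal (lo_lt y)).

Lemma thin_map_end_coef (F : {linear TM -> TM}) (m : S -> S -> k) :
  (forall s t, m s t <> 0 -> thin_rel t s) ->
  (forall v t j, tcoef (F v) t j = if (lo t <= j < hi t)%N then \sum_s m s t * tcoef v s j else 0) ->
  forall x y, end_coef F x y = m y x.
Proof.
move=> mP FE x y; rewrite /end_coef FE (bigD1 y) //= big1 ?addr0 => [|s /negbTE sy]; last first.
  by rewrite tcoef_tgen sy mulr0.
rewrite tcoef_tgen !eqxx; have /andP[-> _] := lohi y.
case: ifP => [_|h]; first by rewrite mulr1.
apply/esym; apply: contrapT => /mP /and3P[h1 h2 h3]; lia.
Qed.

Lemma end_coef_out (F : {linear TM -> TM}) x y : end_coef F x y <> 0 -> thin_rel x y.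
Proof.
have [|m [mP FE]] := thin_hom_matrix F; first by move=> t; case/andP: (lohi t).
have mR s t : m s t <> 0 -> thin_rel t s by move/mP/and3P.
by rewrite (thin_map_end_coef mR FE) => /mR.
Qed.

Lemma end_coefE (F : {linear TM -> TM}) v x j :
  tcoef (F v) x j = if (lo x <= j < hi x)%N then \sum_y end_coef F x y * tcoef v y j else 0.
Proof.
have [|m [mP FE]] := thin_hom_matrix F; first by move=> t; case/andP: (lohi t).
have mR s t : m s t <> 0 -> thin_rel t s by move/mP/and3P.
rewrite FE; case: ifP => // _; apply: eq_bigr => y _.
by rewrite (thin_map_end_coef mR FE).
Qed.

Lemma end_coef_exists (m : S -> S -> k) : exists F : {linear TM -> TM},
  forall x y, end_coef F x y = if thin_rel x y then m x y else 0.
Proof.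
have mR s t : (if thin_rel t s then m t s else 0) <> 0 -> thin_rel t s by case: ifP.
have [|F FE] := @thin_map k n S S lo hi lo hi (fun s t => if thin_rel t s then m t s else 0).
  by move=> s t /mR /and3P[].
by exists F => x y; rewrite (thin_map_end_coef mR FE).
Qed.

Lemma tcoef_scalar a (v : TM) s j : tcoef (ract v (pa_scalar _ a)) s j = a * tcoef v s j.
Proof.
rewrite tcoef_ract; case: ifP => [_|/negbT h]; last by rewrite tcoef_out ?mulr0.
rewrite (bigD1 j) //= big1 ?addr0 => [|i /negbTE ij]; rewrite /pa_scalar pcoefZ pcoef1.
  by rewrite eqxx mulr1 mulrC.
by rewrite ij !mulr0.
Qed.

Lemma end_algebra_thin (T : rmodType A) (phi : {linear T -> TM}) (B : algType k) :
  bijective phi -> is_End_algebra T B -> exists c, @thin_alg k S thin_rel B c.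
Proof.
move=> phib [rho [[rhoD rhoM rho1 rhoZ] [rhoI rhoS]]].
have [psi [pK Kp]] := inverse_linear phib.
pose F b : {linear TM -> TM} := phi \o (rho b \o psi).
have FI b c : (forall x y, end_coef (F b) x y = end_coef (F c) x y) -> b = c.
  move=> e; apply: rhoI => t; apply: (can_inj pK).
  suff : F b (phi t) = F c (phi t) by rewrite /= !pK.
  apply: tcoef_inj => s j; rewrite !end_coefE; case: ifP => // _.
  by apply: eq_bigr => y _; rewrite e.
exists (fun b => end_coef (F b)); split=> //.
- by move=> b x y xy; apply: contrapT => /end_coef_out; exact/negP.
- by move=> b c x y; rewrite /end_coef /= rhoD linearD tcoefD.
- by move=> a b x y; rewrite /end_coef /= rhoZ linearZ /= -[_ *: _]/(ract _ _) tcoef_scalar.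
- move=> x y; rewrite /end_coef /= rho1 Kp tcoef_tgen eqxx /=.
  by have /andP[-> _] := lohi y; rewrite andbT.
- move=> b c x z.
  have -> : end_coef (F (b * c)) x z = tcoef (F b (F c (tgen z))) x (Ordinal (lo_lt z)).
    by rewrite /end_coef /= pK rhoM.
  rewrite end_coefE; case: (boolP (thin_rel x z)) => [/and3P[h1 h2 h3]|xz].
    by rewrite /= h1 h2.
  (* If x and z are unrelated, every composite from z through y to x vanishes: two related pairs in
     a row, seen at a vertex of x, would relate x to z. *)
  case: ifP => //= /andP[h1 h2]; rewrite big1 // => y _.
  have [->|/end_coef_out/and3P[? ? ?]] := pselect (end_coef (F b) x y = 0); first by rewrite mul0r.
  have [->|/tcoef_in h4] := pselect (tcoef (F c (tgen z)) y (Ordinal (lo_lt z)) = 0); first by rewrite mulr0.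
  have [e|/end_coef_out/and3P[? ? ?]] := pselect (end_coef (F c) y z = 0).
    by rewrite -[tcoef _ _ _]/(end_coef (F c) y z) e mulr0.
  by case/negP: xz; apply/and3P; split; lia.
- move=> m; have [G GE] := end_coef_exists m.
  have [b bE] := rhoS (psi \o (G \o phi)).
  exists b => x y; rewrite -GE /end_coef /= bE /= !Kp //.
Qed.

Lemma thin_algebra_end (B : algType k) c : @thin_alg k S thin_rel B c -> is_End_algebra TM B.
Proof.
move=> taB.
have /choice[rho rhoE] : forall b, exists F : {linear TM -> TM}, forall x y, end_coef F x y = c b x y.
  move=> b; have [F FE] := end_coef_exists (c b); exists F => x y; rewrite FE.
  by case: ifP => // /negbT /(ta_out taB).
have rE b v x j : tcoef (rho b v) x j = if (lo x <= j < hi x)%N then \sum_y c b x y * tcoef v y j else 0.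
  by rewrite end_coefE; case: ifP => // _; apply: eq_bigr => y _; rewrite rhoE.
exists rho; split; last split.
- split.
  + move=> b b' v; apply: tcoef_inj => x j; rewrite tcoefD !rE; case: ifP; rewrite ?addr0 // => _.
    by rewrite -big_split; apply: eq_bigr => y _; rewrite (ta_add taB) mulrDl.
  + move=> b b' v; apply: tcoef_inj => x j; rewrite !rE; case: ifP => // xj.
    transitivity (\sum_y \sum_z c b x y * (c b' y z * tcoef v z j)); last first.
      apply: eq_bigr => y _; rewrite rE -big_distrr /=; case: ifP => // yj.
      have [->|h] := pselect (c b x y = 0); first by rewrite !mul0r.
      have /and3P[? ? ?] : thin_rel x y by apply/negP => /negP /(ta_out taB b).
      rewrite big1 ?mulr0 // => z _.
      have [->|h'] := pselect (c b' y z = 0); first by rewrite mul0r.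
      have /and3P[? ? ?] : thin_rel y z by apply/negP => /negP /(ta_out taB b').
      by have [->|/tcoef_in ?] := pselect (tcoef v z j = 0); [rewrite mulr0|lia].
    rewrite exchange_big; apply: eq_bigr => z _ /=; rewrite (ta_mul taB).
    case: ifP => xz; first by rewrite big_distrl; apply: eq_bigr => y _; rewrite /= mulrA.
    rewrite mul0r big1 // => y _.
    have [->|h] := pselect (c b x y = 0); first by rewrite !mul0r.
    have /and3P[? ? ?] : thin_rel x y by apply/negP => /negP /(ta_out taB b).
    have [->|h'] := pselect (c b' y z = 0); first by rewrite mul0r mulr0.
    have /and3P[? ? ?] : thin_rel y z by apply/negP => /negP /(ta_out taB b').
    have [->|/tcoef_in ?] := pselect (tcoef v z j = 0); first by rewrite !mulr0.
    by move/negP: xz; case; apply/and3P; split; lia.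
  + move=> v; apply: tcoef_inj => x j; rewrite rE; case: ifP => [_|/negbT/tcoef_out -> //].
    rewrite (bigD1 x) //= big1 ?addr0 => [|y /negbTE yx]; rewrite (ta_one taB) ?eqxx ?mul1r //.
    by rewrite eq_sym yx mul0r.
  + move=> a b v; apply: tcoef_inj => x j.
    rewrite -[_ *: rho b v]/(ract _ _) tcoef_scalar !rE; case: ifP; rewrite ?mulr0 // => _.
    by rewrite big_distrr; apply: eq_bigr => y _; rewrite (ta_scale taB) /= mulrA.
- move=> b b' e; apply: (ta_inj taB) => x y; rewrite -!rhoE /end_coef.
  by rewrite e.
- move=> f; have [b bE] := ta_surj taB (end_coef f).
  exists b => v; apply: tcoef_inj => x j; rewrite rE [RHS]end_coefE; case: ifP => // _.
  apply: eq_bigr => y _; rewrite bE; case: ifP => // /negP xy.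
  by rewrite (contrapT (fun h => xy (@end_coef_out f x y h))).
Qed.

Lemma thin_rel_refl : reflexive thin_rel.
Proof. by move=> s; rewrite /thin_rel !leqnn; case/andP: (lohi s) => ->. Qed.

(** The convexity condition that makes the multiplication of [thin_alg_exists] associative. *)
Lemma thin_rel_conv x y z w :
  thin_rel x y -> thin_rel y z -> thin_rel z w -> thin_rel x w -> thin_rel x z && thin_rel y w.
Proof. rewrite /thin_rel; lia. Qed.

End EndAlgebra.

(** * Recovering the relation from the algebra *)

Section Invariance.
Variable k : fieldType.

Section Character.
Variables (S : finType) (h : rel S) (R : algType k) (c : R -> S -> S -> k).
Hypotheses (taR : thin_alg h c) (hN : forall x y, h x y -> h y x -> x = y).

Lemma ta_refl x : h x x.
Proof.
apply: contraT => /(ta_out taR 1); rewrite (ta_one taR) eqxx => /eqP.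
by rewrite oner_eq0.
Qed.

Lemma ta_zero x y : c 0 x y = 0.
Proof. by have := ta_scale taR 0 0 x y; rewrite scale0r mul0r. Qed.

Lemma ta_sum (I : finType) (F : I -> R) x y : c (\sum_i F i) x y = \sum_i c (F i) x y.
Proof. by elim/big_rec2: _ => [|i a b _ <-]; rewrite ?ta_zero // (ta_add taR). Qed.

Lemma ta_unit_exists (p : S * S) : exists e, forall x y,
  c e x y = (h p.1 p.2 && (x == p.1) && (y == p.2))%:R.
Proof.
have [e eE] := ta_surj taR (fun x y => ((x == p.1) && (y == p.2))%:R).
exists e => x y; rewrite eE; case: (x =P p.1) => [->|_]; last by rewrite andbF /=; case: ifP.
case: (y =P p.2) => [->|_]; last by rewrite !andbF /=; case: ifP.
by rewrite !andbT; case: ifP.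
Qed.

Definition ta_unit x y : R := projT1 (cid (ta_unit_exists (x, y))).

Lemma ta_unitE a b x y : c (ta_unit a b) x y = (h a b && (x == a) && (y == b))%:R.
Proof. by rewrite /ta_unit; case: cid. Qed.

Lemma ta_expand u : u = \sum_x \sum_y c u x y *: ta_unit x y.
Proof.
apply: (ta_inj taR) => x y; rewrite ta_sum (bigD1 x) //= [X in _ + X]big1 ?addr0.
  rewrite ta_sum (bigD1 y) //= [X in _ + X]big1 ?addr0.
    rewrite (ta_scale taR) ta_unitE !eqxx !andbT.
    by case: (boolP (h x y)) => xy; rewrite ?mulr1 // (ta_out taR) // mul0r.
  by move=> z zy; rewrite (ta_scale taR) ta_unitE [y == z]eq_sym (negbTE zy) andbF mulr0.
move=> z zx; rewrite ta_sum big1 // => t _.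
by rewrite (ta_scale taR) ta_unitE [x == z]eq_sym (negbTE zx) andbF mulr0.
Qed.

Lemma ta_unitM x y z : h x y -> h y z ->
  ta_unit x y * ta_unit y z = if h x z then ta_unit x z else 0.
Proof.
move=> xy yz; apply: (ta_inj taR) => a b; rewrite (ta_mul taR).
rewrite (bigD1 y) //= big1 ?addr0 => [|t /negbTE ty]; last first.
  by rewrite !ta_unitE ty andbF mul0r.
rewrite !ta_unitE !eqxx xy yz /= andbT -natrM mulnb.
case: (a =P x) => [->|ax]; case: (b =P z) => [->|bz] /=; rewrite ?andbF /=;
  case: (boolP (h x z)) => xz; rewrite ?ta_unitE ?ta_zero ?xz ?eqxx //; do ?case: eqP => //;
  by case: ifP.
Qed.

Lemma ta_unitM_ne x y z t : y != z -> ta_unit x y * ta_unit z t = 0.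
Proof.
move=> yz; apply: (ta_inj taR) => a b; rewrite (ta_mul taR) ta_zero; case: ifP => // _.
rewrite big1 // => s _; rewrite !ta_unitE.
case: (s =P y) => [->|]; last by rewrite andbF mul0r.
by rewrite (negbTE yz) andbF /= mulr0.
Qed.

(** By antisymmetry no product of two off-diagonal terms returns to the diagonal. Hence diagonal
    coefficients are characters of R. *)
Lemma ta_diagM u v x : c (u * v) x x = c u x x * c v x x.
Proof.
rewrite (ta_mul taR) ta_refl (bigD1 x) //= big1 ?addr0 // => y yx.
have [->|xy] := pselect (c u x y = 0); first by rewrite mul0r.
have [->|yx'] := pselect (c v y x = 0); first by rewrite mulr0.
have h1 : h x y by apply/negP => /negP /(ta_out taR u).
have h2 : h y x by apply/negP => /negP /(ta_out taR v).
by rewrite (hN h1 h2) eqxx in yx.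
Qed.

(* Every algebra morphism to k kills the nilpotent e_xy, x != y, and sends exactly
   one of the orthogonal idempotents e_xx to 1. *)
Lemma ta_character (chi : R -> k) : {morph chi : u v / u + v} ->
  {morph chi : u v / u * v} -> (forall a u, chi (a *: u) = a * chi u) -> chi 1 = 1 ->
  exists x, forall u, chi u = c u x x.
Proof.
move=> chiD chiM chiZ chi1.
have chi0 : chi 0 = 0 by have := chiZ 0 0; rewrite scale0r mul0r.
have chi_sum (I : finType) (F : I -> R) : chi (\sum_i F i) = \sum_i chi (F i).
  exact: (big_morph _ chiD chi0).
have nil x y : x != y -> chi (ta_unit x y) = 0.
  move=> xy; have := chiM (ta_unit x y) (ta_unit x y).
  rewrite ta_unitM_ne 1?eq_sym // chi0 => /esym/eqP; rewrite mulf_eq0 orbb.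
  by move/eqP.
have expand u : chi u = \sum_x c u x x * chi (ta_unit x x).
  rewrite {1}(ta_expand u) chi_sum; apply: eq_bigr => x _.
  rewrite chi_sum (bigD1 x) //= big1 ?addr0 ?chiZ // => y yx.
  by rewrite chiZ nil ?mulr0 // eq_sym.
have [x xP] : exists x, chi (ta_unit x x) <> 0.
  apply: contrapT => H; have := expand 1; rewrite chi1 big1 => [/eqP|x _].
    by rewrite oner_eq0.
  by rewrite (contrapT (fun h => H (ex_intro _ x h))) mulr0.
have x1 : chi (ta_unit x x) = 1.
  have := chiM (ta_unit x x) (ta_unit x x).
  rewrite ta_unitM ?ta_refl // => e; apply: (mulfI (introN eqP xP)).
  by rewrite -e mulr1.
exists x => u; rewrite expand (bigD1 x) //= big1 ?addr0 ?x1 ?mulr1 // => y yx.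
have : chi (ta_unit x x) * chi (ta_unit y y) = 0.
  by rewrite -chiM ta_unitM_ne ?chi0 // eq_sym.
by rewrite x1 mul1r => ->; rewrite mulr0.
Qed.

End Character.

Section RelationIso.
Variables (S S' : finType) (h : rel S) (h' : rel S') (R R' : algType k).
Variables (c : R -> S -> S -> k) (c' : R' -> S' -> S' -> k).
Hypotheses (taR : thin_alg h c) (taR' : thin_alg h' c').
Hypotheses (hN : forall x y, h x y -> h y x -> x = y).
Hypotheses (hN' : forall x y, h' x y -> h' y x -> x = y).

Lemma ta_character_pullback (f : {lrmorphism R -> R'}) y :
  exists x, forall u, c' (f u) y y = c u x x.
Proof.
apply: (@ta_character S h R c taR (fun u => c' (f u) y y)).
- by move=> u v; rewrite rmorphD (ta_add taR').
- by move=> u v; rewrite rmorphM (ta_diagM taR').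
- by move=> a u; rewrite linearZ (ta_scale taR').
- by rewrite rmorph1 (ta_one taR') eqxx.
Qed.

(* e_x f(R) e_x' <> 0 is detected by the diagonal coefficients of idempotents
   lifting e_x and e_x'. *)
Lemma ta_character_rel (f : {lrmorphism R -> R'}) (tau : S' -> S) :
  bijective f -> (forall y u, c' (f u) y y = c u (tau y) (tau y)) ->
  forall y z, h' y z -> h (tau y) (tau z).
Proof.
move=> [g fg gf] tauE y z yz.
pose a := f (ta_unit taR (tau y) (tau y)); pose b := f (ta_unit taR (tau z) (tau z)).
have ay : c' a y y = 1 by rewrite tauE ta_unitE (ta_refl taR) !eqxx.
have bz : c' b z z = 1 by rewrite tauE ta_unitE (ta_refl taR) !eqxx.
pose w := a * (ta_unit taR' y z * b).
have wyz : c' w y z = 1.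
  rewrite (ta_mul taR') yz (bigD1 y) //= big1 ?addr0 => [|t ty]; last first.
    rewrite (ta_mul taR'); case: ifP; rewrite ?mulr0 // => _.
    by rewrite big1 ?mulr0 // => s _; rewrite ta_unitE (negbTE ty) andbF mul0r.
  rewrite ay mul1r (ta_mul taR') yz (bigD1 z) //= big1 ?addr0 => [|t /negbTE tz]; last first.
    by rewrite ta_unitE tz andbF mul0r.
  by rewrite bz mulr1 ta_unitE yz !eqxx.
apply: contraT => nh.
suff w0 : w = 0 by move: wyz; rewrite w0 (ta_zero taR') => /eqP; rewrite eq_sym oner_eq0.
rewrite /w -(gf (ta_unit taR' y z)) -!rmorphM; set r := g _.
suff -> : ta_unit taR (tau y) (tau y) * (r * ta_unit taR (tau z) (tau z)) = 0 by rewrite rmorph0.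
apply: (ta_inj taR) => p q; rewrite (ta_mul taR) (ta_zero taR); case: ifP => // pq.
rewrite big1 // => s _; rewrite ta_unitE.
case: (p =P tau y) => [e|]; last by rewrite andbF mul0r.
case: (s =P tau y) => [e'|]; last by rewrite andbF mul0r.
rewrite (ta_mul taR); case: ifP; rewrite ?mulr0 // => sq.
rewrite [X in _ * X]big1 ?mulr0 // => t _; rewrite ta_unitE.
case: (q =P tau z) => [e''|]; last by rewrite andbF mulr0.
by move: nh; rewrite -e -e'' pq.
Qed.

End RelationIso.

(** An isomorphism permutes the characters, which are the diagonal coefficients. The index maps
    obtained from f and from its inverse are mutually inverse because the idempotents e_xx separate
    characters. *)
Lemma thin_alg_iso_rel (S S' : finType) (h : rel S) (h' : rel S') (R R' : algType k) c c' :
  @thin_alg k S h R c -> @thin_alg k S' h' R' c' ->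
  (forall x y, h x y -> h y x -> x = y) -> (forall x y, h' x y -> h' y x -> x = y) ->
  alg_iso R R' ->
  exists sg : S -> S', bijective sg /\ forall x y, h' (sg x) (sg y) = h x y.
Proof.
move=> taR taR' hN hN' [f fb]; have [g [fg gf]] := lrmorphism_inverse fb.
have /choice[tau tauE] := ta_character_pullback taR taR' hN' f.
have /choice[sg sgE] := ta_character_pullback taR' taR hN g.
have ts x : tau (sg x) = x.
  have := sgE x (f (ta_unit taR x x)); rewrite fg tauE !ta_unitE (ta_refl taR) !eqxx.
  by case: (tau (sg x) =P x) => // _ /eqP; rewrite ?andbF /= oner_eq0.
have st y : sg (tau y) = y.
  have := tauE y (g (ta_unit taR' y y)); rewrite gf sgE !ta_unitE (ta_refl taR') !eqxx.
  by case: (sg (tau y) =P y) => // _ /eqP; rewrite ?andbF /= oner_eq0.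
exists sg; split; first by exists tau.
move=> x y; apply/idP/idP => xy.
  by have := ta_character_rel taR taR' fb tauE xy; rewrite !ts.
have gb : bijective g by exists f.
exact: (ta_character_rel taR' taR gb sgE xy).
Qed.

End Invariance.

(** * Hereditary algebras *)

Section Hereditary.
Variables (k : fieldType) (S : finType) (h : rel S) (R : algType k) (c : R -> S -> S -> k).
Hypotheses (taR : thin_alg h c) (hN : forall x y, h x y -> h y x -> x = y).
Local Notation Rr := ((R^c)^o).
Local Notation e := (ta_unit taR).

Lemma ta_in u x y : c u x y <> 0 -> h x y.
Proof. by move=> xy; apply/negP => /negP /(ta_out taR u). Qed.

Lemma ta_mul_unit u x y b : c (u * e y y) x b = if b == y then c u x b else 0.
Proof.
rewrite (ta_mul taR); case: (boolP (h x b)) => xb; last first.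
  by rewrite (ta_out taR) //; case: ifP.
rewrite (bigD1 b) //= big1 ?addr0 => [|t tb]; rewrite ta_unitE (ta_refl taR) /=.
  by case: eqP => _; rewrite ?mulr0 // mulr1.
by case: (t =P y) => [ty|]; rewrite ?mulr0 //= -ty eq_sym (negbTE tb) mulr0.
Qed.

(* If e_xy R were projective, the map e_y R -> e_xy R would split, sending e_xy back
   to e_y up to terms killed by e_y; but e_xy e_yz = 0 while e_y e_yz <> 0. *)
Lemma ta_not_hereditary x y z : h x y -> h y z -> ~~ h x z -> ~ hereditary R.
Proof.
move=> xy yz nxz her.
have [|u v|a u|I [i [iI iP]]] := @submodule_exists R^c Rr (fun r => exists s : R, (r : R) = e x y * s).
- by exists 0; rewrite mulr0.
- by move=> [s ->] [t ->]; exists (s + t); rewrite mulrDr.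
- by move=> [s ->]; exists (s * (a : R)); rewrite mulrA.
have [||q qE] := @linear_intro R^c Rr Rr (fun r => (e x y * (r : R) : R)).
- by move=> u v; rewrite mulrDr.
- by move=> a u; rewrite /GRing.scale /= mulrA.
have [|p pE] := @factor_through _ _ _ _ i q iI.
  by move=> w; apply/iP; exists w; rewrite qE.
have [|s sE] := her I i iI _ _ p (idfun : {linear I -> I}).
  move=> u; have [w wE] : exists s : R, (i u : R) = e x y * s by apply/iP; exists u.
  by exists w; apply: iI; rewrite pE qE wE.
have [t tE] : exists t, i t = (e x y : Rr) by apply/iP; exists 1; rewrite mulr1.
pose w : R := s t.
have iw : e x y * w = e x y.
  by have := congr1 i (sE t); rewrite pE qE tE.
have w1 : c w y y = 1.
  have : c (e x y * w) x y = 1 by rewrite iw ta_unitE xy !eqxx.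
  rewrite (ta_mul taR) xy (bigD1 y) //= big1 ?addr0 => [|b /negbTE yb].
    by rewrite ta_unitE xy !eqxx mul1r.
  by rewrite ta_unitE yb andbF mul0r.
have wyz : w * e y z = 0.
  have t0 : (e y z : R^c) *: t = 0.
    apply: iI; rewrite linearZ linear0 /= tE.
    rewrite -[LHS]/(e x y * e y z : R) (ta_unitM taR xy yz).
    by rewrite (negbTE nxz).
  have : s ((e y z : R^c) *: t) = w * e y z by rewrite linearZ.
  by rewrite t0 linear0.
have : c (w * e y z) y z = 1.
  rewrite (ta_mul taR) yz (bigD1 y) //= big1 ?addr0 => [|b /negbTE yb].
    by rewrite w1 ta_unitE yz !eqxx mulr1.
  by rewrite ta_unitE yb andbF mulr0.
by rewrite wyz (ta_zero taR) => /eqP; rewrite eq_sym oner_eq0.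
Qed.

Hypothesis hT : forall x y z, h x y -> h y z -> h x z.
Hypothesis hD : forall x y y' z, h x y -> h x y' -> h y z -> h y' z -> h y y' || h y' y.

Section Peel.
Variables (I : rmodType R) (i : {linear I -> Rr}) (x : S).

(** The columns that occur in row x of the image of I. Right multiplication makes this set closed
    upwards; its minimal elements will index the free part. *)
Let U y := exists m, c (i m) x y <> 0.
Let minU y := U y /\ forall t, U t -> h t y -> t = y.

Let U_rel y : U y -> h x y.
Proof. by move=> [m /ta_in]. Qed.

Let minU_exists y : U y -> exists t, minU t /\ h t y.
Proof.
move=> Uy; pose P t := `[< U t >] && h t y.
have Py : P y by rewrite /P (ta_refl taR) andbT; apply/asboolP.
case: (arg_minnP (fun t => #|[set a | h a t]|) Py) => t /andP[/asboolP Ut ty] tmin.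
exists t; split=> //; split=> // a Ua at_; apply: contrapT => ne.
have := tmin a; rewrite /P (hT at_ ty) andbT => /(_ (introT (asboolP _) Ua)).
rewrite leqNgt => /negP; apply; apply: proper_card; apply/properP; split.
  by apply/subsetP => b; rewrite !inE => /hT; apply.
exists t; rewrite !inE ?(ta_refl taR) //; apply/negP => ta; apply: ne; exact: hN.
Qed.

Let minU_uniq y t t' : U y -> minU t -> minU t' -> h t y -> h t' y -> t = t'.
Proof.
move=> Uy [Ut tm] [Ut' tm'] ty t'y.
by have /orP[/tm'|/tm] := hD (U_rel Ut) (U_rel Ut') ty t'y => ->.
Qed.

(** Division by e_xt on the left: for h x t, multiplying the result by e_xt gives back the part of
    row x that lies over t. *)
Let row_move_exists (p : S * I) : exists r : R, forall a b,
  c r a b = if (a == p.1) && h p.1 b then c (i p.2) x b else 0.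
Proof.
have [r rE] := ta_surj taR (fun a b => if a == p.1 then c (i p.2) x b else 0).
by exists r => a b; rewrite rE; case: eqP => [->|_]; case: ifP.
Qed.

Let rho t m : R := projT1 (cid (row_move_exists (t, m))).

Let rhoE t m a b : c (rho t m) a b = if (a == t) && h t b then c (i m) x b else 0.
Proof. by rewrite /rho; case: cid. Qed.

Let rhoD t m m' : rho t (m + m') = rho t m + rho t m'.
Proof.
apply: (ta_inj taR) => a b; rewrite (ta_add taR) !rhoE linearD (ta_add taR).
by case: ifP; rewrite ?addr0.
Qed.

(** A column s in U with h s b, where b lies over t, is comparable with t by [hD]; if it were below
    t, minimality would make it equal to t. So restricting to columns over t drops no term of the
    product. *)
Let rhoZ t (r : R) m : minU t -> rho t ((r : R^c) *: m) = rho t m * r.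
Proof.
move=> [Ut tm]; apply: (ta_inj taR) => a b; rewrite (ta_mul taR) rhoE.
case: eqP => [->|at_] /=; last first.
  by case: ifP => // _; rewrite big1 // => s _; rewrite rhoE (introF eqP at_) mul0r.
case: ifP => // tb; rewrite linearZ /= -[_ *: i m]/((i m : R) * r) (ta_mul taR).
rewrite (hT (U_rel Ut) tb); apply: eq_bigr => s _; rewrite rhoE eqxx /=.
case: (boolP (h t s)) => // ts; rewrite mul0r.
have [->|sx] := pselect (c (i m) x s = 0); first by rewrite mul0r.
have [->|/ta_in sb] := pselect (c r s b = 0); first by rewrite mulr0.
have Us : U s by exists m.
have /orP[st|st] := hD (U_rel Us) (U_rel Ut) sb tb; last by rewrite st in ts.
by move: ts; rewrite (tm s Us st) (ta_refl taR).
Qed.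

(** An element of I with a nonzero entry in column t, cut by e_tt and rescaled, has e_xt as its row
    x. Its other rows are left arbitrary, and non-minimal t receive the default 0. *)
Let generator_exists t : exists m, minU t -> forall b, c (i m) x b = (b == t)%:R.
Proof.
have [[[m mt] tm]|nt] := pselect (minU t); last by exists 0 => /nt.
exists ((((c (i m) x t)^-1 *: e t t) : R^c) *: m) => _ b.
rewrite linearZ /= -[_ *: i m]/((i m : R) * ((c (i m) x t)^-1 *: e t t)) -scalerAr.
rewrite (ta_scale taR) ta_mul_unit; case: eqP => [->|_]; last by rewrite mulr0.
by rewrite mulVf //; apply/eqP.
Qed.

Let w t : I := projT1 (cid (generator_exists t)).

Let wE t b : minU t -> c (i (w t)) x b = (b == t)%:R.
Proof. by move=> mt; rewrite /w; case: cid => /= m ->. Qed.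

Let s m : I := \sum_(t | `[< minU t >]) (rho t m : R^c) *: w t.

Let sE m b : c (i (s m)) x b = c (i m) x b.
Proof.
have -> : c (i (s m)) x b = \sum_(t | `[< minU t >]) if h t b then c (i m) x b else 0.
  rewrite linear_sum (big_morph (fun u : R => c u x b) (fun u v => ta_add taR u v x b) (ta_zero taR x b)).
  apply: eq_bigr => t /asboolP mt; rewrite linearZ /= -[_ *: i (w t)]/((i (w t) : R) * rho t m).
  rewrite (ta_mul taR) (bigD1 t) //= big1 ?addr0 => [|a /negbTE at_]; last first.
    by rewrite wE // at_ mul0r.
  rewrite wE // eqxx mul1r rhoE eqxx /=; case: (boolP (h x b)) => // xb.
  by rewrite (ta_out taR) //; case: ifP.
have [->|mb] := pselect (c (i m) x b = 0); first by rewrite big1 // => t _; case: ifP.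
have Ub : U b by exists m.
have [t [mt tb]] := minU_exists Ub.
rewrite (bigD1 t) /=; last exact/asboolP.
rewrite tb big1 ?addr0 // => a /andP[/asboolP ma at_]; case: ifP => // ab.
by rewrite (minU_uniq Ub ma mt ab tb) eqxx in at_.
Qed.

(** The element m - s m has zero row x, hence lies in K. Since each [rho t] is linear over R, a lift
    may be chosen separately on K and on the elements w t, so only the projectivity of K remains. *)
Lemma projective_peel :
  (forall (K : rmodType R) (j : {linear K -> I}), injective j ->
     (forall u b, c (i (j u)) x b = 0) -> projective K) ->
  projective I.
Proof.
move=> projK M N g f gS.
have [|u v|r u|K [j [jI jP]]] := @submodule_exists R^c I (fun m => forall b, c (i m) x b = 0).
- by move=> b; rewrite linear0 (ta_zero taR).
- by move=> u0 v0 b; rewrite linearD (ta_add taR) u0 v0 addr0.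
- move=> u0 b; rewrite linearZ /= -[_ *: i u]/((i u : R) * (r : R)) (ta_mul taR).
  by case: ifP => // _; rewrite big1 // => t _; rewrite u0 mul0r.
have [||q qE] := @linear_intro R^c I I (fun m => m - s m).
- move=> u v; rewrite -[RHS]addrACA -opprD; congr (_ - _).
  by rewrite /s -big_split; apply: eq_bigr => t _; rewrite rhoD scalerDl.
- move=> r u; rewrite scalerBr; congr (_ - _).
  rewrite /s scaler_sumr; apply: eq_bigr => t /asboolP mt.
  by rewrite rhoZ // scalerA.
have [|ka kaE] := @factor_through _ _ _ _ j q jI.
  move=> m; apply/jP => b; rewrite qE linearB -scaleN1r.
  rewrite -[_ *: i (s m)]/((i (s m) : R) * (-1)) mulrN1 -scaleN1r.
  by rewrite (ta_add taR) (ta_scale taR) sE mulN1r subrr.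
have Kx u b : c (i (j u)) x b = 0 by move: b; apply/jP; exists u.
have [hK hKE] := projK K j jI Kx M N g (f \o j) gS.
pose y t := projT1 (cid (gS (f (w t)))).
have yE t : g (y t) = f (w t) by rewrite /y; case: cid.
have [||H HE] := @linear_intro R^c I M
  (fun m => hK (ka m) + \sum_(t | `[< minU t >]) (rho t m : R^c) *: y t).
- move=> u v; rewrite !linearD [RHS]addrACA; congr (_ + _).
  by rewrite -big_split; apply: eq_bigr => t _; rewrite rhoD scalerDl.
- move=> r u; rewrite !linearZ scalerDr; congr (_ + _).
  rewrite scaler_sumr; apply: eq_bigr => t /asboolP mt.
  by rewrite rhoZ // scalerA.
exists H => m; rewrite HE linearD hKE /= kaE qE linearB.
suff -> : g (\sum_(t | `[< minU t >]) (rho t m : R^c) *: y t) = f (s m) by rewrite subrK.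
rewrite /s !raddf_sum; apply: eq_bigr => t _.
by rewrite /= !linearZ /= yE.
Qed.

End Peel.

(* Peel off one row at a time: the image of I in e_x R is spanned by the e_xy with y
   in an up-set of a forest, hence is the direct sum of the e_y R, y minimal. *)
Lemma ta_hereditary : hereditary R.
Proof.
suff H n : forall (X : {set S}), (#|X| <= n)%N -> forall (I : rmodType R) (i : {linear I -> Rr}),
    injective i -> (forall m a b, c (i m) a b <> 0 -> a \in X) -> projective I.
  by move=> I i iI; apply: (H _ setT (leqnn _) I i iI).
elim: n => [|n IH] X Xn I i iI iX.
  have X0 : X = set0 by apply/eqP; rewrite -cards_eq0 -leqn0.
  have I0 (m : I) : m = 0.
    apply: iI; rewrite linear0; apply: (ta_inj taR) => a b; rewrite (ta_zero taR).
    by apply: contrapT => /iX; rewrite X0 inE.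
  move=> M N g f _; have [||H _] := @linear_intro R^c I M (fun=> 0).
  - by move=> *; rewrite addr0.
  - by move=> *; rewrite scaler0.
  by exists H => m; rewrite (I0 m) !linear0.
have [X0|[x xX]] := set_0Vmem X.
  by apply: (IH X _ I i iI iX); rewrite X0 cards0.
apply: (@projective_peel I i x) => K j jI Kx.
apply: (IH (X :\ x) _ K (i \o j)) => [||u a b nz].
- by rewrite -ltnS; apply: leq_trans Xn; rewrite [X in (_ < X)%N](cardsD1 x) xX.
- by move=> u v /= /iI /jI.
- rewrite !inE (iX _ _ _ nz) andbT; apply/eqP => ax; apply: nz; by rewrite /= ax Kx.
Qed.

End Hereditary.

(** * Triangulations as binary search trees *)

Definition node (n : nat) (P : nat -> nat -> bool) : predArgType :=
  {x : 'I_n.+1 * 'I_n.+1 | P x.1 x.2}.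
HB.instance Definition _ n P := Finite.on (@node n P).
Definition nlo n P (x : @node n P) : nat := (val x).1.
Definition nhi n P (x : @node n P) : nat := (val x).2.

(* P l b says that the curve joining x_l and x_(b+1), which corresponds to the
   interval module [l, b[, belongs to the triangulation. *)
Record triangulation (n : nat) (P : nat -> nat -> bool) : Prop := Triangulation {
  tri_range : forall l b, P l b -> (l < b <= n)%N;
  tri_root : P 0%N n;
  tri_nc : forall l b l' b', P l b -> P l' b' -> ~~ [&& l < l', l' <= b & b < b']%N;
  tri_max : forall l b, (l < b <= n)%N ->
    (forall l' b', P l' b' -> ~~ [&& l < l', l' <= b & b < b']%N && ~~ [&& l' < l, l <= b' & b' < b]%N) -> P l b }.

Section Tree.
Variables (n : nat) (P : nat -> nat -> bool).
Hypothesis tP : triangulation n P.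
Local Notation S := (node n P).
Local Notation lo := (@nlo n P).
Local Notation hi := (@nhi n P).
Implicit Types x y z w : S.

(** The arguments are swapped so that this reads in the direction of morphisms: Hom from x to y is
    nonzero. *)
Definition nhom x y := thin_rel lo hi y x.

Lemma nodeP x : P (lo x) (hi x). Proof. exact: (valP x). Qed.

Lemma node_range x : (lo x < hi x <= n)%N.
Proof. exact (tri_range tP (nodeP x)). Qed.

Lemma node_eq x y : lo x = lo y -> hi x = hi y -> x = y.
Proof.
move=> e1 e2; apply: val_inj; case: x y e1 e2 => [[a b] p] [[a' b'] p'].
by rewrite /nlo /nhi /= => e1 e2; congr (_, _); apply: val_inj.
Qed.

Lemma node_exists l b : P l b -> exists x, lo x = l /\ hi x = b.
Proof.
move=> lb; have /andP[h1 h2] := tri_range tP lb.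
have h3 : (l < n.+1)%N by apply: ltn_trans h1 _; rewrite ltnS.
by exists (exist (fun x : 'I_n.+1 * 'I_n.+1 => P x.1 x.2) (Ordinal h3, Ordinal (h2 : (b < n.+1)%N)) lb).
Qed.

Lemma node_nc x y : ~~ [&& lo x < lo y, lo y <= hi x & hi x < hi y]%N.
Proof. exact (tri_nc tP (nodeP x) (nodeP y)). Qed.

Lemma node_nc_l x l b : P l b -> ~~ [&& lo x < l, l <= hi x & hi x < b]%N.
Proof. by move=> lb; exact (tri_nc tP (nodeP x) lb). Qed.

Lemma node_nc_r x l b : P l b -> ~~ [&& l < lo x, lo x <= b & b < hi x]%N.
Proof. by move=> lb; exact (tri_nc tP lb (nodeP x)). Qed.

(** Without crossings, a nonzero morphism is either a surjection, with a common left end, or an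
    injection, with a common right end. *)
Lemma nhomE x y : nhom x y =
  (lo x == lo y) && (hi y <= hi x)%N || (hi x == hi y) && (lo y <= lo x)%N.
Proof.
have := node_nc y x; have := node_range x; have := node_range y.
rewrite /nhom /thin_rel; lia.
Qed.

Lemma nhom_antisym x y : nhom x y -> nhom y x -> x = y.
Proof.
rewrite !nhomE => h1 h2; have := node_range x; have := node_range y.
by move=> ? ?; apply: node_eq; lia.
Qed.

(** The triangle below the curve x_l x_(b+1) has its third vertex at x_(t+1); the equalities cover
    the sides that are boundary segments. The largest t giving a left side is taken: a curve
    crossing [[t+1, b[] would either enlarge t or cross [[l, t[], so maximality of the triangulation
    supplies the right side. *)
Lemma tri_apex l b : P l b ->
  exists t, [/\ (l <= t < b)%N, l = t \/ P l t & t.+1 = b \/ P t.+1 b].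
Proof.
move=> lb; have lbn := tri_range tP lb.
pose Q t := (t < b)%N && ((l == t) || P l t).
have exQ : exists t, Q t by exists l; rewrite /Q eqxx; lia.
have Qb t : Q t -> (t <= b)%N by move=> /andP[/ltnW].
case: (ex_maxnP exQ Qb) => t /andP[tb lt] tmax.
have ltt : (l <= t)%N by case/orP: lt => [/eqP->//|/(tri_range tP)]; lia.
exists t; split; [by rewrite ltt|by case/orP: lt => [/eqP|]; [left|right]|].
case: (ltngtP t.+1 b) => t1b; [right|lia|by left].
apply: (tri_max tP); first by lia.
move=> l' b' lb'; have n1 := tri_nc tP lb lb'; have n2 := tri_nc tP lb' lb.
apply/andP; split; first by lia.
apply/negP => H.
have [e|ll'] : l' = l \/ (l < l')%N by lia.
  have : (b' <= t)%N by apply: tmax; rewrite /Q -e lb' orbT; lia.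
  lia.
have Plt : P l t by case/orP: lt => [/eqP e|//]; lia.
by have := tri_nc tP Plt lb'; lia.
Qed.

(** The last clause says that the remaining side of the triangle on x and z is a boundary segment or
    a curve of the triangulation; it excludes deeper descendants with the same left end. *)
Definition lchild x z := [/\ lo z = lo x, (hi z < hi x)%N & (hi z).+1 = hi x \/ P (hi z).+1 (hi x)].
Definition rchild x z := [/\ hi z = hi x, (lo x < lo z)%N & (lo x).+1 = lo z \/ P (lo x) (lo z).-1].
Definition child z x := lchild x z \/ rchild x z.

(** For two left children, the longer one would cross the third side of the triangle belonging to
    the shorter one. *)
Lemma lchild_uniq x z z' : lchild x z -> lchild x z' -> z = z'.
Proof.
have aux u v : lchild x u -> lchild x v -> (hi u < hi v)%N -> False.
  move=> [e1 h1 []] => [e2|p] [e3 h3 _] uv; first by lia.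
  have := node_nc_l v p; have := node_range u; lia.
move=> a b; have := aux _ _ a b; have := aux _ _ b a; case: a => e1 _ _; case: b => e2 _ _ f1 f2.
apply: node_eq; first by rewrite e1 e2.
by case: (ltngtP (hi z) (hi z')) => // ?; exfalso; auto.
Qed.

Lemma rchild_uniq x z z' : rchild x z -> rchild x z' -> z = z'.
Proof.
have aux u v : rchild x u -> rchild x v -> (lo u < lo v)%N -> False.
  move=> [e1 h1 _] [e3 h3 []] => [e2|p] uv; first by lia.
  have := node_nc_r u p; have := node_range v; lia.
move=> a b; have := aux _ _ a b; have := aux _ _ b a; case: a => e1 _ _; case: b => e2 _ _ f1 f2.
apply: node_eq; last by rewrite e1 e2.
by case: (ltngtP (lo z) (lo z')) => // ?; exfalso; auto.
Qed.

Lemma child_size x z : child z x -> (hi z - lo z < hi x - lo x)%N.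
Proof.
have := node_range x; have := node_range z.
by move=> ? ? [] [? ? _]; lia.
Qed.

(** A curve bounds one triangle on the root side: two parents would cross each other, or one would
    cross the third side of the other. *)
Lemma parent_uniq z x x' : child z x -> child z x' -> x = x'.
Proof.
have ll u v : lchild u z -> lchild v z -> (hi u < hi v)%N -> False.
  move=> [e1 h1 _] [e2 h2 []] => [e|p] uv; first by lia.
  by have := node_nc_l u p; have := node_range z; lia.
have rr u v : rchild u z -> rchild v z -> (lo u < lo v)%N -> False.
  move=> [e1 h1 []] => [e|p] [e2 h2 _] uv; first by lia.
  by have := node_nc_r v p; have := node_range z; lia.
have lr u v : lchild u z -> rchild v z -> False.
  move=> [e1 h1 _] [e2 h2 _]; have := node_nc v u; have := node_range z; lia.
move=> [a|a] [b|b]; [|by case: (lr _ _ a b)|by case: (lr _ _ b a)|].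
- have := ll _ _ a b; have := ll _ _ b a; case: a => e1 _ _; case: b => e2 _ _ f1 f2.
  apply: node_eq; first by rewrite -e1 -e2.
  by case: (ltngtP (hi x) (hi x')) => // ?; exfalso; auto.
- have := rr _ _ a b; have := rr _ _ b a; case: a => e1 _ _; case: b => e2 _ _ f1 f2.
  apply: node_eq; last by rewrite -e1 -e2.
  by case: (ltngtP (lo x) (lo x')) => // ?; exfalso; auto.
Qed.

Lemma node_apex x : exists t, [/\ (lo x <= t < hi x)%N,
  (lo x = t /\ forall z, ~ lchild x z) \/ (exists z, lchild x z /\ hi z = t)
  & (t.+1 = hi x /\ forall z, ~ rchild x z) \/ (exists z, rchild x z /\ lo z = t.+1)].
Proof.
have [t [lt L R]] := tri_apex (nodeP x); exists t; split=> //.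
- case: L => [e|p].
    left; split=> // z [e1 h1 _]; have := node_range z; case: R => [|p]; first by lia.
    by have := node_nc_l z p; lia.
  right; have [z [e1 e2]] := node_exists p; exists z; split=> //; split=> //; first by lia.
  by rewrite e2.
- case: R => [e|p].
    left; split=> // z [e1 h1 _]; have := node_range z; case: L => [|p]; first by lia.
    by have := node_nc_r z p; lia.
  right; have [z [e1 e2]] := node_exists p; exists z; split=> //; split=> //; first by lia.
  by rewrite e1 /=; case: L => [->|]; [left|right].
Qed.

Definition inside y x := (lo x <= lo y)%N && (hi y <= hi x)%N.

(** A curve below x stays on one side of the apex: an interval straddling it must share both ends
    with x, or it crosses one of the two other sides. *)
Lemma inside_child x y : inside y x -> y <> x ->
  exists z, child z x /\ inside y z.
Proof.
rewrite /inside => yx ne; have [t [lt L R]] := node_apex x.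
have ne' : (lo y != lo x) || (hi y != hi x).
  by apply: contraT; rewrite negb_or !negbK => /andP[/eqP a /eqP b]; case: ne; exact: node_eq.
have ry := node_range y.
case: (leqP (hi y) t) => yt.
  case: L => [[e _]|[z [lz e]]]; first by lia.
  exists z; split; first by left.
  by case: lz => e1 _ _; lia.
case: (ltnP t (lo y)) => ty.
  case: R => [[e _]|[z [rz e]]]; first by lia.
  exists z; split; first by right.
  by case: rz => e1 _ _; lia.
have e : lo y = lo x.
  case: L => [[e _]|[z [[e1 _ _] e]]]; first by lia.
  by have := node_nc z y; lia.
case: R => [[e' _]|[z [[e1 _ _] e']]]; first by lia.
by have := node_nc y z; lia.
Qed.

(** Morphisms between summands of T that do not factor through a third one, that is, the arrows of
    the quiver of End(T). The composite of x to w and w to y is automatically nonzero when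
    [nhom x y]. *)
Definition narrow x y := [/\ nhom x y, x <> y & forall w, nhom x w -> nhom w y -> w = x \/ w = y].

(** A parent projects onto its left child and a right child embeds into its parent; any longer
    surjection or injection factors through the child on the way. *)
Lemma narrowE x y : narrow x y <-> lchild x y \/ rchild y x.
Proof.
have rx := node_range x; have ry := node_range y; split.
- move=> [xy ne cov]; move: (xy); rewrite nhomE => /orP[]/andP[/eqP e h].
    have hlt : (hi y < hi x)%N by rewrite ltn_neqAle h andbT; apply/eqP => e'; apply: ne; exact: node_eq.
    have yx : inside y x by rewrite /inside e leqnn.
    have [z [[lz|rz] yz]] := inside_child yx (fun e => ne (esym e)); last first.
      by case: rz => ? ? _; move: yz; rewrite /inside; lia.
    left; move: (lz) => [e1 h1 _].
    have [||ez|<- //] := cov z.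
    - by rewrite nhomE e1 eqxx ltnW.
    - by rewrite nhomE e1 -e eqxx; case/andP: yz => _ ->.
    - by rewrite ez ltnn in h1.
  have hlt : (lo y < lo x)%N by rewrite ltn_neqAle h andbT; apply/eqP => e'; apply: ne; exact: node_eq.
  have xy' : inside x y by rewrite /inside e leqnn andbT.
  have [z [[lz|rz] xz]] := inside_child xy' ne.
    by case: lz => ? ? _; move: xz; rewrite /inside; lia.
  right; move: (rz) => [e1 h1 _].
  have [||<- //|ez] := cov z.
  - by rewrite nhomE e1 -e eqxx; case/andP: xz => -> _; rewrite orbT.
  - by rewrite nhomE e1 eqxx (ltnW h1) orbT.
  - by rewrite ez ltnn in h1.
- move=> [[e h p]|[e h p]]; split.
  + by rewrite nhomE e eqxx ltnW.
  + by move=> e'; rewrite e' ltnn in h.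
  + move=> w; rewrite !nhomE => xw wy; have rw := node_range w.
    have ew : lo w = lo x by lia.
    case: (ltngtP (hi w) (hi y)) => wy'; [lia| |by right; apply: node_eq; lia].
    left; apply: node_eq => //; case: p => [|p]; first by lia.
    by have := node_nc_l w p; lia.
  + by rewrite nhomE e eqxx (ltnW h) orbT.
  + by move=> e'; rewrite e' ltnn in h.
  + move=> w; rewrite !nhomE => xw wy; have rw := node_range w.
    have ew : hi w = hi x by lia.
    case: (ltngtP (lo w) (lo x)) => wx; [|lia|by left; apply: node_eq; lia].
    right; apply: node_eq; last by lia.
    case: p => [|p]; first by lia.
    by have := node_nc_r w p; lia.
Qed.

(** Two consecutive surjections or injections compose to a nonzero map, and a left child is not a
    right child, so a vanishing composite of arrows must enter y from its right child and leave to
    its left one. The left side refers only to [nhom], hence is invariant. *)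
Lemma zero_relationE x y z :
  [/\ narrow x y, narrow y z & ~~ nhom x z] <-> rchild y x /\ lchild y z.
Proof.
have rx := node_range x; have ry := node_range y; have rz := node_range z.
split=> [[/narrowE a /narrowE b nxz]|[r l]]; last first.
  split; [by apply/narrowE; right|by apply/narrowE; left|].
  by rewrite nhomE; case: r => ? ? _; case: l => ? ? _; lia.
move: nxz; rewrite nhomE => nxz; case: a b => [a|a] [b|b].
- by case: a b => ? ? _ [? ? _]; lia.
- by case: a b => ? ? _ [? ? _]; have := node_nc z x; lia.
- by [].
- by case: a b => ? ? _ [? ? _]; lia.
Qed.

Definition branching x := exists z z', lchild x z /\ rchild x z'.

Lemma root_exists : exists x, lo x = 0%N /\ hi x = n.
Proof. exact: node_exists (tri_root tP). Qed.

(** Descend from the root through the child that contains x; lengths decrease until that child is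
    x. *)
Lemma parent_exists x : lo x <> 0%N \/ hi x <> n -> exists y, child x y.
Proof.
move=> nr; have [r [r1 r2]] := root_exists.
have xr : inside x r by rewrite /inside r1 r2; have := node_range x; lia.
have ne : r <> x by move=> e; rewrite -e in nr; lia.
move: r xr ne {r1 r2} => y; move: {2}(hi y - lo y)%N (leqnn (hi y - lo y)%N) => m.
elim: m y => [|m IH] y ym xy ne; first by have := node_range y; lia.
have [z [zy xz]] := inside_child xy (fun e => ne (esym e)).
have [<-|zx] := pselect (z = x); first by exists y.
by apply: (IH z) => //; have := child_size zy; lia.
Qed.

End Tree.

(** * Rigidity of the tree under bijections preserving Hom *)

Section TreeIso.
Variables (n : nat) (P P' : nat -> nat -> bool).
Hypotheses (tP : triangulation n P) (tP' : triangulation n P').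
Variables (sg : node n P -> node n P') (tu : node n P' -> node n P).
Hypotheses (sgK : cancel sg tu) (tuK : cancel tu sg).
Hypothesis sg_nhom : forall x y, nhom (sg x) (sg y) = nhom x y.
Local Notation lo := (@nlo n P).
Local Notation hi := (@nhi n P).
Local Notation lo' := (@nlo n P').
Local Notation hi' := (@nhi n P').

Lemma sg_narrow x y : narrow (sg x) (sg y) <-> narrow x y.
Proof.
split=> -[h ne cov]; split.
- by rewrite -sg_nhom.
- by move=> e; apply: ne; rewrite e.
- move=> w xw wy; have [||e|e] := cov (sg w); rewrite ?sg_nhom //.
    by left; exact: (can_inj sgK).
  by right; exact: (can_inj sgK).
- by rewrite sg_nhom.
- by move=> /(can_inj sgK).
- move=> w; rewrite -(tuK w) !sg_nhom => xw wy.
  by have [->|->] := cov _ xw wy; [left|right].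
Qed.

Lemma sg_zero x y z : rchild y x /\ lchild y z <-> rchild (sg y) (sg x) /\ lchild (sg y) (sg z).
Proof.
split=> [/(zero_relationE tP)[a b c]|/(zero_relationE tP')[a b c]].
  by apply/(zero_relationE tP'); split; rewrite ?sg_nhom //; exact/sg_narrow.
by apply/(zero_relationE tP); split; rewrite -?sg_nhom //; exact/sg_narrow.
Qed.

Lemma sg_branching x : branching (sg x) -> branching x.
Proof.
move=> [z [z' [l r]]]; exists (tu z), (tu z').
by have [] : rchild x (tu z') /\ lchild x (tu z) by apply/sg_zero; rewrite !tuK.
Qed.

(** Arrows are preserved, but an arrow alone does not tell which end is the parent: it may lead to a
    left child or come from a right child. *)
Lemma sg_adjacent x z : child z x -> child (sg z) (sg x) \/ child (sg x) (sg z).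
Proof.
have arr u v : narrow (sg u) (sg v) -> child (sg u) (sg v) \/ child (sg v) (sg u).
  by move=> /(narrowE tP')[?|?]; [right; left|left; right].
move=> [h|h].
  have /sg_narrow/arr : narrow x z by apply/(narrowE tP); left.
  by move=> [?|?]; [right|left].
by have /sg_narrow/arr : narrow z x by apply/(narrowE tP); right.
Qed.

Lemma sg_adjacent' x z : child (sg z) (sg x) -> child z x \/ child x z.
Proof.
have arr (u v : node n P) : narrow u v -> child u v \/ child v u.
  by move=> /(narrowE tP)[?|?]; [right; left|left; right].
move=> [h|h].
  have /sg_narrow/arr : narrow (sg x) (sg z) by apply/(narrowE tP'); left.
  by move=> [?|?]; [right|left].
by have /sg_narrow/arr : narrow (sg z) (sg x) by apply/(narrowE tP'); right.
Qed.

Definition sg_children x := forall z, child z x <-> child (sg z) (sg x).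

Lemma branching_children x : branching x -> sg_children x.
Proof.
move=> [a [b [l r]]]; have [r' l'] : rchild (sg x) (sg b) /\ lchild (sg x) (sg a) by apply/sg_zero.
move=> z; split=> -[h|h].
- by left; rewrite (lchild_uniq tP h l).
- by right; rewrite (rchild_uniq tP h r).
- by left; rewrite (can_inj sgK (lchild_uniq tP' h l')).
- by right; rewrite (can_inj sgK (rchild_uniq tP' h r')).
Qed.

Lemma child_asym (x z : node n P) : child z x -> child x z -> False.
Proof. by move=> /(child_size tP) h1 /(child_size tP); lia. Qed.

Lemma child_asym' (x z : node n P') : child z x -> child x z -> False.
Proof. by move=> /(child_size tP') h1 /(child_size tP'); lia. Qed.

Lemma only_child (x z z' : node n P) : ~ branching x -> child z x -> child z' x -> z = z'.
Proof.
move=> nb [a|a] [b|b].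
- exact: (lchild_uniq tP a b).
- by case: nb; exists z, z'.
- by case: nb; exists z', z.
- exact: (rchild_uniq tP a b).
Qed.

Lemma only_child' (x z z' : node n P') : ~ branching x -> child z x -> child z' x -> z = z'.
Proof.
move=> nb [a|a] [b|b].
- exact: (lchild_uniq tP' a b).
- by case: nb; exists z, z'.
- by case: nb; exists z', z.
- exact: (rchild_uniq tP' a b).
Qed.

(* The two children of a branching node are determined by its zero relation, and
   this orientation propagates upwards: a node with a single child known to be a
   child in both trees has the same parent in both. *)
Lemma children_above_branching x y : branching y -> inside y x -> sg_children x.
Proof.
move=> by_ yx; move: {2}(hi x - lo x)%N (leqnn (hi x - lo x)%N) => m.
elim: m x yx => [|m IH] x yx xm; first by have := node_range tP x; lia.
have [bx|nb] := pselect (branching x); first exact: branching_children.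
have [z [zx yz]] : exists z, child z x /\ inside y z.
  by apply: (inside_child tP yx) => e; rewrite e in by_.
have ez : sg_children z by apply: IH => //; have := child_size tP zx; lia.
have zx' : child (sg z) (sg x).
  by case: (sg_adjacent zx) => // /ez /(child_asym zx).
move=> w; split=> [wx|wx].
  by rewrite (only_child nb wx zx).
by rewrite (can_inj sgK (only_child' (fun b => nb (sg_branching b)) wx zx')).
Qed.

Hypothesis some_branching : exists y, @branching n P y.

(** The ancestors of a branching node are settled, the root among them. The orientation then spreads
    downwards: among the neighbours of x, the parent is already known to go to the parent, so all
    others go to children. *)
Lemma all_children x : sg_children x.
Proof.
have [y by_] := some_branching; have [r [r1 r2]] := root_exists tP.
move: {2}(n - (hi x - lo x))%N (leqnn (n - (hi x - lo x))%N) => m.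
elim: m x => [|m IH] x xm.
  have := node_range tP x => rx.
  apply: (children_above_branching by_); rewrite /inside; have := node_range tP y; lia.
have [e|e] := pselect (lo x = 0%N /\ hi x = n).
  by apply: (children_above_branching by_); rewrite /inside; have := node_range tP y; lia.
have [z xz] := parent_exists tP ((not_andP _ _).1 e).
have ez : sg_children z by apply: IH; have := child_size tP xz; have := node_range tP z; have := node_range tP x; lia.
have xz' := (ez x).1 xz.
move=> w; split=> wx.
  case: (sg_adjacent wx) => // xw.
  have e2 := can_inj sgK (parent_uniq tP' xw xz').
  by rewrite e2 in wx; case: (child_asym xz wx).
case: (sg_adjacent' wx) => // xw.
by rewrite -(parent_uniq tP xz xw) in wx; case: (child_asym' xz' wx).
Qed.

(** Once parents go to parents, the direction of the arrow distinguishes left from right. *)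
Lemma sg_lchild x z : lchild x z <-> lchild (sg x) (sg z).
Proof.
split=> l.
  have /sg_narrow/(narrowE tP')[//|r] : narrow x z by apply/(narrowE tP); left.
  have : child (sg z) (sg x) by apply/all_children; left.
  by move/child_asym'; case; right.
have /sg_narrow/(narrowE tP)[//|r] : narrow (sg x) (sg z) by apply/(narrowE tP'); left.
have : child z x by apply/all_children; left.
by move/child_asym; case; right.
Qed.

Lemma sg_rchild x z : rchild x z <-> rchild (sg x) (sg z).
Proof.
split=> l.
  have /sg_narrow/(narrowE tP')[r|//] : narrow z x by apply/(narrowE tP); right.
  have : child (sg z) (sg x) by apply/all_children; right.
  by move/child_asym'; case; left.
have /sg_narrow/(narrowE tP)[r|//] : narrow (sg z) (sg x) by apply/(narrowE tP'); right.
have : child z x by apply/all_children; right.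
by move/child_asym; case; left.
Qed.

(** A missing child puts the apex at an end of the interval, and a present child has the same length
    in both trees by induction; so the shape of the subtree fixes all its intervals up to one shift.
    The equations are additive since the shift may have either sign. *)
Lemma sg_translation x y : inside y x ->
  [/\ hi' (sg x) + lo x = hi x + lo' (sg x), lo' (sg y) + lo x = lo y + lo' (sg x)
    & hi' (sg y) + lo x = hi y + lo' (sg x)]%N.
Proof.
move: {2}(hi x - lo x)%N (leqnn (hi x - lo x)%N) => m.
elim: m x y => [|m IH] x y xm yx; first by have := node_range tP x; lia.
have rx := node_range tP x.
have [t [lt L R]] := node_apex tP x; have [t' [lt' L' R']] := node_apex tP' (sg x).
have refl (z : node n P) : inside z z by rewrite /inside !leqnn.
have eL : (t' + lo x = t + lo' (sg x))%N.
  case: L L' => [[e nl]|[z [lz e]]] [[e' nl']|[z' [lz' e']]].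
  - by lia.
  - by case: (nl (tu z')); apply/sg_lchild; rewrite tuK.
  - by case: (nl' (sg z)); apply/sg_lchild.
  - have sz := lchild_uniq tP' ((sg_lchild _ _).1 lz) lz'.
    have [|h1 h2 h3] := IH z z _ (refl z); first by have := child_size tP (or_introl lz : child z x); lia.
    by move: h1; rewrite sz; case: lz => -> _ _; case: lz' => -> _ _; rewrite e e'.
have eR : (hi' (sg x) + t = hi x + t')%N.
  case: R R' => [[e nr]|[z [rz e]]] [[e' nr']|[z' [rz' e']]].
  - by lia.
  - by case: (nr (tu z')); apply/sg_rchild; rewrite tuK.
  - by case: (nr' (sg z)); apply/sg_rchild.
  - have sz := rchild_uniq tP' ((sg_rchild _ _).1 rz) rz'.
    have [|h1 h2 h3] := IH z z _ (refl z); first by have := child_size tP (or_intror rz : child z x); lia.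
    by move: h1; rewrite sz; case: rz => -> _ _; case: rz' => -> _ _; rewrite e e'; lia.
have [->|ne] := pselect (y = x); first by split; lia.
have [z [zx yz]] := inside_child tP yx ne.
have [|h1 h2 h3] := IH z y _ yz; first by have := child_size tP zx; lia.
case: zx => zx.
  have := (sg_lchild _ _).1 zx => zx'.
  by move: zx zx' => [a1 _ _] [b1 _ _]; split; lia.
have := (sg_rchild _ _).1 zx => zx'.
by move: zx zx' => [a1 _ _] [b1 _ _]; split; lia.
Qed.

Lemma sg_root r : lo r = 0%N -> hi r = n -> lo' (sg r) = 0%N /\ hi' (sg r) = n.
Proof.
move=> r1 r2; apply: contrapT => /not_andP e; have [z] := parent_exists tP' e.
rewrite -(tuK z) => /all_children /(child_size tP).
have := node_range tP (tu z); lia.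
Qed.

Lemma sg_identity y : lo' (sg y) = lo y /\ hi' (sg y) = hi y.
Proof.
have [r [r1 r2]] := root_exists tP; have [e1 e2] := sg_root r1 r2.
have [|_ h1 h2] := @sg_translation r y; last by split; lia.
by rewrite /inside r1 r2; have := node_range tP y; lia.
Qed.

Lemma triangulation_eq l b : P l b = P' l b.
Proof.
apply/idP/idP => lb.
  have [y [<- <-]] := node_exists tP lb; have [<- <-] := sg_identity y.
  exact: nodeP.
have [y [<- <-]] := node_exists tP' lb; rewrite -(tuK y); have [-> ->] := sg_identity (tu y).
exact: nodeP.
Qed.

End TreeIso.

(** * The tilting module of a triangulation *)

Section TreeTilting.
Variables (k : fieldType) (n : nat) (P : nat -> nat -> bool).
Hypothesis tP : triangulation n P.
Local Notation A := (linear_path_algebra k n).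
Local Notation S := (node n P).
Local Notation lo := (@nlo n P).
Local Notation hi := (@nhi n P).
Local Notation TM := (thin_mod k n lo hi).
Local Notation E := (@punit k n).
Local Notation I s := (thin_mod k n (fun _ : unit => lo s) (fun _ : unit => hi s)).

(** By the criterion [thin_Ext1_zero]: a summand t containing the vertex [hi s] also contains
    [lo s], otherwise s and t cross, so the coefficient at [hi s] can be moved back to [lo s]. *)
Lemma tree_Ext1_zero : Ext1_zero (TM : rmodType A) TM.
Proof.
apply: thin_Ext1_zero => [s|s hn y]; first by have := node_range tP s; lia.
have rs := node_range tP s.
have ln : (lo s < n)%N by lia.
exists (of_tcoef lo hi (fun t j => if j == lo s :> nat then tcoef y t (Ordinal hn) else 0)).
apply: tcoef_inj => t j; rewrite !tcoef_ract; case: ifP => // tj.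
rewrite (bigD1 (Ordinal hn)) //= big1 ?addr0 => [|i ij]; last first.
  by rewrite pcoef_punit -[hi s]/(nat_of_ord (Ordinal hn)) val_eqE (negbTE ij) andbF mulr0.
rewrite [RHS](bigD1 (Ordinal ln)) //= [X in _ = _ + X]big1 ?addr0 => [|i ij]; last first.
  by rewrite pcoef_punit -[lo s in X in _ * X]/(nat_of_ord (Ordinal ln)) val_eqE (negbTE ij) andbF mulr0.
rewrite !pcoef_punit /= !eqxx leqnn (_ : lo s <= hi s)%N /=; last by lia.
rewrite of_tcoefK /= eqxx; case: eqP => [ej|_]; last by rewrite !mulr0.
case: ifP => // /negP nlt; have := node_nc tP s t; have := node_range tP t; lia.
Qed.

Lemma node_summand s : in_add TM (I s).
Proof. by apply: thin_in_add => _; right; exists s. Qed.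

(** The induction statement for coresolving the sum of the [[i, beta i[], where D i is the node that
    vertex i has reached on its way down. The extra clause, that the inclusion of [[i, beta i[] into
    the interval of D i extends along f, is what the next step glues along. Writing [s = D i] avoids
    transport between module types. *)
Definition left_approx (D : 'I_n -> S) (beta : 'I_n -> nat) : Prop :=
  exists (T0 T1 : rmodType A)
    (f : {linear thin_mod k n (fun i : 'I_n => i : nat) beta -> T0}) (g : {linear T0 -> T1}),
  [/\ in_add TM T0, in_add TM T1, short_exact f g &
    forall i s, s = D i -> exists psi : {linear T0 -> I s},
      forall w j, tcoef (psi (f w)) tt j = tcoef w i j].

(** Here i labels the apex of D i, and the sequence is [[i, hi[] into [[lo, hi[] onto [[lo, i[],
    whose quotient is zero or the left child. *)
Lemma left_approx_base (D : 'I_n -> S) (beta : 'I_n -> nat) :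
  (forall i, [/\ (lo (D i) <= i < hi (D i))%N, hi (D i) = beta i
     & lo (D i) = i \/ P (lo (D i)) i]) -> left_approx D beta.
Proof.
move=> H.
have [|f [g [fg fE gE]]] := @thin_short_exact k n _ (lo \o D) beta (fun i : 'I_n => i : nat).
  by move=> i /=; have [] := H i; lia.
exists (thin_mod k n (lo \o D) beta), (thin_mod k n (lo \o D) (fun i : 'I_n => i : nat)), f, g.
split=> //.
- by apply: thin_in_add => i; right; exists (D i); have [] := H i.
- apply: thin_in_add => i; have [_ _ [e|p]] := H i; [left; rewrite /= e|right] => //.
  by have [s [s1 s2]] := node_exists tP p; exists s.
- move=> i s ->; have [r e _] := H i.
  have [|psi psiE] := @thin_map k n _ unit (lo \o D) beta (fun=> lo (D i)) (fun=> hi (D i)) (fun t _ => (t == i)%:R).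
    by move=> t _; case: eqP => // ->; rewrite /= e.
  exists psi => w j; rewrite psiE sum_delta fE; case: ifP => // h.
  by rewrite tcoef_out //; apply/negP => h'; lia.
Qed.

Definition set_at (D : 'I_n -> S) i0 z i := if i == i0 then z else D i.

(** A right child is a submodule with the same right end, so the sequence is kept and only the
    extension is composed with the inclusion of the child. *)
Lemma left_approx_rchild (D : 'I_n -> S) (beta : 'I_n -> nat) i0 z : hi z = hi (D i0) -> (lo (D i0) <= lo z)%N ->
  (lo z <= i0)%N -> beta i0 = hi z ->
  left_approx (set_at D i0 z) beta -> left_approx D beta.
Proof.
move=> ez lz zi eb [T0 [T1 [f [g [a0 a1 fg psiP]]]]].
exists T0, T1, f, g; split=> // i s ->.
case: (eqVneq i i0) => [->|ii]; last first.
  have [|psi psiE] := psiP i (D i) _; first by rewrite /set_at (negbTE ii).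
  by exists psi.
have [|psi psiE] := psiP i0 z _; first by rewrite /set_at eqxx.
have [|q qE] := @thin_map k n unit unit (fun=> lo z) (fun=> hi z) (fun=> lo (D i0)) (fun=> hi (D i0)) (fun _ _ => 1).
  by rewrite ez; split.
exists (q \o psi) => w j; rewrite /= qE sum_unit mul1r psiE; case: ifP => // h.
by rewrite tcoef_out // eb ez; apply/negP => h'; lia.
Qed.

(** A left child is a proper quotient, so the module itself changes: [[i0, hi (D i0)[] is the
    pullback of [[i0, hi z[] and the interval of D i0 over that of z. This adds D i0 to the middle
    term and z to the cokernel. *)
Lemma left_approx_lchild (D : 'I_n -> S) (beta : 'I_n -> nat) i0 z : (lo (D i0) <= i0 < hi (D i0))%N ->
  lo z = lo (D i0) -> (i0 < hi z <= hi (D i0))%N ->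
  (forall i, hi (D i) = beta i) ->
  left_approx (set_at D i0 z) (fun i => hi (set_at D i0 z i)) -> left_approx D beta.
Proof.
move=> ri ez hz eb [T0 [T1 [f [g [a0 a1 [fI fg gS] psiP]]]]].
pose b' i := hi (set_at D i0 z i).
have b'0 : b' i0 = hi z by rewrite /b' /set_at eqxx.
have b'i i : i != i0 -> b' i = beta i by move=> /negbTE ii; rewrite /b' /set_at ii.
have b'le i : (b' i <= beta i)%N.
  by case: (eqVneq i i0) => [->|/b'i -> //]; rewrite b'0 -eb; case/andP: hz.
have [|p pE] := @thin_map k n _ _ (fun i : 'I_n => i : nat) beta (fun i : 'I_n => i : nat) b' (fun s t => (s == t)%:R).
  by move=> s t; case: eqP => // ->; split.
have [|io ioE] := @thin_map k n _ unit (fun i : 'I_n => i : nat) beta (fun=> lo (D i0)) (fun=> hi (D i0)) (fun t _ => (t == i0)%:R).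
  by move=> t _; case: eqP => // ->; rewrite eb; split=> //; case/andP: ri.
have [|q qE] := @thin_map k n unit unit (fun=> lo (D i0)) (fun=> hi (D i0)) (fun=> lo z) (fun=> hi z) (fun _ _ => 1).
  by rewrite ez; split=> //; case/andP: hz.
have pC w i j : tcoef (p w) i j = if (i <= j < b' i)%N then tcoef w i j else 0 by rewrite pE sum_delta.
have ioC w j : tcoef (io w) tt j = tcoef w i0 j.
  rewrite ioE sum_delta; case: ifP => // h; rewrite tcoef_out // -eb; apply/negP => h'; lia.
have qC w j : tcoef (q w) tt j = if (lo z <= j < hi z)%N then tcoef w tt j else 0.
  by rewrite qE sum_unit mul1r.
have [|psi psiE] := psiP i0 z _; first by rewrite /set_at eqxx.
have [||F FE] := @linear_intro _ _ (T0 * I (D i0))%type (fun w => (f (p w), io w)).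
- by move=> u v; rewrite !linearD.
- by move=> a u; rewrite !linearZ.
(* The second component is the pullback condition: the extension [psi] and the quotient map q must
   agree in the interval of z. *)
have [||G GE] := @linear_intro _ (T0 * I (D i0))%type (T1 * I z)%type (fun x => (g x.1, psi x.1 - q x.2)).
- by move=> u v; rewrite !linearD /= -[LHS]/(_, _); apply: eq_pair => //=; rewrite addrACA.
- by move=> a u; rewrite !linearZ /=; apply: eq_pair => //=; rewrite -scalerDr.
exists (T0 * I (D i0))%type, (T1 * I z)%type, F, G; split.
- by apply: in_add_prod => //; exact: node_summand.
- by apply: in_add_prod => //; exact: node_summand.
- split.
  + move=> u v; rewrite !FE => -[/fI e1 e2]; apply: tcoef_inj => i j.
    case: (eqVneq i i0) => [->|ii]; first by rewrite -!ioC e2.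
    have := congr1 (fun w => tcoef w i j) e1; rewrite !pC b'i //.
    by case: ifP => // /negbT h _; rewrite !tcoef_out.
  + move=> [t d]; rewrite GE /=; split=> [[gt0 /eqP]|[w]]; last first.
      rewrite FE => -[<- <-]; apply: eq_pair => /=; first by apply/fg; exists (p w).
      apply/eqP; rewrite subr_eq0; apply/eqP/tcoef_inj => -[] j.
      rewrite psiE pC qC ioC b'0; case: (leqP i0 j) => ij; last first.
        by rewrite [tcoef w _ _]tcoef_out ?if_same //; lia.
      by case: ifP => h; case: ifP => h' //; lia.
    rewrite subr_eq0 => /eqP e; have [w' fw'] : exists x, f x = t by apply/fg.
    have dE (j : 'I_n) : (lo z <= j < hi z)%N -> tcoef d tt j = tcoef w' i0 j.
      by move=> h; rewrite -psiE fw' e qC h.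
    pose w : thin_mod k n (fun i : 'I_n => i : nat) beta :=
      of_tcoef _ _ (fun i j => if i == i0 then tcoef d tt j else tcoef w' i j).
    have wE i j : tcoef w i j = if i == i0 then tcoef d tt j else tcoef w' i j.
      rewrite of_tcoefK; case: ifP => // h; case: eqP => [ei|/eqP ii].
        rewrite ei -eb in h; case: (boolP (lo (D i0) <= j < hi (D i0))%N) => h'; last by rewrite tcoef_out.
        by rewrite dE; [rewrite tcoef_out //; lia|lia].
      by rewrite tcoef_out // -/(b' i) b'i // h.
    exists w; rewrite FE; apply: eq_pair => /=.
      rewrite -fw'; congr (f _); apply: tcoef_inj => i j; rewrite pC wE.
      case: ifP => [h|/negbT h]; last by rewrite tcoef_out.
      by case: eqP => // ei; rewrite ei b'0 in h; rewrite dE ?ei //; lia.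
    by apply: tcoef_inj => -[] j; rewrite ioC wE eqxx.
  + move=> [u e]; have [t gt] := gS u.
    exists (t, of_tcoef _ _ (fun _ j => tcoef (psi t - e) tt j)); rewrite GE /=; apply: eq_pair => //=.
    have -> : q (of_tcoef _ _ (fun _ j => tcoef (psi t - e) tt j)) = psi t - e.
      apply: tcoef_inj => -[] j; rewrite qC of_tcoefK; case: ifP => [h|/negbT h]; last by rewrite tcoef_out.
      by have -> : (lo (D i0) <= j < hi (D i0))%N by lia.
    by rewrite opprB addrC subrK.
- move=> i s ->; case: (eqVneq i i0) => [->|ii].
    have [||pr prE] := @linear_intro _ (T0 * I (D i0))%type (I (D i0)) snd; [by []|by []|].
    by exists pr => w j; rewrite prE FE /= ioC.
  have [|psi' psiE'] := psiP i (D i) _; first by rewrite /set_at (negbTE ii).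
  have [||pr prE] := @linear_intro _ (T0 * I (D i0))%type T0 fst; [by []|by []|].
  exists (psi' \o pr) => w j; rewrite /= prE FE /= psiE' pC b'i //.
  by case: ifP => // /negbT h; rewrite tcoef_out.
Qed.

(** Induction on the total length of the nodes D i: as long as some i lies in a child of D i, move
    it to that child. *)
Lemma left_approx_exists (D : 'I_n -> S) (beta : 'I_n -> nat) :
  (forall i, (lo (D i) <= i < hi (D i))%N /\ hi (D i) = beta i) -> left_approx D beta.
Proof.
move: {2}(\sum_i (hi (D i) - lo (D i)))%N (leqnn (\sum_i (hi (D i) - lo (D i))))%N => m.
elim: m D beta => [|m IH] D beta Dm H.
  apply: left_approx_base => i; have [r _] := H i; exfalso.
  by move: Dm; rewrite (bigD1 i) //=; lia.
have small i0 z : (hi z - lo z < hi (D i0) - lo (D i0))%N ->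
    (\sum_i (hi (set_at D i0 z i) - lo (set_at D i0 z i)) <= m)%N.
  move=> zs; rewrite -ltnS; apply: leq_trans Dm.
  rewrite (bigD1 i0) //= [X in (_ < X)%N](bigD1 i0) //= /set_at eqxx -addSn leq_add //.
  by apply: leq_sum => i /negbTE ->.
have [[i0 [z [zD zi]]]|none] := pselect (exists i0 z, child z (D i0) /\ (lo z <= i0 < hi z)%N).
  have zs := small i0 z (child_size tP zD).
  have [ri e0] := H i0.
  case: zD => [[e h _]|[e h _]].
    apply: (@left_approx_lchild _ _ i0 z) => //.
    - by case/andP: zi => _ ->; rewrite ltnW.
    - by move=> i; case: (H i).
    - apply: IH => // i; split=> //; rewrite /set_at; case: eqP => [->|_] //.
      by case: (H i).
  apply: (@left_approx_rchild _ _ i0 z) => //.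
  - by rewrite ltnW.
  - by case/andP: zi.
  - by rewrite e e0.
  apply: IH => [|i]; first exact: zs.
  rewrite /set_at; case: eqP => [->|_]; [rewrite e e0 in zi *|exact: H]; by split.
apply: left_approx_base => i; have [ri ei] := H i; split=> //.
have [t [lt L R]] := node_apex tP (D i).
(* A vertex lying in neither child of its node can only be the one labelling the apex. *)
suff et : t = i.
  by case: L => [[e _]|[z [[e _ _] e']]]; [left; rewrite e et|right; rewrite -et -e' -e; exact: nodeP].
case: (ltngtP t i) => // it; case: none; exists i.
  case: R => [[e _]|[z [rz e]]]; first by lia.
  by exists z; split; [right|case: rz => e' _ _; lia].
case: L => [[e _]|[z [lz e]]]; first by lia.
by exists z; split; [left|case: lz => e' _ _; lia].
Qed.

Lemma tree_tilting : tilting (TM : rmodType A).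
Proof.
split.
- exact: thin_finitely_generated.
- by apply: thin_pd_le1 => s; have := node_range tP s; lia.
- exact: tree_Ext1_zero.
have [r [r1 r2]] := root_exists tP.
have [|T0 [T1 [f [g [a0 a1 [fI fg gS] _]]]]] := @left_approx_exists (fun=> r) (fun=> n).
  by move=> i; rewrite r1 r2 ltn_ord.
(* All vertices start at the root with right end n. The sum of the [[i, n[] is the regular module,
   cut into the rows of triangular matrices. *)
have [||th thE] := @linear_intro A^c (A^c)^o (thin_mod k n (fun i : 'I_n => i : nat) (fun=> n))
    (fun u => of_tcoef _ _ (fun i j => pcoef (u : A) i j)).
- by move=> u v; apply: tcoef_inj => i j; rewrite tcoefD !of_tcoefK pcoefD; case: ifP; rewrite ?addr0.
- move=> a u; apply: tcoef_inj => i j; rewrite -[_ *: of_tcoef _ _ _]/(ract (_ : thin_mod k n _ _) a) tcoef_ract of_tcoefK.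
  case: ifP => // h; rewrite -[a *: u]/((u : A) * a) pcoefM; apply: eq_bigr => l _.
  rewrite of_tcoefK ltn_ord andbT; case: leqP => // li; by rewrite pcoef_lt.
have thC u i j : tcoef (th u) i j = pcoef (u : A) i j.
  by rewrite thE of_tcoefK ltn_ord andbT; case: leqP => // li; rewrite pcoef_lt.
have thI : injective th.
  by move=> u v e; apply: pcoef_inj => i j; rewrite -!thC e.
have thS w : exists u, th u = w.
  exists (of_pcoef (fun i j => tcoef w i j)); apply: tcoef_inj => i j.
  by rewrite thC of_pcoefK; case: leqP => // ji; rewrite tcoef_out // leqNgt ji.
exists T0, T1, (f \o th), g; split=> //; split=> //.
- by move=> u v /= /fI /thI.
- move=> y; rewrite fg; split=> [[x <-]|[x <-]]; last by exists (th x).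
  by have [u <-] := thS x; exists u.
Qed.

Lemma tree_basic : basic_module (TM : rmodType A).
Proof.
exists #|S|, (fun j => thin_mod k n (fun _ : unit => lo (enum_val j)) (fun=> hi (enum_val j))); split.
- exact: thin_direct_sum.
- by move=> j; apply: interval_indecomposable; exact: node_range.
- move=> j l /(interval_iso (node_range tP _) (node_range tP _))[e1 e2].
  by apply: enum_val_inj; apply: node_eq.
Qed.

End TreeTilting.

(** * The triangulation of a tilting module *)

Section RmodIso.
Variable R : pzRingType.

Lemma rmod_iso_sym (M N : rmodType R) : rmod_iso M N -> rmod_iso N M.
Proof.
by move=> [f fb]; have [g [fg gf]] := inverse_linear fb; exists g; exists f.
Qed.

Lemma rmod_iso_trans (M N L : rmodType R) : rmod_iso M N -> rmod_iso N L -> rmod_iso M L.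
Proof. by move=> [f fb] [g gb]; exists (g \o f); exact: bij_comp. Qed.

End RmodIso.

Section TiltingTree.
Variables (k : fieldType) (n : nat).
Local Notation A := (linear_path_algebra k n).
Local Notation E := (@punit k n).
Local Notation I a b := (thin_mod k n (fun _ : unit => a) (fun _ : unit => b)).

Lemma basic_module_intervals (T : rmodType A) : finitely_generated T -> basic_module T ->
  exists m (lo hi : 'I_m -> nat) (phi : {linear T -> thin_mod k n lo hi}),
    [/\ bijective phi, forall s, (lo s < hi s <= n)%N
      & forall s t, lo s = lo t -> hi s = hi t -> s = t].
Proof.
move=> [r [gen genP]] [m [X [[i [p [ip pi0 sumip]]] Xind Xiso]]].
have /choice[ab abP] : forall j, exists ab : nat * nat,
    (ab.1 < ab.2 <= n)%N /\ rmod_iso (X j) (I ab.1 ab.2).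
  move=> j; have [|a [b [ab iso]]] := indecomposable_interval _ (Xind j); last by exists (a, b).
  exists r, (fun l => p j (gen l)) => x; have [c cE] := genP (i j x).
  exists c; rewrite -[LHS](ip j) cE linear_sum; apply: eq_bigr => l _.
  by rewrite linearZ.
pose lo j := (ab j).1; pose hi j := (ab j).2.
have iso j : rmod_iso (X j) (I (lo j) (hi j)) by have [] := abP j.
pose f j := projT1 (cid (iso j)).
have fb j : bijective (f j) by rewrite /f; case: cid.
pose g j := projT1 (cid (inverse_linear (fb j))).
have fg j : cancel (f j) (g j) by rewrite /g; case: cid => ? /= [].
have gf j : cancel (g j) (f j) by rewrite /g; case: cid => ? /= [].
pose pr j := projT1 (cid (@thin_projection k n _ lo hi j)).
have prE j v l : tcoef (pr j v) tt l = tcoef v j l by rewrite /pr; case: cid => ? /= ->.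
have [||phi phiE] := @linear_intro _ T (thin_mod k n lo hi)
  (fun t => of_tcoef lo hi (fun j l => tcoef (f j (p j t)) tt l)).
- move=> u v; apply: tcoef_inj => j l; rewrite tcoefD !of_tcoefK !linearD tcoefD.
  by case: ifP; rewrite ?addr0.
- move=> a u; apply: tcoef_inj => j l; rewrite -[_ *: of_tcoef _ _ _]/(ract (_ : thin_mod k n lo hi) a).
  rewrite tcoef_ract of_tcoefK; case: ifP => // jl.
  rewrite !linearZ /= -[a *: _]/(ract _ a) tcoef_ract jl; apply: eq_bigr => t _.
  rewrite of_tcoefK; case: ifP => // /negbT h; by rewrite tcoef_out.
have phiC t j l : tcoef (phi t) j l = tcoef (f j (p j t)) tt l.
  by rewrite phiE of_tcoefK; case: ifP => // /negbT h; rewrite tcoef_out.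
exists m, lo, hi, phi; split.
- exists (fun w => \sum_j i j (g j (pr j w))) => [t|w].
    rewrite [RHS]sumip; apply: eq_bigr => j _; congr (i j _).
    apply: (can_inj (fg j)); rewrite gf; apply: tcoef_inj => -[] l.
    by rewrite prE phiC.
  apply: tcoef_inj => j l; rewrite phiC linear_sum (bigD1 j) //= big1 ?addr0 => [|t tj].
    by rewrite ip gf prE.
  by rewrite pi0.
- by move=> s; have [] := abP s.
- move=> s t e1 e2; apply: Xiso; apply: rmod_iso_trans (iso s) _.
  by rewrite e1 e2; apply: rmod_iso_sym.
Qed.

(** The extension has middle term [[a, d[] plus [[c, b[], the union and the intersection (empty if c
    = b). A section would send the generator to an element with coefficient 1 at a in [[a, d[]; the
    path from a to b kills the former but, as b < d, not the latter. *)
Lemma crossing_Ext1 a b c d : (a < c <= b)%N -> (b < d <= n)%N ->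
  ~ Ext1_zero (I a b : rmodType A) (I c d).
Proof.
move=> ac bd ext.
pose lo (e : bool) := if e then a else c; pose hi (e : bool) := if e then d else b.
have sumb (G : bool -> k) : \sum_e G e = G true + G false.
  by rewrite (bigD1 true) //= (big_pred1 false) // => -[].
have [|f fE] := @thin_map k n unit bool (fun=> c) (fun=> d) lo hi (fun _ _ => 1).
  by move=> _ [] _ /=; rewrite /lo /hi; lia.
have [|g gE] := @thin_map k n bool unit lo hi (fun=> a) (fun=> b) (fun e _ => if e then 1 else -1).
  by move=> [] _ _ /=; rewrite /lo /hi; lia.
have fC v e j : tcoef (f v) e j = if (lo e <= j < hi e)%N then tcoef v tt j else 0.
  by rewrite fE sum_unit mul1r.
have gC v j : tcoef (g v) tt j = if (a <= j < b)%N then tcoef v true j - tcoef v false j else 0.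
  by rewrite gE sumb mul1r mulN1r.
have ex : short_exact f g.
  split.
  - move=> u v e; apply: tcoef_inj => -[] j; have := congr1 (fun w => tcoef w true j) e.
    rewrite !fC /lo /hi; case: ifP => // /negbT h _; rewrite !tcoef_out //; lia.
  - move=> y; split=> [gy|[x <-]]; last first.
      apply: tcoef_inj => -[] j; rewrite gC !fC tcoef0 /lo /hi.
      case: ifP => // h; case: ifP => h1; case: ifP => h2; rewrite ?subrr ?subr0 //; last by lia.
      by rewrite tcoef_out //; lia.
    have yE (j : 'I_n) : (a <= j < b)%N -> tcoef y true j = tcoef y false j.
      move=> h; have := gC y j; rewrite gy tcoef0 h => /esym/eqP.
      by rewrite subr_eq0 => /eqP.
    exists (of_tcoef _ _ (fun _ j => tcoef y true j)); apply: tcoef_inj => -[] j;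
      rewrite fC of_tcoefK /lo /hi.
    + case: ifP => [h|/negbT h]; last by rewrite tcoef_out.
      case: ifP => // h'; rewrite yE ?tcoef_out //; rewrite ?/lo ?/hi; lia.
    + case: ifP => [h|/negbT h]; last by rewrite tcoef_out.
      by rewrite -yE; [case: ifP => //; lia|lia].
  - move=> z; exists (of_tcoef _ _ (fun e j => if e then tcoef z tt j else 0)).
    apply: tcoef_inj => -[] j; rewrite gC !of_tcoefK if_same subr0 /lo /hi.
    case: ifP => [h|/negbT h]; last by rewrite tcoef_out.
    by case: ifP => //; lia.
have [s sE] := ext _ _ _ ex.
have an : (a < n)%N by lia.
have bn : (b < n)%N by lia.
pose t := tgen k n (fun _ : unit => a) (fun=> b) tt.
have s1 : tcoef (s t) true (Ordinal an) = 1.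
  have := gC (s t) (Ordinal an); rewrite sE tcoef_tgen /= eqxx leqnn.
  have -> : (a < b)%N by lia.
  rewrite [tcoef _ false _]tcoef_out ?subr0; last by rewrite /lo /hi /=; lia.
  by move=> /= <-.
have : tcoef (ract (s t) (E a b)) true (Ordinal bn) = 1.
  rewrite tcoef_ract /lo /hi /=; case: ifP => [_|]; last by lia.
  rewrite (bigD1 (Ordinal an)) //= big1 ?addr0 => [|i ia].
    by rewrite s1 pcoef_punit /= !eqxx mul1r (_ : a <= b)%N //; lia.
  by rewrite pcoef_punit -[a in X in _ * X]/(nat_of_ord (Ordinal an)) val_eqE (negbTE ia) andbF mulr0.
rewrite -ract_linear tgen_kill // linear0 tcoef0 => /eqP.
by rewrite eq_sym oner_eq0.
Qed.

Variables (T : rmodType A) (m : nat) (lo hi : 'I_m -> nat).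
Variables (phi : {linear T -> thin_mod k n lo hi}) (psi : {linear thin_mod k n lo hi -> T}).
Hypotheses (phiK : cancel phi psi) (psiK : cancel psi phi).
Hypothesis lohi : forall s, (lo s < hi s <= n)%N.
Hypothesis tT : tilting T.

Lemma tilting_noncrossing s t : ~~ [&& lo s < lo t, lo t <= hi s & hi s < hi t]%N.
Proof.
apply/negP => st; have [_ _ ext _] := tT.
have [i1 i1E] := @thin_inclusion k n _ lo hi s; have [p1 p1E] := @thin_projection k n _ lo hi s.
have [i2 i2E] := @thin_inclusion k n _ lo hi t; have [p2 p2E] := @thin_projection k n _ lo hi t.
have /and3P[st1 st2 st3] := st; have /andP[_ tn] := lohi t.
apply: (@crossing_Ext1 (lo s) (hi s) (lo t) (hi t)); first by rewrite st1.
  by rewrite st3.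
apply: (@Ext1_zero_retract _ T _ _ (psi \o i1) (p1 \o phi) (psi \o i2) (p2 \o phi)) => // x /=;
  by rewrite psiK; apply: tcoef_inj => -[] j; rewrite ?p1E ?i1E ?p2E ?i2E eqxx.
Qed.

Lemma tcoef_ract_punit (w : thin_mod k n lo hi) (a b : 'I_n) s j : (a <= b)%N ->
  tcoef (ract w (E a b)) s j = if (lo s <= j < hi s)%N && (j == b) then tcoef w s a else 0.
Proof.
move=> ab; rewrite tcoef_ract; case: ifP => //= _.
rewrite (bigD1 a) //= big1 ?addr0 => [|i ia].
  by rewrite pcoef_punit ab eqxx /= val_eqE; case: eqP => _; rewrite ?mulr1 ?mulr0.
by rewrite pcoef_punit !val_eqE (negbTE ia) andbF mulr0.
Qed.

(* For Y = [a, b[, the hypothesis gives Ext^1(T, Y) = 0, so the generator of Y lifts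
   along A -> T' and Y is a quotient of some summand [a, hi s[. *)
Lemma tilting_generates a b : (a < b <= n)%N ->
  (forall s, ~~ [&& lo s < a, a <= hi s & hi s < b]%N) -> exists s, lo s = a /\ (b <= hi s)%N.
Proof.
move=> ab nc; apply: contrapT => none.
have [_ _ _ [T' [T'' [f [g [[m1 [i1 [p1 ip1]]] [m2 [i2 [p2 ip2]]] [fI fg gS]]]]]]] := tT.
have an : (a < n)%N by lia.
have b1n : (b.-1 < n)%N by lia.
pose oa := Ordinal an; pose ob := Ordinal b1n.
pose u0 : T' := f (E a a : A).
have u0E : ract u0 (E a b.-1) = f (E a b.-1 : A).
  rewrite /u0 -ract_linear; congr (f _).
  by rewrite -[LHS]/(E a a * E a b.-1 : A) punitM ?eqxx //; lia.
have Eab : (E a b.-1 : A) <> 0.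
  move/(congr1 (fun u => pcoef u oa ob)); rewrite pcoef_punit pcoef0 /= !eqxx.
  rewrite (_ : a <= b.-1)%N; last by lia.
  by move/eqP; rewrite oner_eq0.
have ffun_ract r := fun X i x (f' : A) l => @linear_ffunZ _ T X r i (f' : A^c) x l.
(* For a = 0, a summand seeing both a and b - 1 would start at a and reach b, which is excluded;
   hence that path kills u0, contradicting the injectivity of f. *)
case: (posnP a) => [a0|a0].
  have : ract u0 (E a b.-1) = 0.
    rewrite -(ip1 (ract _ _)) (_ : i1 _ = 0) ?linear0 //; apply/ffunP => l.
    rewrite ffun_ract ffunE; apply: (can_inj phiK).
    rewrite ract_linear linear0; apply: tcoef_inj => s j.
    rewrite (@tcoef_ract_punit _ oa ob) ?tcoef0; last by rewrite /=; lia.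
    case: ifP => // /andP[sj /eqP jb]; apply: contrapT => /tcoef_in /= sa.
    by apply: none; exists s; move: sj; rewrite jb /=; lia.
  by rewrite u0E => e; apply: Eab; apply: fI; rewrite e linear0.
have a1n : (a.-1 < n)%N by lia.
pose oa1 := Ordinal a1n.
(* A summand seeing a and b - 1 does not start at a, so it also contains a - 1, and the coefficient
   can be moved there. *)
have [v vE] : exists v, ract v (E a.-1 b.-1) = ract u0 (E a b.-1).
  exists (p1 [ffun l => psi (of_tcoef lo hi (fun s j =>
    if j == oa1 then tcoef (phi (i1 u0 l)) s oa else 0))]).
  rewrite -[RHS]ip1 -[ract (p1 _) _]linearZ; congr (p1 _); apply/ffunP => l.
  rewrite ffun_ract !ffunE -[_ *: psi _]/(ract (psi _) (E a.-1 b.-1)); apply: (can_inj phiK).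
  rewrite !ract_linear psiK; apply: tcoef_inj => s j.
  rewrite (@tcoef_ract_punit _ oa1 ob) ?(@tcoef_ract_punit _ oa ob); [|by rewrite /=; lia..].
  case: ifP => // /andP[sj /eqP jb]; rewrite of_tcoefK eqxx /=.
  case: ifP => // /negP h; apply: contrapT => /(fun h e => h (esym e)) /tcoef_in /= sa.
  move: sj; rewrite jb /= => sj; have [e|ne] := eqVneq (lo s) a; last by lia.
  by apply: none; exists s; split=> //; lia.
(* A summand containing a - 1 but not b - 1 is excluded by [nc]; on the others the path to b - 1 is
   injective. *)
have gv : g (ract v (E a.-1 a.-1)) = 0.
  have gv0 : ract (g v) (E a.-1 b.-1) = 0.
    by rewrite -ract_linear vE u0E; apply/fg; eexists.
  rewrite -[LHS]ip2 (_ : i2 _ = 0) ?linear0 //; apply/ffunP => l.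
  rewrite ract_linear ffun_ract ffunE; apply: (can_inj phiK).
  rewrite ract_linear linear0; apply: tcoef_inj => s j.
  rewrite (@tcoef_ract_punit _ oa1 oa1) // tcoef0.
  case: ifP => // /andP[sj /eqP ja]; apply: contrapT => nz.
  have := congr1 (fun w => tcoef (phi (i2 w l)) s ob) gv0.
  rewrite ffun_ract ract_linear (@tcoef_ract_punit _ oa1 ob); last by rewrite /=; lia.
  rewrite linear0 ffunE linear0 tcoef0 eqxx andbT.
  have := nc s; move: sj; rewrite ja /= => h1 h2.
  by case: ifP => // /negP; case; lia.
have [x xE] : exists x, f x = ract v (E a.-1 a.-1) by apply/fg.
(* So the path from a to b - 1 would factor in the path algebra through a - 1, though no path leads
   from a back to a - 1. *)
have xab : (x : A) * E a.-1 b.-1 = E a b.-1.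
  apply: fI; rewrite -u0E -vE; apply: (etrans (ract_linear f x (E a.-1 b.-1))).
  by rewrite xE -ractM punitM ?eqxx //; lia.
have := congr1 (fun u => pcoef u oa ob) xab.
rewrite pcoefM pcoef_punit /= !eqxx (_ : a <= b.-1)%N; last by lia.
rewrite big1 => [/eqP|j _]; first by rewrite eq_sym oner_eq0.
rewrite pcoef_punit; case: (j =P a.-1 :> nat) => [e|_]; last by rewrite andbF mulr0.
by rewrite pcoef_lt ?mul0r //= e; lia.
Qed.

Definition summand_rel l b := [exists s, (lo s == l) && (hi s == b)].

Lemma summand_relP l b : reflect (exists s, lo s = l /\ hi s = b) (summand_rel l b).
Proof.
apply: (iffP existsP) => -[s]; first by move=> /andP[/eqP ? /eqP ?]; exists s.
by move=> [<- <-]; exists s; rewrite !eqxx.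
Qed.

(* Let [a, b[ cross no summand, c be least with [a, c[ a summand and c >= b, and
   a' > a be least with a' = b or [a', b[ a summand. If b < c, then [a', c[ satisfies
   the hypothesis of tilting_generates, and a summand [a', d[ with d >= c would cross
   [a, b[. *)
Lemma tilting_triangulation : (0 < n)%N -> triangulation n summand_rel.
Proof.
move=> n0; have max l b : (l < b <= n)%N ->
    (forall l' b', summand_rel l' b' -> ~~ [&& l < l', l' <= b & b < b']%N && ~~ [&& l' < l, l <= b' & b' < b]%N) ->
    summand_rel l b.
  move=> lb nc.
  have ncs s : ~~ [&& l < lo s, lo s <= b & b < hi s]%N && ~~ [&& lo s < l, l <= hi s & hi s < b]%N.
    by apply: nc; apply/summand_relP; exists s.
  have [|s [s1 s2]] := tilting_generates lb; first by move=> s; case/andP: (ncs s).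
  pose Q c := (b <= c)%N && summand_rel l c.
  have exQ : exists c, Q c by exists (hi s); rewrite /Q s2; apply/summand_relP; exists s.
  case: (ex_minnP exQ) => c /andP[bc /summand_relP[t [t1 t2]]] cmin {s s1 s2}.
  have [<-|ne] := eqVneq c b; first by apply/summand_relP; exists t.
  pose Q' a := (l < a)%N && ((a == b) || summand_rel a b).
  have exQ' : exists a, Q' a by exists b; rewrite /Q' eqxx; lia.
  case: (ex_minnP exQ') => a /andP[la aP] amin.
  have ab : (a <= b)%N by apply: amin; rewrite /Q' eqxx; lia.
  have [||s [s1 s2]] := @tilting_generates a c.
  - by have := lohi t; lia.
  - move=> s; apply/negP => H.
    have h1 := tilting_noncrossing s t; have h2 := ncs s; have rs := lohi s.
    have hb : (b <= hi s)%N.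
      case/orP: aP => [/eqP <-|/summand_relP[z [z1 z2]]]; first by lia.
      by have := tilting_noncrossing s z; lia.
    have [e|ls] : lo s = l \/ (l < lo s)%N by lia.
      have : (c <= hi s)%N by apply: cmin; rewrite /Q hb; apply/summand_relP; exists s.
      lia.
    have e : hi s = b by lia.
    have : (a <= lo s)%N by apply: amin; rewrite /Q' ls; apply/orP; right; apply/summand_relP; exists s.
    lia.
  by have := ncs s; lia.
split=> //.
- by move=> l b /summand_relP[s [<- <-]].
- apply: max => [|l b /summand_relP[s [<- <-]]]; [by rewrite n0 leqnn|by have := lohi s; lia].
- by move=> l b l' b' /summand_relP[s [<- <-]] /summand_relP[t [<- <-]]; exact: tilting_noncrossing.
Qed.

End TiltingTree.

(** * Dissections of the surface *)

Section SurfaceTree.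
Variable n : nat.
Implicit Types (c d : {set point n}) (G H : {set {set point n}}).

Lemma inord3 i : (i < n.+3)%N -> (inord i : 'I_n.+3) = i :> nat.
Proof. exact: inordK. Qed.

Lemma pair_set_inj (a b u v : 'I_n.+3) : (a < b)%N -> (u < v)%N ->
  [set a; b] = [set u; v] -> a = u /\ b = v.
Proof.
move=> ab uv e.
have : a \in [set u; v] by rewrite -e set21.
have : b \in [set u; v] by rewrite -e set22.
have : u \in [set a; b] by rewrite e set21.
rewrite !inE => /orP[]/eqP h1 /orP[]/eqP h2 /orP[]/eqP h3; subst; try by split.
all: by rewrite ?ltnn in ab uv; try lia.
Qed.

Definition tcurve l b : {set point n} := [set inord l.+1; inord b.+2].

Definition tree_of G l b : bool := (l < b <= n)%N && (tcurve l b \in G).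

Lemma curve_P1E : curve_P1 n = tcurve 0 n.
Proof. by []. Qed.

Lemma tcurve_inj l b l' b' : (l < b <= n)%N -> (l' < b' <= n)%N ->
  tcurve l b = tcurve l' b' -> l = l' /\ b = b'.
Proof.
move=> lb lb' /pair_set_inj[]; rewrite ?inord3; try lia.
by move=> /(congr1 val) /= + /(congr1 val) /=; rewrite !inord3; lia.
Qed.

Lemma interleave_pair (a b u v : 'I_n.+3) : (a < b)%N -> (u < v)%N ->
  interleave [set a; b] [set u; v] = [&& a < u, u < b & b < v]%N.
Proof.
move=> ab uv; apply/existsP/idP => [[a' /existsP[b' /existsP[u' /existsP[v']]]]|h].
  case/and3P=> /eqP e1 /eqP e2 /andP[/andP[h1 h2] h3].
  have [|-> ->] := pair_set_inj ab _ e1; first by lia.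
  have [|-> ->] := pair_set_inj uv _ e2; first by lia.
  by rewrite h1 h2.
exists a; apply/existsP; exists b; apply/existsP; exists u; apply/existsP; exists v.
by rewrite !eqxx; case/and3P: h => -> -> ->.
Qed.

(** The end points are numbered l + 1 and b + 2, so the strict alternation l' + 1 < b + 2 becomes
    the weak inequality l' <= b. *)
Lemma tcurve_cross l b l' b' : (l < b <= n)%N -> (l' < b' <= n)%N ->
  cross (tcurve l b) (tcurve l' b') =
  [&& l < l', l' <= b & b < b']%N || [&& l' < l, l <= b' & b' < b]%N.
Proof.
move=> lb lb'; rewrite /cross !interleave_pair; rewrite ?inord3; lia.
Qed.

Lemma tcurve_ok l b : (l < b <= n)%N ->
  is_curve (tcurve l b) && ~~ is_boundary_segment (tcurve l b).
Proof.
move=> lb; rewrite /is_curve cards2 -val_eqE /= !inord3; try lia.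
apply/andP; split; first by lia.
apply/existsPn => a; apply/eqP => e.
have ha := ltn_ord a.
have : inord l.+1 \in [set a; ordS a] by rewrite -e set21.
have : inord b.+2 \in [set a; ordS a] by rewrite -e set22.
rewrite !inE -!val_eqE /= !inord3; try lia.
case: (ltnP a.+1 n.+3) => h; first by rewrite modn_small //; lia.
have -> : a.+1 = n.+3 by lia.
rewrite modnn; lia.
Qed.

(** The other curves end at p, which is the point 0: those to x_0 and x_(n+1) are boundary segments,
    and the rest cross c_P(1). *)
Lemma partial_curve H c : partial_dissection H -> curve_P1 n \in H -> c \in H ->
  exists l b, (l < b <= n)%N /\ c = tcurve l b.
Proof.
move=> /andP[/forall_inP ok /forall_inP nc] rH cH.
have /andP[/cards2P[u [v [uv cE]]] nb] := ok c cH.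
wlog ltuv : u v uv cE / (u < v)%N.
  move=> W; case: (ltngtP u v) => h; first exact: (W u v).
    by apply: (W v u) => //; [rewrite eq_sym|rewrite cE setUC].
  by case/eqP: uv; apply: val_inj.
have nb1 : ordS u != v.
  by apply: contra nb => /eqP e; apply/existsP; exists u; rewrite e cE.
have nb2 : ordS v != u.
  by apply: contra nb => /eqP e; apply/existsP; exists v; rewrite e cE setUC.
have hv := ltn_ord v.
move: nb1 nb2; rewrite -!val_eqE /= modn_small; last by lia.
have u0 : (v.+1 < n.+3)%N || (v.+1 == n.+3) by lia.
case/orP: u0 => [sv|/eqP sv]; [rewrite modn_small // => h1 h2|rewrite sv modnn => h1 h2].
  have u1 : (0 < u)%N.
    rewrite lt0n; apply/eqP => u0.
    have := forall_inP (nc _ cH) _ rH; rewrite cE curve_P1E /cross !interleave_pair ?inord3 //; lia.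
  exists u.-1, v.-2; split; first by lia.
  rewrite cE /tcurve; congr [set _; _]; apply: val_inj; rewrite /= inord3; lia.
exists u.-1, v.-2; split; first by lia.
rewrite cE /tcurve; congr [set _; _]; apply: val_inj; rewrite /= inord3; lia.
Qed.

Lemma cross_sym c d : cross c d = cross d c.
Proof. by rewrite /cross orbC. Qed.

Section OfDissection.
Variable G : {set {set point n}}.
Hypotheses (n0 : (0 < n)%N) (dG : generalized_dissection G) (rG : curve_P1 n \in G).

Let pG : partial_dissection G. Proof. by have /maxsetP[] := dG. Qed.

Lemma dissection_triangulation : triangulation n (tree_of G).
Proof.
have /andP[/forall_inP ok /forall_inP nc] := pG.
split.
- by move=> l b /andP[].
- by rewrite /tree_of -curve_P1E rG n0 leqnn.
- move=> l b l' b' /andP[r1 c1] /andP[r2 c2].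
  have := forall_inP (nc _ c1) _ c2; rewrite tcurve_cross //; lia.
- move=> l b lb H; rewrite /tree_of lb /=.
  (* By maximality it suffices that adding the curve leaves a partial dissection. *)
  have /maxsetP[_ mx] := dG; rewrite -(mx (tcurve l b |: G)) ?setU11 ?subsetU1 //.
  have nc1 d : d \in G -> ~~ cross (tcurve l b) d.
    move=> dG'; have [l' [b' [lb' e]]] := partial_curve pG rG dG'.
    rewrite e tcurve_cross //; have := H l' b'; rewrite /tree_of lb' -e dG' => /(_ isT).
    lia.
  apply/andP; split; apply/forall_inP => c; rewrite !inE => /orP[/eqP->|cG].
  + exact: tcurve_ok.
  + exact: ok.
  + apply/forall_inP => d; rewrite !inE => /orP[/eqP->|]; last exact: nc1.
    by rewrite tcurve_cross //; lia.
  + apply/forall_inP => d; rewrite !inE => /orP[/eqP->|dG'].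
      by rewrite cross_sym nc1.
    exact: (forall_inP (nc _ cG)).
Qed.

Lemma dissection_memE c : c \in G <-> exists l b, tree_of G l b /\ c = tcurve l b.
Proof.
split=> [cG|[l [b [/andP[_ ?] -> //]]]].
have [l [b [lb e]]] := partial_curve pG rG cG.
by exists l, b; rewrite /tree_of lb -e.
Qed.

(** Sorted vertices of a complete triangle are x_l, x_(t+1), x_(b+1), none of them p, and its sides
    are the node [[l, b[] with the children [[l, t[] and [[t+1, b[]. *)
Lemma complete_triangle_branching :
  (exists t, is_complete_triangle G t) <-> exists y : node n (tree_of G), branching y.
Proof.
have tG := dissection_triangulation.
split=> [[t /andP[/andP[/eqP t3 _] /forall_inP tc]]|[y [z [z' [l r]]]]].
  have [x [y [w [[xt yt wt] xy yw]]]] : exists x y w : 'I_n.+3,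
      [/\ [/\ x \in t, y \in t & w \in t], (x < y)%N & (y < w)%N].
    have /card_gt2P[x [y [w [[xt yt wt] [xy yw wx]]]]] : (2 < #|t|)%N by rewrite t3.
    move: xy yw wx; rewrite -!val_eqE /= => xy yw wx.
    case: (ltngtP x y) xy => // h1 _; case: (ltngtP y w) yw => // h2 _;
      case: (ltngtP w x) wx => // h3 _; try by lia.
    - by exists x, y, w.
    - by exists w, x, y.
    - by exists x, w, y.
    - by exists y, w, x.
    - by exists y, x, w.
    - by exists w, y, x.
  have mem u v : u \in t -> v \in t -> (u < v)%N -> [set u; v] \in G.
    move=> ut vt uv; have /forall_inP/(_ v vt)/implyP := tc u ut; apply.
    by apply/eqP => e; rewrite e ltnn in uv.
  have cv u v : u \in t -> v \in t -> (u < v)%N ->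
      exists l b, [/\ tree_of G l b, u = l.+1 :> nat & v = b.+2 :> nat].
    move=> ut vt uv; have /dissection_memE[l [b [lb]]] := mem u v ut vt uv.
    have := tri_range tG lb => lb' /pair_set_inj[]//; rewrite ?inord3; try lia.
    move=> /(congr1 val) /= + /(congr1 val) /=; rewrite !inord3; try lia.
    by move=> h1 h2; exists l, b.
  have [l1 [b1 [p1 e1 e1']]] := cv _ _ xt yt xy.
  have [l2 [b2 [p2 e2 e2']]] := cv _ _ yt wt yw.
  have [l3 [b3 [p3 e3 e3']]] := cv _ _ xt wt (ltn_trans xy yw).
  have [? ? ?] : [/\ l1 = l3, b2 = b3 & l2 = b1.+1] by split; lia.
  subst l1 b2 l2.
  have [v [v1 v2]] := node_exists tG p3; have [v' [v1' v2']] := node_exists tG p1.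
  have [v'' [v1'' v2'']] := node_exists tG p2.
  exists v, v', v''; split; split; rewrite ?v1 ?v2 ?v1' ?v2' ?v1'' ?v2'' //; try lia; by right.
(* The two children must belong to the same triangle: the third side of z is itself a right child of
   y, and right children are unique. *)
have rz' : lchild y z -> rchild y z' -> nlo z' = (nhi z).+1.
  move=> [e1 h1 [e|p]] r'.
    by case: r' => e2 h2 _; have := node_nc tG z z'; have := node_range tG z'; lia.
  have [w [w1 w2]] := node_exists tG p.
  rewrite (rchild_uniq tG r' (_ : rchild y w)) //; split=> //.
    by have := node_range tG z; lia.
  by right; rewrite w1 /= -e1; exact: nodeP.
have e := rz' l r; have ry := node_range tG y; have rz := node_range tG z.
have rr := node_range tG z'.
have [/andP[_ my] /andP[_ mz] /andP[_ mz']] : [/\ tree_of G (nlo y) (nhi y), tree_of G (nlo z) (nhi z)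
   & tree_of G (nlo z') (nhi z')] by split; exact: nodeP.
case: l => e1 h1 _; case: r => e2 h2 _.
pose A : 'I_n.+3 := inord (nlo y).+1; pose B : 'I_n.+3 := inord (nhi z).+2; pose C : 'I_n.+3 := inord (nhi y).+2.
have vA : A = (nlo y).+1 :> nat by rewrite inord3; lia.
have vB : B = (nhi z).+2 :> nat by rewrite inord3; lia.
have vC : C = (nhi y).+2 :> nat by rewrite inord3; lia.
have mAB : [set A; B] \in G by move: mz; rewrite /tcurve e1.
have mBC : [set B; C] \in G by move: mz'; rewrite /tcurve e e2.
have mAC : [set A; C] \in G by exact: my.
have full a b : a \in [set A; B; C] -> b \in [set A; B; C] -> a != b -> [set a; b] \in G.
  rewrite !inE => /orP[/orP[]|]/eqP-> /orP[/orP[]|]/eqP->; rewrite ?eqxx // => _;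
    rewrite ?mAB ?mBC ?mAC //; by rewrite setUC.
exists [set A; B; C]; apply/andP; split; [apply/andP; split|].
- by rewrite -setUA !cardsU1 cards1 !inE -!val_eqE /=; lia.
- by apply/forall_inP => a ha; apply/forall_inP => b hb; apply/implyP => ab; rewrite full.
- by apply/forall_inP => a ha; apply/forall_inP => b hb; apply/implyP => ab; rewrite full.
Qed.

End OfDissection.

Lemma triangulation_dissection P : (0 < n)%N -> triangulation n P ->
  exists G, [/\ generalized_dissection G, curve_P1 n \in G & forall l b, tree_of G l b = P l b].
Proof.
move=> n0 tP.
pose G := [set tcurve (x : 'I_n.+1 * 'I_n.+1).1 x.2 | x in [pred x : 'I_n.+1 * 'I_n.+1 | P x.1 x.2]].
have memG l b : P l b -> tcurve l b \in G.
  move=> p; have r := tri_range tP p.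
  have h1 : (l < n.+1)%N by lia.
  have h2 : (b < n.+1)%N by lia.
  by apply/imsetP; exists (Ordinal h1, Ordinal h2).
have Gmem c : c \in G -> exists l b, P l b /\ c = tcurve l b.
  by case/imsetP => -[l b] /= p ->; exists l, b.
have rG : curve_P1 n \in G by rewrite curve_P1E memG //; exact: tri_root tP.
have nc l b l' b' : P l b -> P l' b' -> ~~ cross (tcurve l b) (tcurve l' b').
  move=> p p'; rewrite tcurve_cross ?(tri_range tP p) ?(tri_range tP p') // negb_or.
  by rewrite (tri_nc tP p p') (tri_nc tP p' p).
exists G; split=> //.
- apply/maxsetP; split.
    apply/andP; split; apply/forall_inP => c /Gmem[l [b [p ->]]].
      by apply: tcurve_ok; exact (tri_range tP p).
    by apply/forall_inP => d /Gmem[l' [b' [p' ->]]]; exact: nc.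
  move=> H pH GH; apply/eqP; rewrite eqEsubset GH andbT; apply/subsetP => c cH.
  have [l [b [lb e]]] := partial_curve pH (subsetP GH _ rG) cH.
  rewrite e; apply: (memG); apply: (tri_max tP) => // l' b' p'.
  have /andP[_ /forall_inP ncH] := pH.
  have := forall_inP (ncH _ cH) _ (subsetP GH _ (memG _ _ p')).
  by rewrite e tcurve_cross ?(tri_range tP p') // negb_or.
- move=> l b; apply/andP/idP => [[lb /Gmem[l' [b' [p e]]]]|p].
    by have [-> ->] := tcurve_inj lb (tri_range tP p) e.
  by rewrite memG //; split=> //; exact (tri_range tP p).
Qed.

End SurfaceTree.

(** * Algebras of triangulations and the bijection *)

Section TreeAlgebra.
Variables (n : nat) (P : nat -> nat -> bool).
Hypothesis tP : triangulation n P.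
Local Notation S := (node n P).
Local Notation lo := (@nlo n P).
Local Notation hi := (@nhi n P).

(** A composite from x through y to z that vanishes is a proper injection followed by a proper
    surjection; then x lies below a right child of y and z below a left child. *)
Lemma not_branching_trans : ~ (exists y : S, branching y) ->
  forall x y z : S, nhom x y -> nhom y z -> nhom x z.
Proof.
move=> nb x y z xy yz; apply: contraT => nxz.
have rx := node_range tP x; have ry := node_range tP y; have rz := node_range tP z.
have nzx := node_nc tP z x; move: xy yz nxz; rewrite !(nhomE tP) => xy yz nxz.
have [h1 h2 h3 h4] : [/\ hi x = hi y, (lo y < lo x)%N, lo z = lo y & (hi z < hi y)%N] by split; lia.
case: nb; exists y.
have [||c [[lc|rc] xc]] := @inside_child _ _ tP y x.
- by rewrite /inside h1 ltnW ?leqnn.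
- by move=> e; rewrite e ltnn in h2.
- by case: lc => _ + _; move: xc; rewrite /inside; lia.
have [||d [[ld|rd] zd]] := @inside_child _ _ tP y z.
- by rewrite /inside h3 leqnn ltnW.
- by move=> e; rewrite e ltnn in h4.
- by exists d, c.
- by case: rd => _ + _; move: zd; rewrite /inside; lia.
Qed.

Variables (k : fieldType) (S' : finType) (sg : S' -> S) (R : algType k) (c : R -> S' -> S' -> k).
Hypotheses (sgb : bijective sg) (taR : thin_alg (thin_rel (lo \o sg) (hi \o sg)) c).

Lemma tree_rel_antisym x y :
  thin_rel (lo \o sg) (hi \o sg) x y -> thin_rel (lo \o sg) (hi \o sg) y x -> x = y.
Proof. by move=> h1 h2; apply: (bij_inj sgb); exact: (nhom_antisym tP h2 h1). Qed.

Lemma tree_alg_hereditary : ~ (exists y : S, branching y) -> hereditary R.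
Proof.
move=> nb; apply: (ta_hereditary taR tree_rel_antisym).
  by move=> x y z h1 h2; exact: (not_branching_trans nb h2 h1).
move=> x y y' z h1 h2 h3 h4.
(* By transitivity the map from z to x is a surjection or an injection, so y and y' both have the
   end common to z and x and are nested. *)
have h5 : nhom (sg z) (sg x) := not_branching_trans nb h3 h1.
have := node_range tP (sg y); have := node_range tP (sg y').
have := node_range tP (sg x); have := node_range tP (sg z).
move: h1 h2 h3 h4 h5; rewrite (nhomE tP) /thin_rel /=; lia.
Qed.

Lemma tree_alg_not_hereditary : (exists y : S, branching y) -> ~ hereditary R.
Proof.
move=> [y [z [z' [l r]]]]; have [tu st ts] := sgb.
have [h1 h2 h3] : [/\ narrow z' y, narrow y z & ~~ nhom z' z] by apply/(zero_relationE tP).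
have [h1' _ _] := h1; have [h2' _ _] := h2.
apply: (ta_not_hereditary taR (x := tu z) (y := tu y) (z := tu z')).
- by rewrite /thin_rel /= !ts.
- by rewrite /thin_rel /= !ts.
- by rewrite /thin_rel /= !ts.
Qed.

End TreeAlgebra.

Section Main.
Variables (k : fieldType) (n : nat).
Hypothesis n0 : (0 < n)%N.
Local Notation A := (linear_path_algebra k n).

Definition tree_thin_alg P (B : algType k) : Prop :=
  exists c, thin_alg (thin_rel (@nlo n P) (@nhi n P)) (R := B) c.

Lemma tree_algebra_exists P : triangulation n P -> exists B, tree_thin_alg P B.
Proof.
move=> tP; have [r _] := root_exists tP.
have [||B [c cB]] := @thin_alg_exists k _ (thin_rel (@nlo n P) (@nhi n P)) r; last by exists B, c.
  exact: (thin_rel_refl (node_range tP)).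
exact: thin_rel_conv.
Qed.

Lemma tree_algebra_tilted P B : triangulation n P -> tree_thin_alg P B -> tilted_algebra n B.
Proof.
move=> tP [c cB]; exists (thin_mod k n (@nlo n P) (@nhi n P)); split.
- exact: tree_tilting.
- exact: tree_basic.
- exact: (thin_algebra_end (node_range tP) cB).
Qed.

Lemma tree_algebra_hereditary P B : triangulation n P -> tree_thin_alg P B ->
  (exists y : node n P, branching y) <-> ~ hereditary B.
Proof.
move=> tP [c cB]; have idb : bijective (@id (node n P)) by exists id.
split=> [/(tree_alg_not_hereditary tP idb cB) //|nh].
by apply: contrapT => nb; apply: nh; exact: (tree_alg_hereditary tP idb cB).
Qed.

Lemma tree_algebra_iso P P' B B' : triangulation n P -> triangulation n P' ->
  tree_thin_alg P B -> tree_thin_alg P' B' -> alg_iso B B' ->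
  (exists y : node n P, branching y) -> forall l b, P l b = P' l b.
Proof.
move=> tP tP' [c cB] [c' cB'] iso br.
have [||sg [[tu st ts] sgE]] := thin_alg_iso_rel cB cB' _ _ iso.
- by move=> x y h1 h2; exact: (nhom_antisym tP h2 h1).
- by move=> x y h1 h2; exact: (nhom_antisym tP' h2 h1).
apply: (triangulation_eq tP tP' st ts _ br) => x y; exact: sgE.
Qed.

(** Heredity is compared through the tree, where both algebras depend on the same branching
    condition, so it need not be transported along the isomorphism. *)
Lemma tilted_algebra_tree B : tilted_algebra n B ->
  exists P, triangulation n P /\ forall B', tree_thin_alg P B' ->
    alg_iso B B' /\ (hereditary B' -> hereditary B).
Proof.
move=> [T [tT bT eT]]; have [fgT _ _ _] := tT.
have [m [lo [hi [phi [phib lohi inj]]]]] := basic_module_intervals fgT bT.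
have [psi [pK Kp]] := inverse_linear phib.
have tP := tilting_triangulation pK Kp lohi tT n0.
exists (summand_rel lo hi); split=> // B' [c' cB'].
have [c cB] := end_algebra_thin lohi phib eT.
have /choice[sg sgE] : forall s, exists x : node n (summand_rel lo hi), nlo x = lo s /\ nhi x = hi s.
  by move=> s; apply: (node_exists tP); apply/summand_relP; exists s.
have /choice[tu tuE] : forall x : node n (summand_rel lo hi), exists s, lo s = nlo x /\ hi s = nhi x.
  by move=> x; apply/summand_relP; exact: nodeP.
have st : cancel sg tu.
  by move=> s; have [a b] := sgE s; have [a' b'] := tuE (sg s); apply: inj; rewrite ?a' ?b'.
have ts : cancel tu sg.
  by move=> s; have [a b] := tuE s; have [a' b'] := sgE (tu s); apply: node_eq; rewrite ?a' ?b'.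
have sgb : bijective sg by exists tu.
have er : thin_rel (@nlo n _ \o sg) (@nhi n _ \o sg) = thin_rel lo hi.
  apply: funext => x; apply: funext => y.
  by rewrite /thin_rel /=; have [-> ->] := sgE x; have [-> ->] := sgE y.
split.
  apply: (thin_alg_iso cB cB' sgb) => x y.
  by rewrite /thin_rel; have [-> ->] := sgE x; have [-> ->] := sgE y.
move=> hB'; have nb : ~ (exists y : node n (summand_rel lo hi), branching y).
  by move=> /(tree_algebra_hereditary tP (ex_intro _ c' cB')).
rewrite -er in cB.
exact: (tree_alg_hereditary tP sgb cB nb).
Qed.

Lemma iso_class_eq (B B' : algType k) : iso_class B = iso_class B' <-> alg_iso B B'.
Proof.
split=> [e|iso].
  by have := alg_iso_refl B'; rewrite -[alg_iso B' B']/(iso_class B' B') -e.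
apply: funext => C; apply: propext; split=> h.
  exact: alg_iso_trans (alg_iso_sym iso) h.
exact: alg_iso_trans iso h.
Qed.

Lemma bijective_of_inj_surj (X Y : Type) (f : X -> Y) :
  injective f -> (forall y, exists x, f x = y) -> bijective f.
Proof.
move=> fI fS; pose g y := projT1 (cid (fS y)).
have gE y : f (g y) = y by rewrite /g; case: cid.
by exists g => // x; apply: fI; rewrite gE.
Qed.

End Main.

Theorem proposition1p4 (k : closedFieldType) (n : nat) (hn : (1 <= n)%N) :
  exists f : {G : {set {set point n}} |
                [/\ generalized_dissection G, curve_P1 n \in G
                  & exists t, is_complete_triangle G t]} ->
             {C : algType k -> Prop |
                exists B : algType k,
                  [/\ tilted_algebra n B, ~ hereditary B & C = iso_class B]},
    bijective f.
Proof.
pose X := {G : {set {set point n}} | [/\ generalized_dissection G, curve_P1 n \in G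
  & exists t, is_complete_triangle G t]}.
have tX (G : X) : triangulation n (tree_of (sval G)).
  by case: G => G /= [dG rG _]; exact: dissection_triangulation.
have bX (G : X) : exists y : node n (tree_of (sval G)), branching y.
  by case: G => G /= [dG rG cG]; apply/complete_triangle_branching.
pose alg (G : X) : algType k := projT1 (cid (tree_algebra_exists k (tX G))).
have algP (G : X) : tree_thin_alg n (tree_of (sval G)) (alg G) by rewrite /alg; case: cid.
have fP (G : X) : exists B : algType k, [/\ tilted_algebra n B, ~ hereditary B & iso_class (alg G) = iso_class B].
  exists (alg G); split=> //; first exact: tree_algebra_tilted (tX G) (algP G).
  exact/(tree_algebra_hereditary (tX G) (algP G)).
exists (fun G => exist _ (iso_class (alg G)) (fP G)).
apply: bijective_of_inj_surj.
- move=> G G' /(congr1 sval) /= /iso_class_eq iso.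
  have e := tree_algebra_iso (tX G) (tX G') (algP G) (algP G') iso (bX G).
  have [dG rG _] := svalP G; have [dG' rG' _] := svalP G'.
  have GG' : sval G = sval G'; last by apply: eq_sig_hprop => // x; exact: Prop_irrelevance.
  apply/setP => c; apply/idP/idP.
    move/(dissection_memE dG rG) => [l [b [h ->]]]; apply/(dissection_memE dG' rG').
    by exists l, b; rewrite -e.
  move/(dissection_memE dG' rG') => [l [b [h ->]]]; apply/(dissection_memE dG rG).
  by exists l, b; rewrite e.
- move=> [C [B [tB nB eC]]].
  have [P [tP PB]] := tilted_algebra_tree hn tB.
  have [G [dG rG eG]] := triangulation_dissection hn tP.
  have eG' : tree_of G = P by apply: funext => l; apply: funext => b.
  subst P.
  (* Since B is not hereditary, neither is an algebra built from its tree, which therefore has a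
     branching node. *)
  have cG : exists t, is_complete_triangle G t.
    apply/(complete_triangle_branching hn dG rG).
    have [B' tB'] := tree_algebra_exists k tP.
    by apply/(tree_algebra_hereditary tP tB') => /(proj2 (PB B' tB')).
  pose g : X := exist _ G (And3 dG rG cG).
  exists g; apply: eq_exist => /=; rewrite eC; apply/iso_class_eq/alg_iso_sym.
  by have [] := PB _ (algP g).
Qed.
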